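(* Let $(X,\mathcal B,\mu,T)$ be a nonsingular transformation. Then $T$ is locally compact ergodic with isometric coefficients (LCEIC) if and only if $T$ is weakly mixing (WM).
   Context: $(X,\mathcal B,\mu)$ is a standard Borel space with a nonatomic $\sigma$-finite measure; transformations are assumed invertible (on a set of full measure, with measurable inverse). $T$ is nonsingular if it is measurable and $\mu(A)=0$ if and only if $\mu(T^{-1}A)=0$. A transformation is ergodic if $\mu(T^{-1}A\triangle A)=0$ implies $\mu(A)=0$ or $\mu(A^c)=0$. LCEIC: $(X,\mathcal B,\mu,T)$ is locally compact ergodic with isometric coefficients if for every locally compact metric space $(Y,d)$, every invertible isometry $S:Y\to Y$, and every Borel map $\phi:X\to Y$ with $S\circ\phi=\phi\circ T$ $\mu$-a.e., the map $\phi$ is constant $\mu$-a.e. WM: $T$ is weakly mixing if for every ergodic measure-preserving transformation $(Y,m,S)$ of a probability space, the transformation $T\times S$ is ergodic on $X\times Y$ with respect to the product measure $\mu\otimes m$. *)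

(* Defs.v *)
From HB Require Import structures.
From mathcomp Require Import all_boot all_order all_algebra.
From mathcomp Require Import all_classical all_reals all_analysis.
Set Implicit Arguments.
Unset Strict Implicit.
Unset Printing Implicit Defensive.
Import Order.TTheory GRing.Theory Num.Theory.
Import numFieldNormedType.Exports.

Local Open Scope classical_set_scope.
Local Open Scope ring_scope.

Definition borel_set (Y : topologicalType) : set (set Y) := <<s @open Y >>.

(* The library's completeType requires a base point, hence the unbundled
   completeness condition. *)
Definition complete_space (Y : uniformType) : Prop :=
  forall F : set_system Y, ProperFilter F -> cauchy F -> exists y : Y, F --> y.

Definition separable_space (Y : topologicalType) : Prop :=
  exists2 D : set Y, countable D & dense D.

Definition standard_borel (R : realType) (d : measure_display)
    (X : measurableType d) : Prop :=
  exists P : metricType R,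
    [/\ complete_space P, separable_space P &
        exists f : X -> P, bijective f /\
          forall A : set X, measurable A <-> borel_set (f @` A)].

Definition nonatomic (R : realType) (d : measure_display)
    (X : measurableType d) (mu : set X -> \bar R) : Prop :=
  forall A : set X, measurable A -> (0 < mu A)%E ->
    exists B : set X, [/\ measurable B, B `<=` A, (0 < mu B)%E & (mu B < mu A)%E].

Definition nonsingular (R : realType) (d : measure_display)
    (X : measurableType d) (mu : set X -> \bar R) (T : X -> X) : Prop :=
  measurable_fun setT T /\
  forall A : set X, measurable A -> (mu A = 0%E <-> mu (T @^-1` A) = 0%E).

(* Only the restriction of T' to X0 matters. *)
Definition invertible_mod0 (R : realType) (d : measure_display)
    (X : measurableType d) (mu : set X -> \bar R) (T : X -> X) : Prop :=
  exists (X0 : set X) (T' : X -> X),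
    [/\ measurable X0, mu (~` X0) = 0%E, set_bij X0 X0 T,
        measurable_fun X0 T' & forall x, X0 x -> T' (T x) = x].

Definition measure_preserving (R : realType) (d : measure_display)
    (X : measurableType d) (mu : set X -> \bar R) (T : X -> X) : Prop :=
  measurable_fun setT T /\
  forall A : set X, measurable A -> mu (T @^-1` A) = mu A.

Definition ergodic (R : realType) (d : measure_display)
    (X : measurableType d) (mu : set X -> \bar R) (T : X -> X) : Prop :=
  forall A : set X, measurable A -> mu (T @^-1` A `+` A) = 0%E ->
    mu A = 0%E \/ mu (~` A) = 0%E.

Definition isometry (R : realType) (Y : metricType R) (S : Y -> Y) : Prop :=
  forall y z : Y, mdist (S y) (S z) = mdist y z.

(* borel_map is not stated with measurable_fun because g_sigma_algebraType
   carries a measurable structure only over pointed types. *)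
Definition borel_map (d : measure_display) (X : measurableType d)
    (Y : topologicalType) (phi : X -> Y) : Prop :=
  forall B : set Y, borel_set B -> measurable (phi @^-1` B).

Definition LCEIC (R : realType) (d : measure_display)
    (X : measurableType d) (mu : set X -> \bar R) (T : X -> X) : Prop :=
  forall (Y : metricType R) (S : Y -> Y) (phi : X -> Y),
    locally_compact [set: Y] -> bijective S -> isometry S -> borel_map phi ->
    {ae mu, forall x, S (phi x) = phi (T x)} ->
    exists c : Y, {ae mu, forall x, phi x = c}.

Definition weakly_mixing (R : realType) (d : measure_display)
    (X : measurableType d) (mu : set X -> \bar R) (T : X -> X) : Prop :=
  forall (d' : measure_display) (Y : measurableType d') (m : probability Y R)
      (S : Y -> Y),
    invertible_mod0 m S -> measure_preserving m S -> ergodic m S ->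
    ergodic (mu \x m)%E (fun p : X * Y => (T p.1, S p.2)).

(* Main.v *)
(* LCEIC => WM. Let [A] be invariant under [T x S] and [f] its indicator; the
   orbit-covariant map [x |-> f(x, .)] takes values in L^2(m). If [f] correlates,
   in the first variable, with a weight [w] of mean zero, then averaging
   [f(x, S^n y)] against the characters of Z/N and summing over the characters
   (Parseval) produces functions on [X] that are eigenfunctions up to a small
   error and whose correlation with [w] stays bounded below. Functions of nearly
   minimal norm among these converge, and the limit is an exact eigenfunction,
   that is a factor onto a rotation of the plane; LCEIC makes it constant,
   contradicting the correlation with [w]. So the first coordinate is independent
   of the second one on [A], hence [A] is [X x D] up to a null set with [D]
   invariant, and ergodicity of [S] concludes.

   WM => LCEIC. A zero-one argument puts [phi x] in a single orbit closure for
   almost every [x]. If the orbit were not recurrent, it would be discrete and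
   infinite, and its parity would be a factor on which weak mixing fails.
   Otherwise local compactness makes the orbit closure compact, and the limits of
   the means along orbits define on it an [S]-invariant ergodic probability of
   full support. The sets [d(phi x, z) < e] are invariant under [T x S] and not
   null, hence conull for every [e], which forces [phi] to be constant. *)

Require Import Defs.
From HB Require Import structures.
From mathcomp Require Import all_boot all_order all_algebra.
From mathcomp Require Import all_classical all_reals all_analysis.
From mathcomp Require Import measurable_realfun ring lra.
Set Implicit Arguments.
Unset Strict Implicit.
Unset Printing Implicit Defensive.
Import Order.TTheory GRing.Theory Num.Theory.
Import numFieldNormedType.Exports.
Local Open Scope classical_set_scope.
Local Open Scope ring_scope.

(** * Integration of bounded functions *)

(** As [T] need not preserve [mu], there is no unitary operator on the [X] side to which spectral
    theory could be applied. Invariance of [f] is what helps: moving [x] by [T] is compensated in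
    [L^2(m)] by the isometry that [S] induces. That space is not locally compact, so LCEIC says
    nothing about [x |-> f(x, .)] itself, and a map into a finite-dimensional space has to be
    extracted from it. Cutting orbits at length [N] breaks the invariance by a boundary term that is
    bounded independently of [N], while the squared norms of the [N] Fourier coefficients add up to
    order [N^2]. Some coefficient therefore has squared norm of order [N], against which the
    boundary term is negligible.

    In the converse direction [Y] may be nonseparable and [phi] is only Borel, so the essential
    orbit cannot be found with a countable base. Moreover weak mixing speaks only of
    probability-preserving systems, so a probability has to be built on the orbit closure. It is
    obtained by Caratheodory's construction from the means of bounded Lipschitz functions, which
    converge uniformly there. *)

Section bounded_measurable.
Context {R : realType} {d : measure_display} {X : measurableType d}.
Implicit Types f g : X -> R.

(** Bounded everywhere, not merely almost everywhere: the class is stable under products and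
    sections and is integrable for every probability, so integrability reduces to closure lemmas. *)
Definition bdm f := measurable_fun setT f /\ exists M, forall x, `|f x| <= M.

Lemma bdm_cst (c : R) : bdm (fun=> c).
Proof. by split; [exact: measurable_cst|exists `|c|]. Qed.

Lemma bdmD f g : bdm f -> bdm g -> bdm (fun x => f x + g x).
Proof.
move=> [mf [M fM]] [mg [N gN]]; split; first exact: measurable_funD.
exists (M + N) => x; exact: le_trans (ler_normD _ _) (lerD (fM x) (gN x)).
Qed.

Lemma bdmM f g : bdm f -> bdm g -> bdm (fun x => f x * g x).
Proof.
move=> [mf [M fM]] [mg [N gN]]; split; first exact: measurable_funM.
by exists (M * N) => x; rewrite normrM ler_pM.
Qed.

Lemma bdmN f : bdm f -> bdm (fun x => - f x).
Proof.
move=> bf; rewrite (_ : (fun _ => _) = (fun x => -1 * f x)).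
  exact: bdmM (bdm_cst _) bf.
by apply/funext => x; rewrite mulN1r.
Qed.

Lemma bdmB f g : bdm f -> bdm g -> bdm (fun x => f x - g x).
Proof. by move=> bf bg; exact: bdmD bf (bdmN bg). Qed.

Lemma bdmX f n : bdm f -> bdm (fun x => f x ^+ n).
Proof.
move=> bf; elim: n => [|n IHn]; first exact: bdm_cst.
rewrite (_ : (fun _ => _) = (fun x => f x * f x ^+ n)); first exact: bdmM.
by apply/funext => x; rewrite exprS.
Qed.

Lemma bdm_norm f : bdm f -> bdm (fun x => `|f x|).
Proof.
move=> [mf [M fM]]; split; first exact: measurableT_comp.
by exists M => x; rewrite normr_id.
Qed.

Lemma bdm_sum I (r : seq I) (P : pred I) (F : I -> X -> R) :
  (forall i, bdm (F i)) -> bdm (fun x => \sum_(i <- r | P i) F i x).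
Proof.
move=> bF; elim: r => [|i r IHr].
  rewrite (_ : (fun _ => _) = (fun=> 0)); first exact: bdm_cst.
  by apply/funext => x; rewrite big_nil.
case: (boolP (P i)) => Pi.
  rewrite (_ : (fun _ => _) = (fun x => F i x + \sum_(i <- r | P i) F i x)).
    exact: bdmD.
  by apply/funext => x; rewrite big_cons Pi.
by under eq_fun do rewrite big_cons (negbTE Pi).
Qed.

Lemma bdm_indic (A : set X) : measurable A -> bdm (\1_A : X -> R).
Proof.
move=> mA; split; first exact: measurable_indic.
by exists 1 => x; rewrite indicE; case: (_ \in _); rewrite /= ?normr1 ?normr0.
Qed.

End bounded_measurable.

Lemma bdm_comp (R : realType) (d d' : measure_display) (X : measurableType d)
    (Z : measurableType d') (h : Z -> X) (f : X -> R) :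
  measurable_fun setT h -> bdm f -> bdm (fun z => f (h z)).
Proof.
move=> mh [mf [M fM]]; split; first exact: measurableT_comp.
by exists M => z; exact: fM.
Qed.

Section expectation.
Context {R : realType} {d : measure_display} {X : measurableType d}.
Implicit Types f g : X -> R.
Variable p : probability X R.

Lemma bdm_integrable f : bdm f -> p.-integrable setT (EFin \o f).
Proof.
move=> [mf [M fM]]; apply: measurable_bounded_integrable => //.
  by rewrite (le_lt_trans (probability_le1 p measurableT))// ltry.
exists M; split; first exact: num_real.
by move=> y My x _; exact: le_trans (fM x) (ltW My).
Qed.

Lemma ExD f g : bdm f -> bdm g ->
  \int[p]_x (f x + g x) = \int[p]_x f x + \int[p]_x g x.
Proof. by move=> bf bg; rewrite RintegralD//; exact: bdm_integrable. Qed.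

Lemma ExB f g : bdm f -> bdm g ->
  \int[p]_x (f x - g x) = \int[p]_x f x - \int[p]_x g x.
Proof. by move=> bf bg; rewrite RintegralB//; exact: bdm_integrable. Qed.

Lemma ExZl (k : R) f : bdm f -> \int[p]_x (k * f x) = k * \int[p]_x f x.
Proof. by move=> bf; rewrite RintegralZl//; exact: bdm_integrable. Qed.

Lemma ExZr (k : R) f : bdm f -> \int[p]_x (f x * k) = \int[p]_x f x * k.
Proof. by move=> bf; rewrite RintegralZr//; exact: bdm_integrable. Qed.

Lemma Ex_cst (k : R) : \int[p]_x k = k.
Proof. by rewrite Rintegral_cst//= probability_setT mulr1. Qed.

Lemma le_Ex f g : bdm f -> bdm g -> (forall x, f x <= g x) ->
  \int[p]_x f x <= \int[p]_x g x.
Proof. by move=> bf bg fg; rewrite le_Rintegral//; exact: bdm_integrable. Qed.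

Lemma Ex_sum I (r : seq I) (P : pred I) (F : I -> X -> R) :
  (forall i, bdm (F i)) ->
  \int[p]_x (\sum_(i <- r | P i) F i x) = \sum_(i <- r | P i) \int[p]_x F i x.
Proof.
move=> bF; elim: r => [|i r IHr].
  under eq_Rintegral do rewrite big_nil.
  by rewrite big_nil Ex_cst.
rewrite big_cons; case: (boolP (P i)) => Pi.
  under eq_Rintegral do rewrite big_cons Pi.
  by rewrite ExD// ?IHr//; exact: bdm_sum.
by under eq_Rintegral do rewrite big_cons (negbTE Pi).
Qed.

Lemma ae_eq_Ex f g : bdm f -> bdm g -> {ae p, forall x, f x = g x} ->
  \int[p]_x f x = \int[p]_x g x.
Proof.
move=> [mf _] [mg _] fg; rewrite /Rintegral; congr fine.
apply: ae_eq_integral => //; [exact/measurable_EFinP|exact/measurable_EFinP|].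
by apply: filterS fg => x /= ->.
Qed.

(** The maximum of [f] and [g] equals [g] almost everywhere and dominates [f] everywhere. *)
Lemma ae_le_Ex f g : bdm f -> bdm g -> {ae p, forall x, f x <= g x} ->
  \int[p]_x f x <= \int[p]_x g x.
Proof.
move=> bf bg fg.
have bm : bdm (fun x => Num.max (f x) (g x)).
  case: bf bg => mf [M fM] [mg [N gN]]; split; first exact: measurable_maxr.
  exists (M + N) => x; rewrite /Num.max; case: ifP => _.
    by rewrite (le_trans (gN x))// lerDr (le_trans _ (fM x)).
  by rewrite (le_trans (fM x))// lerDl (le_trans _ (gN x)).
rewrite (@ae_eq_Ex g (fun x => Num.max (f x) (g x)))//.
  by apply: le_Ex => // x; rewrite le_max lexx.
by apply: filterS fg => x ?; rewrite max_r.
Qed.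

Lemma Ex_ge0 f : (forall x, 0 <= f x) -> 0 <= \int[p]_x f x.
Proof. by move=> f0; exact: Rintegral_ge0. Qed.

Lemma Ex_indic (A : set X) : measurable A ->
  \int[p]_x (\1_A x : R) = fine (p A).
Proof. by move=> mA; rewrite /Rintegral integral_indic// setIT. Qed.

Lemma Ex_eq0 f : bdm f -> (forall x, 0 <= f x) -> \int[p]_x f x = 0 ->
  {ae p, forall x, f x = 0}.
Proof.
move=> bf f0 If; have [mf _] := bf.
have mfE : measurable_fun setT (EFin \o f) by exact/measurable_EFinP.
have /(ae_eq_integral_abs _ measurableT mfE) : (\int[p]_x `|(EFin \o f) x| = 0)%E.
  transitivity (\int[p]_x (f x)%:E)%E.
    by apply: eq_integral => x _ /=; rewrite ger0_norm.
  rewrite -[LHS]fineK; first by rewrite -/(Rintegral p setT f) If.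
  exact: (integrable_fin_num measurableT (bdm_integrable bf)).
by apply: filterS => x /= /(_ I) [].
Qed.

Lemma Ex_norm f : bdm f -> `|\int[p]_x f x| <= \int[p]_x `|f x|.
Proof. by move=> bf; apply: le_normr_Rintegral => //; exact: bdm_integrable. Qed.

Lemma Ex_le_cst f (M : R) : bdm f -> (forall x, `|f x| <= M) ->
  `|\int[p]_x f x| <= M.
Proof.
move=> bf fM; apply: le_trans (Ex_norm bf) _.
rewrite -[leRHS]Ex_cst; apply: le_Ex => //; [exact: bdm_norm|exact: bdm_cst].
Qed.

Lemma Ex_mp (S : X -> X) f : measure_preserving p S -> bdm f ->
  \int[p]_x f (S x) = \int[p]_x f x.
Proof.
move=> [mS pS] bf; have [mf _] := bf; rewrite /Rintegral; congr fine.
have mfE : measurable_fun setT (EFin \o f) by exact/measurable_EFinP.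
transitivity (\int[pushforward p S]_(x in setT) (EFin \o f) x)%E.
  rewrite integral_pushforward//; rewrite preimage_setT.
  by have := bdm_integrable (bdm_comp mS bf).
by apply: eq_measure_integral => A mA _; exact: pS.
Qed.

End expectation.

Section bounded_fubini.
Context {R : realType} {d d' : measure_display}
  {X : measurableType d} {Y : measurableType d'}.
Variables (p : probability X R) (m : probability Y R).
Variable F : X * Y -> R.
Hypothesis bF : bdm F.

Lemma bdm_fst x : bdm (fun y => F (x, y)).
Proof. by apply: bdm_comp bF; exact: measurable_pair1. Qed.

Lemma bdm_snd y : bdm (fun x => F (x, y)).
Proof. by apply: bdm_comp bF; exact: measurable_pair2. Qed.

Let integrableF : (p \x m)%E.-integrable setT (EFin \o F).
Proof. exact: (@bdm_integrable _ _ _ (p \x m)%E). Qed.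

Lemma bdm_Ex1 : bdm (fun x => \int[m]_y F (x, y)).
Proof.
have [_ [M FM]] := bF; split; last first.
  by exists M => x; apply: Ex_le_cst => //; exact: bdm_fst.
apply: (measurableT_comp (fine_measurable measurableT)).
exact: (measurable_fubini_F integrableF).
Qed.

Lemma bdm_Ex2 : bdm (fun y => \int[p]_x F (x, y)).
Proof.
have [_ [M FM]] := bF; split; last first.
  by exists M => x; apply: Ex_le_cst => //; exact: bdm_snd.
apply: (measurableT_comp (fine_measurable measurableT)).
exact: (measurable_fubini_G integrableF).
Qed.

Lemma Ex_fubini :
  \int[p]_x (\int[m]_y F (x, y)) = \int[m]_y (\int[p]_x F (x, y)).
Proof.
rewrite [LHS]/Rintegral [RHS]/Rintegral; congr fine.
transitivity (\int[p]_x \int[m]_y (EFin \o F) (x, y))%E.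
  apply: eq_integral => x _; rewrite fineK//.
  exact: (integrable_fin_num measurableT (bdm_integrable m (bdm_fst x))).
rewrite (Fubini integrableF); apply: eq_integral => y _; rewrite fineK//.
exact: (integrable_fin_num measurableT (bdm_integrable p (bdm_snd y))).
Qed.

End bounded_fubini.

(** * Null sets of products and equivalent probabilities *)

Section null_sets.
Context {R : realType} {d : measure_display} {X : measurableType d}.

(** The product measure is by definition the integral of the measures of the sections, and a
    nonnegative integrand with zero integral vanishes almost everywhere. *)
Lemma product_null (d' : measure_display) (Y : measurableType d')
    (mu : {measure set X -> \bar R}) (m : {sigma_finite_measure set Y -> \bar R})
    (A : set (X * Y)) : measurable A ->
  (mu \x m)%E A = 0%E <-> {ae mu, forall x, m (xsection A x) = 0%E}.
Proof.
move=> mA; rewrite /product_measure1.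
have mf := measurable_fun_xsection m mA.
have -> : (\int[mu]_x (m \o xsection A) x = \int[mu]_x `|(m \o xsection A) x|)%E.
  by apply: eq_integral => x _; rewrite gee0_abs.
rewrite (ae_eq_integral_abs _ measurableT mf).
by split; apply: filterS => x /=; [move=> /(_ I)|].
Qed.

(** LCEIC, nonsingularity and ergodicity of products see only the null sets of [mu], so this reduces
    the sigma-finite case to that of a probability. *)
Lemma equivalent_probability (mu : {sigma_finite_measure set X -> \bar R}) :
  mu setT <> 0%E ->
  exists p : probability X R, forall A, measurable A -> mu A = 0%E <-> p A = 0%E.
Proof.
move=> muT; have [F FT Ffin] := sigma_finiteT mu.
have mF n : measurable (F n) by have [] := Ffin n.
(* The first factor brings the mass of each piece below 1, the [1 +] covering null pieces; the
   powers of two make the total finite. Positivity of the weights preserves the null sets. *)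
have c0 n : 0 < (1 + fine (mu (F n)))^-1 / (2 ^ n.+1)%:R.
  by rewrite divr_gt0// ?invr_gt0 ?ltr0n ?expn_gt0// ltr_pwDl// fine_ge0.
pose c n : {nonneg R} := NngNum (ltW (c0 n)).
pose q n := mscale (c n) (mrestr mu (mF n)).
pose P0 : {measure set X -> \bar R} := mseries q 0.
have P0E A : P0 A = (\sum_(0 <= k <oo) q k A)%E by [].
have q0 n A : (0 <= q n A)%E by exact: measure_ge0.
have P00 A : measurable A -> mu A = 0%E <-> P0 A = 0%E.
  move=> mA; split=> [A0|].
    rewrite P0E eseries0// => k _ _; rewrite /q /mscale/= /mrestr.
    rewrite (_ : mu (A `&` F k) = 0%E) ?mule0//; apply: measure_negligible.
      exact: measurableI.
    by apply: negligibleS (@subIsetl _ A (F k)) _; exact/negligibleP.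
  rewrite P0E => s0.
  have qA0 k : q k A = 0%E.
    apply/eqP; rewrite eq_le q0 andbT -s0.
    apply: le_trans _ (@nneseries_lim_ge R (q ^~ A) xpredT 0%N k.+1 (fun n _ _ => q0 n A)).
    by rewrite big_nat_recr//= leeDr// sume_ge0.
  have muAF k : mu (A `&` F k) = 0%E.
    move: (qA0 k); rewrite /q /mscale/= /mrestr => /eqP.
    by rewrite mule_eq0 eqe gt_eqF//= => /eqP.
  apply: (measure_negligible mA).
  rewrite -[A]setIT FT setI_bigcupr.
  by apply: negligible_bigcup => k; exists (A `&` F k); split => //; [exact: measurableI|exact: muAF].
have P0fin : (P0 setT <= 1)%E.
  rewrite P0E; apply: le_trans (epsilon_trick0 xpredT (@ler01 R)).
  apply: lee_nneseries => [k _ _|k _]; first exact: q0.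
  rewrite /q /mscale/= /mrestr setTI.
  have [_ Fk] := Ffin k.
  have Fk' : mu (F k) \is a fin_num by rewrite ge0_fin_numE.
  have a0 : 0 <= fine (mu (F k)) by exact: fine_ge0.
  rewrite -[X in (_ * X)%E](fineK Fk') -EFinM lee_fin mulrAC.
  rewrite ler_pM2r ?invr_gt0 ?ltr0n ?expn_gt0//.
  by rewrite mulrC ler_pdivrMr ?mul1r; lra.
have P0T : P0 setT <> 0%E by move=> /(P00 _ measurableT).
(* [dirac point] is the value of the normalization for a total mass that is zero or infinite, which
   is excluded here. *)
exists (mnormalize P0 (dirac point)) => A mA.
rewrite (P00 _ mA).
rewrite [X in _ <-> X = _](_ : _ = mnormalize P0 (dirac point) A)// /mnormalize.
have P0Ty : P0 setT \is a fin_num by rewrite ge0_fin_numE// (le_lt_trans P0fin)// ltry.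
rewrite ifF; last first.
  apply/negbTE/norP; split; first exact/eqP.
  by apply/eqP => e; rewrite e in P0Ty.
split=> [->|/eqP]; first by rewrite mul0e.
rewrite mule_eq0 eqe invr_eq0 fine_eq0// => /orP[/eqP//|/eqP//].
Qed.

End null_sets.

(** * Rotations of the plane *)

(** A fresh type, so that it can carry the Euclidean distance: rotations are not isometries for the
    sup distance of the product. *)
Definition plane (R : realType) : Type := (R * R)%type.

HB.instance Definition _ (R : realType) := Choice.on (plane R).

Section plane_metric.
Context {R : realType}.
Implicit Types u v w : plane R.

Definition plane_dist u v : R :=
  Num.sqrt ((u.1 - v.1) ^+ 2 + (u.2 - v.2) ^+ 2).

Lemma plane_dist_ge0 u v : 0 <= plane_dist u v.
Proof. exact: sqrtr_ge0. Qed.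

Lemma sqr_plane_dist u v :
  plane_dist u v ^+ 2 = (u.1 - v.1) ^+ 2 + (u.2 - v.2) ^+ 2.
Proof. by rewrite sqr_sqrtr// addr_ge0// sqr_ge0. Qed.

Lemma plane_distxx u : plane_dist u u = 0.
Proof. by rewrite /plane_dist !subrr expr0n/= addr0 sqrtr0. Qed.

Lemma plane_dist_eq0 u v : plane_dist u v = 0 -> u = v.
Proof.
move=> /(congr1 (fun r => r ^+ 2)); rewrite sqr_plane_dist expr0n/= => /eqP.
rewrite paddr_eq0 ?sqr_ge0// !sqrf_eq0 !subr_eq0 => /andP[/eqP e1 /eqP e2].
by case: u v e1 e2 => [? ?] [? ?] /= -> ->.
Qed.

Lemma plane_dist_sym u v : plane_dist u v = plane_dist v u.
Proof.
by rewrite /plane_dist -(sqrrN (u.1 - _)) -(sqrrN (u.2 - _)) !opprB.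
Qed.

Lemma plane_dist_triangle v u w :
  plane_dist u w <= plane_dist u v + plane_dist v w.
Proof.
rewrite -(@ler_pXn2r _ 2)// ?nnegrE ?addr_ge0 ?plane_dist_ge0//.
rewrite sqr_plane_dist [leRHS]sqrrD !sqr_plane_dist.
set a := u.1 - v.1; set b := u.2 - v.2; set c := v.1 - w.1; set e := v.2 - w.2.
have -> : u.1 - w.1 = a + c by rewrite /a /c; ring.
have -> : u.2 - w.2 = b + e by rewrite /b /e; ring.
have CS : a * c + b * e <= plane_dist u v * plane_dist v w.
  apply: le_trans (ler_norm _) _.
  rewrite -(@ler_pXn2r _ 2)// ?nnegrE ?mulr_ge0 ?plane_dist_ge0//.
  rewrite real_normK ?num_real// exprMn !sqr_plane_dist -/a -/b -/c -/e.
  (* Lagrange's identity: this square is the defect in the Cauchy-Schwarz inequality. *)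
  have := sqr_ge0 (a * e - b * c); nra.
by move: CS; set s := plane_dist _ _; set t := plane_dist _ _; lra.
Qed.

End plane_metric.

HB.instance Definition _ (R : realType) := isMetric.Build R (plane R)
  (@plane_distxx R) (@plane_dist_eq0 R) (@plane_dist_sym R)
  (@plane_dist_triangle R).

Section plane_topology.
Context {R : realType}.
Implicit Types u v w : plane R.

Lemma plane_mdistE u v : mdist u v = plane_dist u v. Proof. by []. Qed.

Lemma plane_dist1 u v : `|u.1 - v.1| <= plane_dist u v.
Proof.
by rewrite -sqrtr_sqr ler_sqrt ?addr_ge0 ?sqr_ge0// lerDl sqr_ge0.
Qed.

Lemma plane_dist2 u v : `|u.2 - v.2| <= plane_dist u v.
Proof.
by rewrite -sqrtr_sqr ler_sqrt ?addr_ge0 ?sqr_ge0// lerDr sqr_ge0.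
Qed.

Lemma plane_dist_le u v : plane_dist u v <= `|u.1 - v.1| + `|u.2 - v.2|.
Proof.
rewrite -(@ler_pXn2r _ 2)// ?nnegrE ?addr_ge0 ?plane_dist_ge0//.
rewrite sqr_plane_dist [leRHS]sqrrD !real_normK ?num_real//.
by rewrite lerD2r lerDl mulrn_wge0// mulr_ge0.
Qed.

Lemma plane_locally_compact : locally_compact [set: plane R].
Proof.
move=> u _; rewrite withinET.
pose B : set (R * R) := `[u.1 - 1, u.1 + 1]%classic `*` `[u.2 - 1, u.2 + 1]%classic.
(* The identity, continuous from the product topology to the Euclidean one; it carries over the
   compactness of a closed square. *)
pose f (z : R * R) : plane R := z.
have cf : continuous f.
  move=> z; apply/metricType_numDomainType.cvgrPdist_lt => e e0.
  have e2 : 0 < e / 2 by lra.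
  exists (ball z.1 (e / 2), ball z.2 (e / 2)).
    by split; exact: nbhsx_ballx.
  move=> [a b] /= []; rewrite -ball_normE /= => za zb.
  apply: le_lt_trans (plane_dist_le _ _) _ => /=.
  by rewrite (splitr e) ltrD.
have cB : compact (f @` B).
  apply: continuous_compact; first exact: continuous_subspaceT.
  by apply: compact_setX; exact: segment_compact.
exists (f @` B); last first.
  by split => //; apply: compact_closed => //; exact: (@metric_hausdorff R).
rewrite nbhs_ballP; exists 1 => //= v; rewrite ballEmdist /= => uv.
exists v => //; have := le_lt_trans (plane_dist1 u v) uv.
have := le_lt_trans (plane_dist2 u v) uv.
rewrite !ltr_norml => /andP[? ?] /andP[? ?].
by split; rewrite /= in_itv/=; apply/andP; split; lra.
Qed.

End plane_topology.

Section borel_maps.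
Context {d : measure_display} {X : measurableType d}.

Lemma borel_map_open (Y : topologicalType) (phi : X -> Y) :
  (forall U, open U -> measurable (phi @^-1` U)) -> borel_map phi.
Proof.
move=> phiU B /(_ [set B | measurable (phi @^-1` B)]); apply; split => //.
split => /=.
- by rewrite preimage_set0.
- move=> A mA; rewrite setTD preimage_setC; exact: measurableC.
- move=> F mF; rewrite preimage_bigcup; exact: bigcupT_measurable.
Qed.

Lemma borel_open (Y : topologicalType) (U : set Y) : open U -> borel_set U.
Proof. by move=> oU B [_]; apply. Qed.

Lemma borel_map_plane (R : realType) (a b : X -> R) :
  measurable_fun setT a -> measurable_fun setT b ->
  borel_map (fun x => (a x, b x) : plane R).
Proof.
move=> ma mb; apply: borel_map_open => U oU.
(* Squares with rational centre and half-side [1/(k+1)]: an open set is the union of the countably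
   many of them that it contains. Two points of such a square are less than 4 half-sides apart,
   hence the [e / 4] below. *)
pose W (i : rat * rat * nat) : set (plane R) :=
  [set u | `|ratr i.1.1 - u.1| < i.2.+1%:R^-1 /\ `|ratr i.1.2 - u.2| < i.2.+1%:R^-1].
pose phi x : plane R := (a x, b x).
have -> : phi @^-1` U = \bigcup_(i in [set i | W i `<=` U]) (phi @^-1` (W i)).
  apply/seteqP; split => [x Ux|x [i WU Wx]]; last exact: WU.
  move: oU; rewrite openE => /(_ _ Ux); rewrite /interior nbhs_ballP => -[e /= e0 eU].
  pose k := Num.truncn (4 / e).
  have k4 : k.+1%:R^-1 < e / 4.
    rewrite invf_plt ?posrE ?ltr0n//; last by lra.
    by rewrite invf_div truncnS_gt.
  have [r [rE r0 re]] : exists r : R, [/\ r = k.+1%:R^-1, 0 < r & r < e / 4].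
    by exists k.+1%:R^-1; split => //; rewrite invr_gt0 ltr0n.
  have /rat_in_itvoo[q1] : a x - r < a x + r by lra.
  rewrite in_itv /= => /andP[q1l q1r].
  have /rat_in_itvoo[q2] : b x - r < b x + r by lra.
  rewrite in_itv /= => /andP[q2l q2r].
  exists (q1, q2, k); last by split; rewrite /= -rE ltr_norml; apply/andP; split; lra.
  move=> v [/=]; rewrite -rE !ltr_norml => /andP[? ?] /andP[? ?]; apply: eU.
  rewrite ballEmdist /=; apply: le_lt_trans (plane_dist_le _ _) _ => /=.
  have : `|a x - v.1| < 2 * r by rewrite ltr_norml; apply/andP; split; lra.
  have : `|b x - v.2| < 2 * r by rewrite ltr_norml; apply/andP; split; lra.
  by lra.
rewrite bigcup_mkcond; apply: countable_bigcupT_measurable => // i.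
case: ifPn => // _.
have mW (f : X -> R) (q : R) : measurable_fun setT f ->
    measurable [set x | `|q - f x| < i.2.+1%:R^-1].
  move=> mf; have mg : measurable_fun setT (fun x => `|q - f x|).
    by apply: measurableT_comp => //; exact: measurable_funB.
  have := mg measurableT `]-oo, i.2.+1%:R^-1[%classic (measurable_itv _).
  by rewrite setTI; congr measurable; apply/seteqP; split => x /=; rewrite in_itv.
exact: measurableI (mW _ _ ma) (mW _ _ mb).
Qed.

End borel_maps.

Section LCEIC_consequences.
Context {R : realType} {d : measure_display} {X : measurableType d}.
Variables (mu : {measure set X -> \bar R}) (T : X -> X).
Hypothesis lceic : LCEIC mu T.

(** All uses of LCEIC in this direction go through the rotation with matrix [(c, -s; s, c)] of the
    plane. *)
Lemma LCEIC_rotation (a b : X -> R) (c s : R) :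
  measurable_fun setT a -> measurable_fun setT b -> c ^+ 2 + s ^+ 2 = 1 ->
  {ae mu, forall x, a (T x) = c * a x - s * b x} ->
  {ae mu, forall x, b (T x) = s * a x + c * b x} ->
  exists k l, {ae mu, forall x, a x = k /\ b x = l}.
Proof.
move=> ma mb cs aT bT.
pose S (u : plane R) : plane R := (c * u.1 - s * u.2, s * u.1 + c * u.2).
pose S' (u : plane R) : plane R := (c * u.1 + s * u.2, c * u.2 - s * u.1).
have [|||||[k l] kl] := @lceic (plane R) S (fun x => (a x, b x)).
- exact: plane_locally_compact.
- exists S' => -[u v]; rewrite /S /S' /=; congr pair.
  + by rewrite -[RHS]mul1r -cs; ring.
  + by rewrite -[RHS]mul1r -cs; ring.
  + by rewrite -[RHS]mul1r -cs; ring.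
  + by rewrite -[RHS]mul1r -cs; ring.
- move=> u v; rewrite !plane_mdistE /plane_dist /=; congr Num.sqrt.
  by rewrite -[RHS]mul1r -cs; ring.
- exact: borel_map_plane.
- by apply: filterS2 aT bT => x -> ->.
by exists k, l; apply: filterS kl => x [].
Qed.

Lemma LCEIC_invariant (a : X -> R) : measurable_fun setT a ->
  {ae mu, forall x, a (T x) = a x} -> exists k, {ae mu, forall x, a x = k}.
Proof.
move=> ma aT.
have [|||||k [l kl]] := @LCEIC_rotation a (fun=> 0) 1 0 => //.
- by rewrite expr1n expr0n addr0.
- by apply: filterS aT => x ->; rewrite mul1r mul0r subr0.
- by apply: aeW => x; rewrite mul0r mulr0 addr0.
by exists k; apply: filterS kl => x [].
Qed.

End LCEIC_consequences.

(** * Approximate and exact eigenfunctions *)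

Section trigonometric_sums.
Context {R : realType}.
Implicit Types (N j : nat) (v : nat -> R).

Definition angle N j : R := j%:R * (pi *+ 2 / N%:R).

(** With [sin_sum], the real and imaginary parts of the sum of [e^(i n t) v_n] over [n < N], where
    [t = angle N j]. *)
Definition cos_sum N j v : R := \sum_(n < N) cos (n%:R * angle N j) * v n.

Definition sin_sum N j v : R := \sum_(n < N) sin (n%:R * angle N j) * v n.

Lemma cos_period j (x : R) : cos (x + j%:R * (pi *+ 2)) = cos x.
Proof. by rewrite mulr_natl (periodicn (@cosD2pi R)). Qed.

Lemma sin_period j (x : R) : sin (x + j%:R * (pi *+ 2)) = sin x.
Proof. by rewrite mulr_natl (periodicn (@sinD2pi R)). Qed.

(** With [h = k pi / N], multiplication by [2 sin h] makes the sum telescope between two sines whose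
    arguments differ by [2 k pi]; the bounds on [k] give [sin h > 0]. *)
Lemma sum_cos_roots N k : (0 < k < N)%N ->
  \sum_(j < N) cos (k%:R * angle N j) = 0 :> R.
Proof.
move=> /andP[k0 kN]; have N0 : (0 < N)%N by exact: leq_trans kN.
have NR0 : N%:R != 0 :> R by rewrite pnatr_eq0 -lt0n.
pose h : R := k%:R * (pi / N%:R).
have sh0 : 0 < sin h.
  apply: sin_gt0_pi; rewrite /h mulr_gt0 ?ltr0n ?divr_gt0 ?pi_gt0 ?ltr0n//=.
  rewrite mulrCA gtr_pMr ?pi_gt0// ltr_pdivrMr ?ltr0n// mul1r ltr_nat.
  exact: kN.
pose u j : R := sin ((2 * j%:R - 1) * h).
have uE j : cos (k%:R * angle N j) * (2 * sin h) = u j.+1 - u j.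
  rewrite /u /angle (_ : k%:R * _ = 2 * j%:R * h); last first.
    by rewrite /h -mulr_natl; ring.
  rewrite (_ : (2 * j.+1%:R - 1) * h = 2 * j%:R * h + h); last first.
    by rewrite -addn1 natrD; ring.
  rewrite (_ : (2 * j%:R - 1) * h = 2 * j%:R * h - h); last by ring.
  by rewrite sinD sinB; ring.
apply: (mulIf (x := 2 * sin h)); first by rewrite mulf_neq0 ?gt_eqF.
rewrite mul0r mulr_suml (eq_bigr (fun j : 'I_N => u j.+1 - u j)); last first.
  by move=> j _; exact: uE.
rewrite -(big_mkord xpredT (fun j => u j.+1 - u j)) telescope_sumr// /u.
rewrite mulr0 sub0r (_ : (2 * N%:R - 1) * h = - h + k%:R * (pi *+ 2)); last first.
  by rewrite /h -mulr_natl; field.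
by rewrite sin_period mulN1r subrr.
Qed.

(** Expanding the squares gives [cos ((n - m) t)] in front of [v n * v m]; summed over the
    frequencies, the off-diagonal terms vanish. *)
Lemma parseval N v :
  \sum_(j < N) (cos_sum N j v ^+ 2 + sin_sum N j v ^+ 2) =
  N%:R * \sum_(n < N) v n ^+ 2.
Proof.
transitivity (\sum_(j < N) \sum_(n < N) \sum_(m < N)
    v n * v m * cos ((n%:R - m%:R) * angle N j)).
  apply: eq_bigr => j _; rewrite !expr2 /cos_sum /sin_sum !mulr_suml -big_split/=.
  apply: eq_bigr => n _; rewrite !mulr_sumr -big_split/=.
  by apply: eq_bigr => m _; rewrite mulrBl cosB; ring.
rewrite exchange_big mulr_sumr /=; apply: eq_bigr => n _.
rewrite exchange_big /= (bigD1 n)//= [X in _ + X]big1 ?addr0; last first.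
  move=> m mn; rewrite -mulr_sumr.
  suff -> : \sum_(j < N) cos ((n%:R - m%:R) * angle N j) = 0 :> R by rewrite mulr0.
  have [nm|mn'|e] := ltngtP n m; last by rewrite -val_eqE /= e eqxx in mn.
    under eq_bigr => j _ do rewrite -cosN -mulNr opprB -natrB ?(ltnW nm)//.
    apply: sum_cos_roots; rewrite subn_gt0 nm /=.
    exact: leq_ltn_trans (leq_subr _ _) (ltn_ord m).
  under eq_bigr => j _ do rewrite -natrB ?(ltnW mn')//.
  apply: sum_cos_roots; rewrite subn_gt0 mn' /=.
  exact: leq_ltn_trans (leq_subr _ _) (ltn_ord n).
under eq_bigr => j _ do rewrite subrr mul0r cos0 mulr1 -expr2.
by rewrite sumr_const card_ord mulr_natl.
Qed.

Lemma angle_full N j : (0 < N)%N ->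
  N%:R * angle N j = j%:R * (pi *+ 2).
Proof.
move=> N0; have NR0 : N%:R != 0 :> R by rewrite pnatr_eq0 -lt0n.
by rewrite /angle; field.
Qed.

(** Real part of: shifting [v] multiplies its coefficient by [e^(-i t)], up to the end terms. They
    combine into [v N - v 0] because [e^(i N t) = 1]. *)
Lemma cos_sum_shift N j v : (0 < N)%N ->
  cos_sum N j (fun n => v n.+1) = cos (angle N j) * (cos_sum N j v + (v N - v 0))
    + sin (angle N j) * sin_sum N j v.
Proof.
move=> N0; set t := angle N j.
pose F n := cos ((n%:R - 1) * t) * v n.
have FE n : F n = cos t * (cos (n%:R * t) * v n) + sin t * (sin (n%:R * t) * v n).
  by rewrite /F mulrBl mul1r cosB; ring.
have -> : cos_sum N j (fun n => v n.+1) = \sum_(n < N) F n.+1.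
  by apply: eq_bigr => n _; rewrite /F -addn1 natrD addrK.
have -> : \sum_(n < N) F n.+1 = \sum_(n < N) F n + (F N - F 0%N).
  apply/eqP; rewrite addrC -subr_eq -sumrB.
  by rewrite -(big_mkord xpredT (fun n => F n.+1 - F n)) telescope_sumr.
under eq_bigr do rewrite FE.
rewrite big_split /= -!mulr_sumr !FE (angle_full j N0) mul0r sin0 cos0.
rewrite -(add0r (j%:R * _)) cos_period sin_period sin0 cos0.
by rewrite /cos_sum /sin_sum; ring.
Qed.

Lemma sin_sum_shift N j v : (0 < N)%N ->
  sin_sum N j (fun n => v n.+1) = cos (angle N j) * sin_sum N j v
    - sin (angle N j) * (cos_sum N j v + (v N - v 0)).
Proof.
move=> N0; set t := angle N j.
pose F n := sin ((n%:R - 1) * t) * v n.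
have FE n : F n = cos t * (sin (n%:R * t) * v n) - sin t * (cos (n%:R * t) * v n).
  by rewrite /F mulrBl mul1r sinB; ring.
have -> : sin_sum N j (fun n => v n.+1) = \sum_(n < N) F n.+1.
  by apply: eq_bigr => n _; rewrite /F -addn1 natrD addrK.
have -> : \sum_(n < N) F n.+1 = \sum_(n < N) F n + (F N - F 0%N).
  apply/eqP; rewrite addrC -subr_eq -sumrB.
  by rewrite -(big_mkord xpredT (fun n => F n.+1 - F n)) telescope_sumr.
under eq_bigr do rewrite FE.
rewrite sumrB -!mulr_sumr !FE (angle_full j N0) mul0r sin0 cos0.
rewrite -(add0r (j%:R * _)) cos_period sin_period sin0 cos0.
by rewrite /cos_sum /sin_sum; ring.
Qed.

End trigonometric_sums.

Section almost_eigenfunctions.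
Context {R : realType} {d : measure_display} {X : measurableType d}.
Variables (p : probability X R) (T : X -> X).

Lemma ae_exists (P : X -> Prop) : {ae p, forall x, P x} -> exists x, P x.
Proof.
move=> aeP; have pT : (0 < p setT)%E by rewrite probability_setT.
have := ae_properfilter_algebraOfSetsType pT => PF.
by have [x Px] := @filter_ex _ _ PF _ aeP; exists x.
Qed.

(* [a + i b] is, up to [eps], an eigenfunction for the eigenvalue [c + i s]; the
   correlation with [w] keeps it away from [0]. *)
Definition almost_eigenfunction (w : X -> R) (delta c s eps : R) (a b : X -> R) :=
  [/\ bdm a, bdm b, {ae p, forall x, `|a x| <= 1 /\ `|b x| <= 1},
    {ae p, forall x, `|a (T x) - (c * a x - s * b x)| <= eps /\
                     `|b (T x) - (s * a x + c * b x)| <= eps} &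
    delta <= \int[p]_x (w x * a x)].

End almost_eigenfunctions.

(** * Approximate eigenfunctions from the Fourier coefficients of a correlation *)

Section approximate_eigenfunctions.
Context {R : realType} {d d' : measure_display}
  {X : measurableType d} {Y : measurableType d'}.
Variables (p : probability X R) (m : probability Y R).
Variables (T : X -> X) (S : Y -> Y).
Hypothesis lceic : LCEIC p T.
Hypothesis mpS : measure_preserving m S.
Variable f : X * Y -> R.
Hypothesis bf : bdm f.
Hypothesis f1 : forall z, `|f z| <= 1.
Hypothesis fTS :
  {ae p, forall x, {ae m, forall y, f (T x, S y) = f (x, y)}}.
Variable w : X -> R.
Hypothesis bw : bdm w.
Hypothesis w1 : forall x, `|w x| <= 1.

Let mS : measurable_fun setT S. Proof. by case: mpS. Qed.

Let mSn n : measurable_fun setT (iter n S).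
Proof.
by elim: n => [|n IHn]; [exact: measurable_id|exact: (measurableT_comp mS IHn)].
Qed.

Lemma ae_measure_preserving (P : Y -> Prop) :
  {ae m, forall y, P y} -> {ae m, forall y, P (S y)}.
Proof.
move=> [N [mN N0 PN]]; exists (S @^-1` N); split.
- by rewrite -[X in measurable X]setTI; exact: mS.
- by have [_ ->] := mpS.
- by move=> y /= nP; exact: PN.
Qed.

Let ae_iter (P : Y -> Prop) n :
  {ae m, forall y, P y} -> {ae m, forall y, P (iter n S y)}.
Proof.
by elim: n P => // n IHn P /ae_measure_preserving /IHn.
Qed.

Let fTSn : {ae p, forall x, {ae m, forall y, forall n,
  f (T x, iter n S (S y)) = f (x, iter n S y)}}.
Proof.
apply: filterS fTS => x fx; apply: ae_foralln => n.
by have := ae_iter n fx; apply: filterS => y; rewrite -iterSr.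
Qed.

Let h y : R := \int[p]_x (w x * f (x, y)).

Let bwf : bdm (fun z : X * Y => w z.1 * f z).
Proof. by apply: bdmM => //; exact: (bdm_comp _ bw). Qed.

Let bh : bdm h. Proof. exact: (bdm_Ex2 p m bwf). Qed.

Let h1 y : `|h y| <= 1.
Proof.
apply: Ex_le_cst; first exact: (bdm_snd bwf).
by move=> x; rewrite normrM -[leRHS]mulr1 ler_pM.
Qed.

Let fn n (z : X * Y) := f (z.1, iter n S z.2).

Let bfn n : bdm (fn n).
Proof.
apply: (bdm_comp (h := fun z : X * Y => (z.1, iter n S z.2)) _ bf) => //.
by apply: measurable_fun_pair => //; exact: measurableT_comp (mSn n) measurable_snd.
Qed.

Let hn n y := h (iter n S y).

Let bhn n : bdm (hn n). Proof. exact: bdm_comp (mSn n) bh. Qed.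

Section frequency.
Variables N j : nat.
Hypothesis N0 : (0 < N)%N.

Let Cf z := cos_sum N j (fn ^~ z).
Let Df z := sin_sum N j (fn ^~ z).
Let Ch y := cos_sum N j (hn ^~ y).
Let Dh y := sin_sum N j (hn ^~ y).

Let bCf : bdm Cf.
Proof. by apply: bdm_sum => n; apply: bdmM => //; exact: bdm_cst. Qed.

Let bDf : bdm Df.
Proof. by apply: bdm_sum => n; apply: bdmM => //; exact: bdm_cst. Qed.

Let bCh : bdm Ch.
Proof. by apply: bdm_sum => n; apply: bdmM => //; exact: bdm_cst. Qed.

Let bDh : bdm Dh.
Proof. by apply: bdm_sum => n; apply: bdmM => //; exact: bdm_cst. Qed.

Let CfT : {ae p, forall x, {ae m, forall y,
  Cf (T x, S y) = Cf (x, y) /\ Df (T x, S y) = Df (x, y)}}.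
Proof.
apply: filterS fTSn => x; apply: filterS => y fxy.
by split; apply: eq_bigr => n _; rewrite /fn /= fxy.
Qed.

Definition energy x : R := \int[m]_y (Cf (x, y) ^+ 2 + Df (x, y) ^+ 2).

Definition hnorm : R := \int[m]_y (Ch y ^+ 2 + Dh y ^+ 2).

Let bE : bdm (fun z => Cf z ^+ 2 + Df z ^+ 2).
Proof. by apply: bdmD; exact: bdmX. Qed.

Let bH : bdm (fun y => Ch y ^+ 2 + Dh y ^+ 2).
Proof. by apply: bdmD; exact: bdmX. Qed.

(** The coefficient of [f(T x, .)] composed with [S] is that of [f(x, .)], and [S] preserves [m], so
    [energy] is invariant. Its being constant allows a normalization by a number [tau] independent
    of [x]. *)
Lemma energy_const : exists e, {ae p, forall x, energy x = e}.
Proof.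
apply: (LCEIC_invariant lceic); first by case: (bdm_Ex1 p m bE).
apply: filterS CfT => x Tx; rewrite /energy.
rewrite -(Ex_mp mpS (bdm_fst bE (T x))).
apply: ae_eq_Ex; [exact: bdm_comp mS (bdm_fst bE (T x))|exact: bdm_fst bE x|].
by apply: filterS Tx => y [-> ->].
Qed.

(** The boundary term of the shift, bounded by 2 whatever [N] is. *)
Let e y := hn N y - h y.

Let be : bdm e. Proof. exact: bdmB. Qed.

Let e2 y : `|e y| <= 2.
Proof.
apply: le_trans (ler_normB _ _) _.
by have := lerD (h1 (iter N S y)) (h1 y).
Qed.

Let ChS y : Ch (S y) = cos (angle N j) * (Ch y + e y) + sin (angle N j) * Dh y.
Proof.
rewrite /Ch /Dh /e -cos_sum_shift//.
by apply: eq_bigr => n _; rewrite /hn -iterSr.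
Qed.

Let DhS y : Dh (S y) = cos (angle N j) * Dh y - sin (angle N j) * (Ch y + e y).
Proof.
rewrite /Ch /Dh /e -sin_sum_shift//.
by apply: eq_bigr => n _; rewrite /hn -iterSr.
Qed.

Variable tau : R.
Hypothesis tau0 : 0 < tau.
Hypothesis tauE : {ae p, forall x, energy x + hnorm = tau}.

(** [P1 + i P2] is [(Cf + i Df)] times the conjugate of [(Ch + i Dh)]. *)
Let P1 z := Cf z * Ch z.2 + Df z * Dh z.2.
Let P2 z := Df z * Ch z.2 - Cf z * Dh z.2.

Let bCh2 : bdm (fun z : X * Y => Ch z.2).
Proof. exact: (bdm_comp _ bCh). Qed.

Let bDh2 : bdm (fun z : X * Y => Dh z.2).
Proof. exact: (bdm_comp _ bDh). Qed.

Let bP1 : bdm P1. Proof. by apply: bdmD; exact: bdmM. Qed.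

Let bP2 : bdm P2. Proof. by apply: bdmB; exact: bdmM. Qed.

(** [eig_re + i eig_im] is the inner product in [L^2(m)] of the coefficient of [f(x, .)] with that
    of [h], over [tau]. Composing both with [S] preserves it, turns [T x] back into [x] and
    multiplies the coefficient of [h] by about [e^(-i t)]; by conjugation the approximate eigenvalue
    is [e^(i t)]. *)
Definition eig_re x : R := (\int[m]_y P1 (x, y)) / tau.
Definition eig_im x : R := (\int[m]_y P2 (x, y)) / tau.

Lemma bdm_eig_re : bdm eig_re.
Proof. by apply: bdmM; [exact: (bdm_Ex1 p m bP1)|exact: bdm_cst]. Qed.

Lemma bdm_eig_im : bdm eig_im.
Proof. by apply: bdmM; [exact: (bdm_Ex1 p m bP2)|exact: bdm_cst]. Qed.

(** The inner product of two vectors is at most half the sum of their squared norms, which is what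
    [tau] adds up. *)
Let bound (P : X * Y -> R) : bdm P ->
  (forall x y, 2 * `|P (x, y)| <=
     (Cf (x, y) ^+ 2 + Df (x, y) ^+ 2) + (Ch y ^+ 2 + Dh y ^+ 2)) ->
  {ae p, forall x, `|(\int[m]_y P (x, y)) / tau| <= 1}.
Proof.
move=> bP PE; apply: filterS tauE => x tx.
rewrite normrM (gtr0_norm (_ : 0 < tau^-1)) ?invr_gt0// ler_pdivrMr// mul1r.
have := Ex_norm m (bdm_fst bP x).
have : 2 * \int[m]_y `|P (x, y)| <= tau.
  rewrite -tx /energy /hnorm -ExD//; last exact: (bdm_fst bE x).
  rewrite -ExZl; last exact: bdm_norm (bdm_fst bP x).
  apply: le_Ex.
  - exact: (bdmM (bdm_cst _) (bdm_norm (bdm_fst bP x))).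
  - exact: (bdmD (bdm_fst bE x) bH).
  - exact: PE.
by have := tau0; lra.
Qed.

Lemma eig_re_bound : {ae p, forall x, `|eig_re x| <= 1}.
Proof.
apply: bound bP1 _ => x y; rewrite /P1 /=; move: (Cf _) (Df _) (Ch _) (Dh _).
move=> a b c g; rewrite -ler_pdivlMl// ler_norml; apply/andP; split.
  have := sqr_ge0 (a + c); have := sqr_ge0 (b + g); nra.
have := sqr_ge0 (a - c); have := sqr_ge0 (b - g); nra.
Qed.

Lemma eig_im_bound : {ae p, forall x, `|eig_im x| <= 1}.
Proof.
apply: bound bP2 _ => x y; rewrite /P2 /=; move: (Cf _) (Df _) (Ch _) (Dh _).
move=> a b c g; rewrite -ler_pdivlMl// ler_norml; apply/andP; split.
  have := sqr_ge0 (b + c); have := sqr_ge0 (a - g); nra.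
have := sqr_ge0 (b - c); have := sqr_ge0 (a + g); nra.
Qed.

(** By Fubini, integrating the coefficient of [f(x, .)] against [w] gives that of [h], so the
    correlation is the squared norm of the latter over [tau]. *)
Lemma Ex_w_eig_re : \int[p]_x (w x * eig_re x) = hnorm / tau.
Proof.
have bwP : bdm (fun z : X * Y => w z.1 * P1 z).
  by apply: bdmM => //; exact: (bdm_comp _ bw).
under eq_Rintegral => x _ do rewrite /eig_re mulrA -(ExZl m (w x) (bdm_fst bP1 x)).
rewrite ExZr; last exact: (bdm_Ex1 p m bwP).
congr (_ / _); rewrite (Ex_fubini p m bwP) /hnorm.
have wfn n y : \int[p]_x (w x * fn n (x, y)) = hn n y by [].
have wsum (c : nat -> R) y :
    \int[p]_x (w x * \sum_(n < N) c n * fn n (x, y)) = \sum_(n < N) c n * hn n y.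
  transitivity (\int[p]_x (\sum_(n < N) c n * (w x * fn n (x, y)))).
    apply: eq_Rintegral => x _; rewrite mulr_sumr.
    by apply: eq_bigr => n _; ring.
  rewrite Ex_sum; last first.
    by move=> n; apply: (bdmM (bdm_cst _) (bdmM bw (bdm_snd (bfn n) y))).
  apply: eq_bigr => n _; rewrite ExZl ?wfn//.
  exact: (bdmM bw (bdm_snd (bfn n) y)).
apply: eq_Rintegral => y _.
transitivity (\int[p]_x (w x * Cf (x, y) * Ch y + w x * Df (x, y) * Dh y)).
  by apply: eq_Rintegral => x _; rewrite /P1 /=; ring.
have bwC := bdmM bw (bdm_snd bCf y); have bwD := bdmM bw (bdm_snd bDf y).
rewrite ExD; [|exact: bdmM bwC (bdm_cst _)|exact: bdmM bwD (bdm_cst _)].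
rewrite !ExZr// [X in X * _ + _](wsum (fun n => cos (n%:R * angle N j))).
by rewrite [X in _ + X * _](wsum (fun n => sin (n%:R * angle N j))) !expr2.
Qed.

Let c : R := cos (angle N j).
Let s : R := sin (angle N j).

(* AM-GM with weight [k]: [|e W| <= 2 k + W^2 / (2 k)] since [|e| <= 2]. *)
Let err (W : X * Y -> R) (k : R) : bdm W -> 0 < k ->
  (forall z, W z ^+ 2 <= Cf z ^+ 2 + Df z ^+ 2) ->
  {ae p, forall x, `|\int[m]_y (e y * W (x, y))| <= 2 * k + tau / (2 * k)}.
Proof.
move=> bW k0 WE; apply: filterS tauE => x tx.
apply: le_trans (Ex_norm m (bdmM be (bdm_fst bW x))) _.
apply: (@le_trans _ _ (\int[m]_y (2 * k + (2 * k)^-1 * (Cf (x, y) ^+ 2 + Df (x, y) ^+ 2)))).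
  apply: le_Ex.
  - exact: bdm_norm (bdmM be (bdm_fst bW x)).
  - exact: bdmD (bdm_cst _) (bdmM (bdm_cst _) (bdm_fst bE x)).
  - move=> y; apply: (@le_trans _ _ (2 * k + (2 * k)^-1 * W (x, y) ^+ 2)); last first.
      by rewrite lerD2l ler_pM2l ?invr_gt0 ?mulr_gt0.
    rewrite normrM; apply: (@le_trans _ _ (2 * `|W (x, y)|)); first by rewrite ler_wpM2r.
    rewrite -[W _ ^+ 2]real_normK ?num_real// -subr_ge0.
    rewrite (_ : _ - _ = (2 * k)^-1 * (2 * k - `|W (x, y)|) ^+ 2).
      by rewrite mulr_ge0 ?sqr_ge0 ?invr_ge0// mulr_ge0// ltW.
    by field; rewrite gt_eqF.
rewrite ExD; [|exact: bdm_cst|exact: bdmM (bdm_cst _) (bdm_fst bE x)].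
rewrite Ex_cst ExZl; last exact: (bdm_fst bE x).
rewrite lerD2l mulrC ler_pM2r ?invr_gt0 ?mulr_gt0// -tx lerDl.
by apply: Ex_ge0 => y; rewrite addr_ge0 ?sqr_ge0.
Qed.

(** Since [S] preserves [m], [P (T x, .)] may be integrated along [S], where it is [Q (x, .)] up to
    [e W]. *)
Let shift (P Q W : X * Y -> R) (k : R) :
  bdm P -> bdm Q -> bdm W -> 0 < k ->
  (forall z, W z ^+ 2 <= Cf z ^+ 2 + Df z ^+ 2) ->
  {ae p, forall x, {ae m, forall y,
    P (T x, S y) = Q (x, y) + e y * W (x, y)}} ->
  {ae p, forall x, `|(\int[m]_y P (T x, y)) / tau - (\int[m]_y Q (x, y)) / tau|
     <= (2 * k + tau / (2 * k)) / tau}.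
Proof.
move=> bP bQ bW k0 WE PE; apply: filterS2 (err bW k0 WE) PE => x ex Px.
rewrite -mulrBl normrM (gtr0_norm (_ : 0 < tau^-1)) ?invr_gt0//.
rewrite ler_pM2r ?invr_gt0//; apply: le_trans ex.
rewrite -(Ex_mp mpS (bdm_fst bP (T x))).
rewrite (_ : \int[m]_y _ = \int[m]_y (Q (x, y) + e y * W (x, y))).
  rewrite ExD; [|exact: bdm_fst bQ x|exact: bdmM be (bdm_fst bW x)].
  by rewrite addrAC subrr add0r.
apply: ae_eq_Ex => //; first exact: bdm_comp mS (bdm_fst bP (T x)).
exact: bdmD (bdm_fst bQ x) (bdmM be (bdm_fst bW x)).
Qed.

Lemma eig_re_shift (k : R) : 0 < k -> {ae p, forall x,
  `|eig_re (T x) - (c * eig_re x - s * eig_im x)| <= (2 * k + tau / (2 * k)) / tau}.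
Proof.
move=> k0; pose W z := c * Cf z - s * Df z; pose Q z := c * P1 z - s * P2 z.
have bc (g : X * Y -> R) r : bdm g -> bdm (fun z => r * g z).
  exact: bdmM (bdm_cst _).
have bW : bdm W by apply: bdmB; exact: bc.
have bQ : bdm Q by apply: bdmB; exact: bc.
(* [W] is one coordinate of the pair [(Cf, Df)] after a rotation; the other one supplies the square
   given to [nra]. *)
have WE z : W z ^+ 2 <= Cf z ^+ 2 + Df z ^+ 2.
  rewrite -[leRHS]mul1r -(cos2Dsin2 (angle N j)) -/c -/s /W.
  have := sqr_ge0 (s * Cf z + c * Df z); nra.
have PE : {ae p, forall x, {ae m, forall y,
    P1 (T x, S y) = Q (x, y) + e y * W (x, y)}}.
  apply: filterS CfT => x; apply: filterS => y [CT DT].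
  by rewrite /Q /P1 /W /P2 /= CT DT ChS DhS -/c -/s; ring.
apply: filterS (shift bP1 bQ bW k0 WE PE) => x.
congr (`|_ - _| <= _); rewrite /eig_re /eig_im /Q ExB.
- rewrite !ExZl; [ring|exact: bdm_fst bP2 x|exact: bdm_fst bP1 x].
- exact: (bdm_fst (bc _ c bP1) x).
- exact: (bdm_fst (bc _ s bP2) x).
Qed.

Lemma eig_im_shift (k : R) : 0 < k -> {ae p, forall x,
  `|eig_im (T x) - (s * eig_re x + c * eig_im x)| <= (2 * k + tau / (2 * k)) / tau}.
Proof.
move=> k0; pose W z := c * Df z + s * Cf z; pose Q z := s * P1 z + c * P2 z.
have bc (g : X * Y -> R) r : bdm g -> bdm (fun z => r * g z).
  exact: bdmM (bdm_cst _).
have bW : bdm W by apply: bdmD; exact: bc.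
have bQ : bdm Q by apply: bdmD; exact: bc.
have WE z : W z ^+ 2 <= Cf z ^+ 2 + Df z ^+ 2.
  rewrite -[leRHS]mul1r -(cos2Dsin2 (angle N j)) -/c -/s /W.
  have := sqr_ge0 (c * Cf z - s * Df z); nra.
have PE : {ae p, forall x, {ae m, forall y,
    P2 (T x, S y) = Q (x, y) + e y * W (x, y)}}.
  apply: filterS CfT => x; apply: filterS => y [CT DT].
  by rewrite /Q /P1 /W /P2 /= CT DT ChS DhS -/c -/s; ring.
apply: filterS (shift bP2 bQ bW k0 WE PE) => x.
congr (`|_ - _| <= _); rewrite /eig_re /eig_im /Q ExD.
- rewrite !ExZl; [ring|exact: bdm_fst bP2 x|exact: bdm_fst bP1 x].
- exact: (bdm_fst (bc _ s bP1) x).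
- exact: (bdm_fst (bc _ c bP2) x).
Qed.

End frequency.

Let fn1 n z : fn n z ^+ 2 <= 1.
Proof. by rewrite -real_normK ?num_real// exprn_ile1//; exact: f1. Qed.

Let Ex_hn2 n : \int[m]_y hn n y ^+ 2 = \int[m]_y h y ^+ 2.
Proof.
elim: n => // n IHn; rewrite -IHn.
rewrite -(Ex_mp mpS (bdmX 2 (bhn n))); apply: eq_Rintegral => y _.
by rewrite /hn iterSr.
Qed.

Let energy_const_all : exists e : nat -> nat -> R,
  {ae p, forall x, forall N j, energy N j x = e N j}.
Proof.
have /choice[e He] : forall Nj : nat * nat, exists e,
    {ae p, forall x, energy Nj.1 Nj.2 x = e}.
  by move=> Nj; exact: energy_const.
exists (fun N j => e (N, j)).
have := ae_foralln (fun N => ae_foralln (fun j => He (N, j))).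
by apply: filterS => x ex N j; exact: ex.
Qed.

Let sum_hnorm N : \sum_(j < N) hnorm N j = (N * N)%:R * \int[m]_y h y ^+ 2.
Proof.
have bs (c : nat -> R) : bdm (fun y => \sum_(n < N) c n * hn n y).
  by apply: bdm_sum => n; exact: bdmM (bdm_cst _) (bhn n).
rewrite /hnorm -Ex_sum; last first.
  move=> j; apply: bdmD; apply: bdmX.
    exact: (bs (fun n => cos (n%:R * angle N j))).
  exact: (bs (fun n => sin (n%:R * angle N j))).
under eq_Rintegral => y _ do rewrite parseval.
rewrite ExZl; last by apply: bdm_sum => n; exact: bdmX.
rewrite Ex_sum; last by move=> n; exact: bdmX.
under eq_bigr => n _ do rewrite Ex_hn2.
by rewrite sumr_const card_ord natrM -mulrA !mulr_natl.
Qed.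

Let sum_energy N x : \sum_(j < N) energy N j x <= (N * N)%:R.
Proof.
have bs (c : nat -> R) : bdm (fun y => \sum_(n < N) c n * fn n (x, y)).
  by apply: bdm_sum => n; exact: bdmM (bdm_cst _) (bdm_fst (bfn n) x).
have bj (j : 'I_N) : bdm (fun y =>
    cos_sum N j (fn ^~ (x, y)) ^+ 2 + sin_sum N j (fn ^~ (x, y)) ^+ 2).
  apply: bdmD; apply: bdmX.
    exact: (bs (fun n => cos (n%:R * angle N j))).
  exact: (bs (fun n => sin (n%:R * angle N j))).
rewrite /energy -Ex_sum//.
rewrite -[leRHS](Ex_cst m); apply: le_Ex.
- exact: bdm_sum bj.
- exact: bdm_cst.
- move=> y; rewrite parseval natrM ler_wpM2l//.
  apply: le_trans (_ : \sum_(n < N) 1 <= _); first by apply: ler_sum => n _.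
  by rewrite sumr_const card_ord.
Qed.

Lemma approximate_eigenfunction : 0 < \int[m]_y h y ^+ 2 ->
  exists2 delta, 0 < delta & forall eps, 0 < eps ->
  exists c s, c ^+ 2 + s ^+ 2 = 1 /\
    exists a b, almost_eigenfunction p T w delta c s eps a b.
Proof.
set eta := \int[m]_y h y ^+ 2 => eta0.
have eta1 : eta <= 1.
  rewrite -[leRHS](Ex_cst m); apply: le_Ex; [exact: bdmX|exact: bdm_cst|].
  by move=> y; rewrite -real_normK ?num_real// expr_le1.
have [e He] := energy_const_all.
exists (eta / 4); first by rewrite divr_gt0.
move=> eps eps0.
(* Chosen so that [K eta / 2 = 4 / eps^2], the size of [tau] beyond which the error is at most
   [eps]. *)
pose K := 8 / (eta * eps ^+ 2).
have K0 : 0 < K by rewrite divr_gt0// mulr_gt0// exprn_gt0.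
pose N := (Num.truncn K).+1.
have NK : K < N%:R by rewrite truncnS_gt.
have N0 : (0 < N)%N by [].
have NR0 : 0 < N%:R :> R by rewrite ltr0n.
have [x0 Hx0] := ae_exists He.
(* Pigeonhole: the right-hand sides sum to at least [N^2 eta - (eta / 4) (2 N^2) = N^2 eta / 2]. A
   single [j] thus gives both the correlation bound [hnorm / tau >= eta / 4] and a large [tau]. *)
have [j jP] : exists j : 'I_N, N%:R * eta / 2 <=
    hnorm N j - eta / 4 * (e N j + hnorm N j).
  apply: contrapT => /forallNP nj.
  have : \sum_(j < N) (hnorm N j - eta / 4 * (e N j + hnorm N j)) <
         \sum_(j < N) (N%:R * eta / 2).
    apply: ltr_sum => [|j _]; last by rewrite ltNge; exact/negP/nj.
    by apply/hasP; exists (Ordinal N0) => //; rewrite mem_index_enum.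
  rewrite sumrB -mulr_sumr big_split/= sum_hnorm -/eta sumr_const card_ord.
  rewrite -mulr_natl natrM.
  have : \sum_(i < N) e N i <= (N * N)%:R.
    apply: le_trans (sum_energy N x0).
    by rewrite le_eqVlt; apply/orP; left; apply/eqP/eq_bigr => i _; rewrite Hx0.
  rewrite natrM; set E := \sum_(i < N) e N i.
  set n : R := N%:R in NR0 *; have n2 : 0 < n * n by rewrite mulr_gt0.
  move=> En; nra.
set tau := e N j + hnorm N j in jP.
have e0 : 0 <= e N j.
  by rewrite -(Hx0 N j); apply: Ex_ge0 => y; rewrite addr_ge0 ?sqr_ge0.
have tauN : N%:R * eta / 2 <= tau.
  apply: le_trans (_ : hnorm N j <= _); last by rewrite lerDr.
  have h0 : 0 <= hnorm N j by apply: Ex_ge0 => y; rewrite addr_ge0 ?sqr_ge0.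
  apply: le_trans jP _; rewrite gerBl mulr_ge0//; first by lra.
  by rewrite addr_ge0.
have tau0 : 0 < tau by apply: lt_le_trans tauN; rewrite divr_gt0// mulr_gt0.
have tauE : {ae p, forall x, energy N j x + hnorm N j = tau}.
  by apply: filterS He => x ->.
have k0 : 0 < eps^-1 by rewrite invr_gt0.
(* The weight [k = 1 / eps] leaves [2 / (eps tau) + eps / 2]. *)
have err : (2 * eps^-1 + tau / (2 * eps^-1)) / tau <= eps.
  have t4 : 4 <= eps ^+ 2 * tau.
    have : K * eta / 2 <= tau.
      by apply: le_trans tauN; rewrite !ler_pM2r ?ltW// invr_gt0.
    rewrite (_ : K * eta / 2 = 4 / eps ^+ 2); last by rewrite /K; field; lra.
    by rewrite ler_pdivrMr ?exprn_gt0// mulrC.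
  rewrite ler_pdivrMr// -subr_ge0.
  rewrite (_ : _ - _ = (eps ^+ 2 * tau - 4) * (2 * eps)^-1); last by field; lra.
  by rewrite mulr_ge0 ?subr_ge0// invr_ge0 mulr_ge0// ltW.
exists (cos (angle N j)), (sin (angle N j)); split; first exact: cos2Dsin2.
exists (eig_re N j tau), (eig_im N j tau); split.
- exact: bdm_eig_re.
- exact: bdm_eig_im.
- by apply: filterS2 (eig_re_bound tau0 tauE) (eig_im_bound tau0 tauE).
- apply: filterS2 (eig_re_shift N0 tau0 tauE k0) (eig_im_shift N0 tau0 tauE k0) => x ar ai.
  by split; [exact: le_trans ar err|exact: le_trans ai err].
- rewrite Ex_w_eig_re// ler_pdivlMr//.
  have : 0 <= N%:R * eta / 2 by rewrite divr_ge0// mulr_ge0// ltW.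
  by move: jP; lra.
Qed.

End approximate_eigenfunctions.

Section fast_convergence.
Context {R : realType} {d : measure_display} {X : measurableType d}.
Variable p : probability X R.

Lemma bdm_clamp (g : X -> R) : measurable_fun setT g ->
  bdm (fun x => Num.min 1 (Num.max (-1) (g x))).
Proof.
move=> mg; split.
  apply: measurable_minr; first exact: measurable_cst.
  by apply: measurable_maxr => //; exact: measurable_cst.
exists 1 => x; rewrite ler_norml ge_min lexx/= andbT le_min le_max lexx /=.
by rewrite andbT; lra.
Qed.

(** The increments are summable in [L^1], so their series converges absolutely almost everywhere,
    and it telescopes to [a n]. *)
Lemma fast_cauchy_cvg (a : nat -> X -> R) : (forall n, bdm (a n)) ->
  {ae p, forall x, forall n, `|a n x| <= 1} ->
  (forall n, \int[p]_x `|a n.+1 x - a n x| <= 2 ^- n) ->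
  exists2 g, bdm g & {ae p, forall x, a ^~ x @ \oo --> g x}.
Proof.
move=> ba a1 Da.
pose D n x := `|a n.+1 x - a n x|.
have bD n : bdm (D n) by apply/bdm_norm/bdmB.
pose s x : \bar R := (\sum_(n <oo) (D n x)%:E)%E.
have mD n : measurable_fun setT (EFin \o D n).
  by apply/measurable_EFinP; case: (bD n).
have D0 n x : (0 <= (EFin \o D n) x)%E by rewrite lee_fin normr_ge0.
have ms : measurable_fun setT s.
  by apply: ge0_emeasurable_sum => [n x _ _|n _]; [exact: D0|exact: mD].
have s0 x : (0 <= s x)%E by apply: nneseries_ge0 => n _ _; exact: D0.
have is' : p.-integrable setT s.
  apply/integrableP; split=> //.
  rewrite (_ : (\int[p]_x `|s x| = \int[p]_x s x)%E); last first.
    by apply: eq_integral => x _; rewrite gee0_abs.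
  rewrite (integral_nneseries p measurableT mD (fun n x _ => D0 n x)).
  apply: (@le_lt_trans _ _ (\sum_(n <oo) (2 / (2 ^ n.+1)%:R)%:E)%E).
    apply: lee_nneseries => [n _ _|n _]; first by apply: integral_ge0 => x _; exact: D0.
    rewrite -[leLHS]fineK; last exact: (integrable_fin_num measurableT (bdm_integrable p (bD n))).
    rewrite lee_fin; apply: le_trans (Da n) _.
    by rewrite expnS natrM natrX invfM mulrA divff// mul1r.
  by apply: le_lt_trans (epsilon_trick0 xpredT (ltW (@ltr0Sn R 1))) _; rewrite ltry.
(* Multiplying by the indicator of [G] makes the sequence converge everywhere, whence a measurable
   limit. Clamping then bounds that limit everywhere without changing it almost everywhere. *)
pose G := [set x | (s x < +oo)%E].
have mG : measurable G.
  by rewrite -[G]setTI; exact: emeasurable_fun_infty_o.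
have aG : {ae p, forall x, G x}.
  have := integrable_ae measurableT is'; apply: filterS => x /(_ I).
  by rewrite ge0_fin_numE.
pose b n x := a n x * \1_G x.
have cb x : cvgn (b ^~ x).
  rewrite /b indicE; case: (boolP (x \in G)) => xG; last first.
    by under eq_fun do rewrite mulr0; exact: is_cvg_cst.
  under eq_fun do rewrite mulr1.
  have cs : cvgn [normed series (fun n => a n.+1 x - a n x)].
    have Gx : G x by rewrite inE in xG.
    exact: (nnseries_is_cvg (fun i => normr_ge0 _) Gx).
  have /cvg_ex[l sl] := normed_cvg cs.
  apply/cvg_ex; exists (l + a 0%N x).
  rewrite (_ : (fun n => a n x) = (fun n => series (fun n => a n.+1 x - a n x) n + a 0%N x)).
    by apply: cvgD => //; exact: cvg_cst.
  by apply/funext => n; rewrite /series /= telescope_sumr// subrK.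
pose g0 x := limn (b ^~ x).
have mg0 : measurable_fun setT g0.
  apply: (@measurable_fun_cvg _ _ _ _ b) => [n|x _]; last exact: cb.
  by have [] := bdmM (ba n) (bdm_indic mG).
exists (fun x => Num.min 1 (Num.max (-1) (g0 x))); first exact: bdm_clamp.
apply: filterS2 aG a1 => x xG x1.
have bE : b ^~ x = a ^~ x.
  by apply/funext => n; rewrite /b indicE mem_set// mulr1.
have ag0 : a ^~ x @ \oo --> g0 x by rewrite -bE; exact: cb.
suff : `|g0 x| <= 1.
  by rewrite ler_norml => /andP[l u]; rewrite max_r// min_r.
have x1' n : -1 <= a n x <= 1 by rewrite -ler_norml.
rewrite ler_norml; apply/andP; split.
  by apply: (cvgr_to_ge ag0); apply: nearW => n; have /andP[] := x1' n.
by apply: (cvgr_to_le ag0); apply: nearW => n; have /andP[] := x1' n.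
Qed.

Lemma bounded_convergence (a : nat -> X -> R) (g : X -> R) (M : R) :
  (forall n, bdm (a n)) -> bdm g ->
  {ae p, forall x, forall n, `|a n x| <= M} ->
  {ae p, forall x, a ^~ x @ \oo --> g x} ->
  \int[p]_x a n x @[n --> \oo] --> \int[p]_x g x.
Proof.
move=> ba bg aM ag.
have [] := @dominated_convergence _ _ _ p setT measurableT
  (fun n => EFin \o a n) (EFin \o g) (cst M%:E).
- by move=> n; apply/measurable_EFinP; case: (ba n).
- by apply/measurable_EFinP; case: bg.
- by apply: filterS ag => x agx _; apply: cvg_EFin; [exact: nearW|exact: agx].
- exact: (bdm_integrable p (bdm_cst M)).
- by apply: filterS aM => x xM n _ /=; rewrite lee_fin.
move=> _ _ cv; apply: fine_cvg; rewrite fineK//.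
exact: (integrable_fin_num measurableT (bdm_integrable p bg)).
Qed.

End fast_convergence.

(** * From approximate to exact eigenfunctions *)

Section exact_eigenfunctions.
Context {R : realType} {d : measure_display} {X : measurableType d}.
Variables (p : probability X R) (T : X -> X).
Hypothesis nsT : nonsingular p T.

Lemma ae_nonsingular (P : X -> Prop) :
  {ae p, forall x, P x} -> {ae p, forall x, P (T x)}.
Proof.
move=> [N [mN N0 PN]]; have [mT TN] := nsT.
exists (T @^-1` N); split.
- by rewrite -[X in measurable X]setTI; exact: mT.
- exact/(TN _ mN).
- by move=> x /= nP; exact: PN.
Qed.

Variables (w : X -> R) (delta : R).
Hypothesis bw : bdm w.
Hypothesis w1 : forall x, `|w x| <= 1.

Local Notation almost := (almost_eigenfunction p T w delta).

Lemma almost_eigenfunctionW c s eps eps' a b : eps <= eps' ->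
  almost c s eps a b -> almost c s eps' a b.
Proof.
move=> ee [ba bb ab1 abT dl]; split => //; apply: filterS abT => x [xa xb].
by split; [exact: le_trans xa ee|exact: le_trans xb ee].
Qed.

Lemma almost_eigenfunction_perturb c s c' s' eps eps' a b :
  `|c' - c| <= eps' -> `|s' - s| <= eps' -> almost c' s' eps a b ->
  almost c s (eps + 2 * eps') a b.
Proof.
move=> cc ss [ba bb ab1 abT dl]; split => //.
apply: filterS2 ab1 abT => x [a1 b1] [xa xb].
have ca : `|(c' - c) * a x| <= eps' by rewrite normrM -[eps']mulr1 ler_pM.
have cb : `|(c' - c) * b x| <= eps' by rewrite normrM -[eps']mulr1 ler_pM.
have sa : `|(s' - s) * a x| <= eps' by rewrite normrM -[eps']mulr1 ler_pM.
have sb : `|(s' - s) * b x| <= eps' by rewrite normrM -[eps']mulr1 ler_pM.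
move: xa xb ca cb sa sb; rewrite !ler_norml.
move=> /andP[? ?] /andP[? ?] /andP[? ?] /andP[? ?] /andP[? ?] /andP[? ?].
by split; apply/andP; split; lra.
Qed.

(** For a fixed eigenvalue all the conditions are convex; midpoints are what the parallelogram
    identity needs. *)
Lemma almost_eigenfunction_mid c s eps a b a' b' :
  almost c s eps a b -> almost c s eps a' b' ->
  almost c s eps (fun x => 2^-1 * (a x + a' x)) (fun x => 2^-1 * (b x + b' x)).
Proof.
move=> [ba bb ab1 abT dl] [ba' bb' ab1' abT' dl'].
have bmid (f g : X -> R) : bdm f -> bdm g -> bdm (fun x => 2^-1 * (f x + g x)).
  by move=> bf bg; apply: bdmM; [exact: bdm_cst|exact: bdmD].
split; [exact: bmid|exact: bmid|..].
- apply: filterS2 ab1 ab1' => x; rewrite !ler_norml.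
  move=> [/andP[? ?] /andP[? ?]] [/andP[? ?] /andP[? ?]].
  by split; apply/andP; split; lra.
- apply: filterS2 abT abT' => x; rewrite !ler_norml.
  move=> [/andP[? ?] /andP[? ?]] [/andP[? ?] /andP[? ?]].
  by split; apply/andP; split; lra.
- rewrite (_ : \int[p]_x _ =
      2^-1 * (\int[p]_x (w x * a x) + \int[p]_x (w x * a' x))); first by lra.
  rewrite -ExD; [|exact: bdmM|exact: bdmM].
  rewrite -ExZl; last by apply: bdmD; exact: bdmM.
  by apply: eq_Rintegral => x _; ring.
Qed.

(** The eigenvalues lie on the compact unit circle; moving to a cluster point of them costs no more
    than a small additional error. *)
Lemma cluster_eigenvalue :
  (forall eps, 0 < eps -> exists c s, c ^+ 2 + s ^+ 2 = 1 /\
    exists a b, almost c s eps a b) ->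
  exists c s, c ^+ 2 + s ^+ 2 = 1 /\
    forall eps, 0 < eps -> exists a b, almost c s eps a b.
Proof.
move=> H.
have /choice[u Hu] : forall n, exists u : R * R, u.1 ^+ 2 + u.2 ^+ 2 = 1 /\
    exists a b, almost u.1 u.2 (n.+1%:R^-1) a b.
  move=> n; have [|c [s [cs ab]]] := H n.+1%:R^-1; first by rewrite invr_gt0.
  by exists (c, s).
have unit_bound (c s : R) : c ^+ 2 + s ^+ 2 = 1 -> -1 <= c <= 1 /\ -1 <= s <= 1.
  move=> cs; rewrite -!ler_norml -!(@ler_pXn2r _ 2 _ _ 1) ?nnegrE//.
  rewrite expr1n !real_normK ?num_real//.
  by have := sqr_ge0 c; have := sqr_ge0 s; split; lra.
have cK : compact (`[-1, 1]%classic `*` `[-1, 1]%classic : set (R * R)).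
  by apply: compact_setX; exact: segment_compact.
have uK : (u @ \oo) (`[-1, 1]%classic `*` `[-1, 1]%classic).
  exists 0%N => // n _; have [un _] := Hu n; have [? ?] := unit_bound _ _ un.
  by split; rewrite /= in_itv.
have [[c s] [[c1 s1] cl]] := cK _ (fmap_proper_filter _ _) uK.
have approx e N : 0 < e -> exists n, [/\ (N <= n)%N, `|(u n).1 - c| < e & `|(u n).2 - s| < e].
  move=> e0; have [|v [[n /= Nn <-] [vc vs]]] :=
    cl [set u n | n in [set n | (N <= n)%N]] (ball (c, s) e) _ (nbhsx_ballx _ _ e0).
    by exists N => // n Nn; exists n.
  exists n; split => //; move: vc vs; rewrite -ball_normE /ball_ /=.
    by move=> + _; rewrite distrC.
  by move=> _; rewrite distrC.
have cs1 : c ^+ 2 + s ^+ 2 = 1.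
  apply/eqP; rewrite -subr_eq0 -normr_eq0 eq_le normr_ge0 andbT.
  apply/ler_addgt0Pr => e e0; rewrite add0r.
  have [n [_ nc ns]] := approx (e / 4) 0%N ltac:(by rewrite divr_gt0).
  have [un _] := Hu n; have [/andP[? ?] /andP[? ?]] := unit_bound _ _ un.
  move: c1 s1; rewrite /= !in_itv/= => /andP[? ?] /andP[? ?].
  have sq (x y : R) : -1 <= x <= 1 -> -1 <= y <= 1 -> `|y - x| < e / 4 ->
      `|x ^+ 2 - y ^+ 2| <= e / 2.
    move=> /andP[? ?] /andP[? ?] yx; rewrite subr_sqr normrM distrC.
    apply: (@le_trans _ _ ((e / 4) * 2)); last by lra.
    rewrite ler_pM//; first exact: ltW.
    by rewrite ler_norml; apply/andP; split; lra.
  have := sq c (u n).1 ltac:(by apply/andP) ltac:(by apply/andP) nc.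
  have := sq s (u n).2 ltac:(by apply/andP) ltac:(by apply/andP) ns.
  rewrite !ler_norml => /andP[? ?] /andP[? ?].
  by apply/andP; split; lra.
exists c, s; split => // eps eps0.
have e4 : 0 < eps / 4 by rewrite divr_gt0.
(* The error [1/(n+1)] is then at most [eps / 2], and the change of eigenvalue adds
   [2 * (eps / 4)]. *)
have [n [Nn nc ns]] := approx (eps / 4) (Num.truncn (2 / eps)) e4.
have [un [a [b ab]]] := Hu n; exists a, b.
apply: almost_eigenfunctionW (almost_eigenfunction_perturb (ltW nc) (ltW ns) ab).
suff le2 : n.+1%:R^-1 <= eps / 2.
  by rewrite -[leRHS](subrK (2 * (eps / 4))) lerD2r (le_trans le2)//; lra.
rewrite -[leRHS]invrK lef_pV2 ?posrE ?invr_gt0 ?divr_gt0// invf_div.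
by apply: ltW; apply: lt_le_trans (truncnS_gt _) _; rewrite ler_nat ltnS.
Qed.

Section minimization.
Variables c s : R.
Hypothesis exab : forall eps, 0 < eps -> exists a b, almost c s eps a b.

Let q (a b : X -> R) : R := \int[p]_x (a x ^+ 2 + b x ^+ 2).

Let V eps : set R := [set v | exists a b, almost c s eps a b /\ v = q a b].

Let q0 a b : 0 <= q a b.
Proof. by apply: Ex_ge0 => x; rewrite addr_ge0 ?sqr_ge0. Qed.

Let bq (a b : X -> R) : bdm a -> bdm b -> bdm (fun x => a x ^+ 2 + b x ^+ 2).
Proof. by move=> ba bb; apply: bdmD; exact: bdmX. Qed.

Let q2 a b eps : almost c s eps a b -> q a b <= 2.
Proof.
move=> [ba bb ab1 _ _]; rewrite -[leRHS](Ex_cst p).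
apply: ae_le_Ex; [exact: bq|exact: bdm_cst|].
apply: filterS ab1 => x [a1 b1].
rewrite -[a x ^+ 2]real_normK ?num_real// -[b x ^+ 2]real_normK ?num_real//.
by rewrite [leRHS](_ : _ = 1 + 1)// lerD// exprn_ile1.
Qed.

Let V_inf eps : 0 < eps -> has_inf (V eps).
Proof.
move=> eps0; split.
  by have [a [b ab]] := exab eps0; exists (q a b), a, b.
by exists 0 => _ [a [b [_ ->]]]; exact: q0.
Qed.

Let V_mono eps eps' : 0 < eps -> eps <= eps' -> inf (V eps') <= inf (V eps).
Proof.
move=> eps0 ee; have [nV _] := V_inf eps0.
apply: lb_le_inf => // _ [a [b [ab ->]]].
apply: ge_inf; first by exists 0 => _ [? [? [_ ->]]]; exact: q0.
by exists a, b; split => //; exact: almost_eigenfunctionW ee ab.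
Qed.

(** The infimum increases as [eps] decreases and stays below 2, so [sup W] is its limit as [eps]
    tends to 0. *)
Let W : set R := [set inf (V eps) | eps in [set eps | 0 < eps]].

Let W_sup : has_sup W.
Proof.
split; first by exists (inf (V 1)), 1 => //=.
exists 2 => _ [eps /= eps0 <-]; have [a [b ab]] := exab eps0.
apply: le_trans (q2 ab); apply: ge_inf; last by exists a, b.
by exists 0 => _ [? [? [_ ->]]]; exact: q0.
Qed.

Let near_minimizer eta e : 0 < eta -> 0 < e -> exists eps a b,
  [/\ 0 < eps <= e, almost c s eps a b, q a b <= sup W + eta &
      forall eps', 0 < eps' <= eps -> sup W - eta <= inf (V eps')].
Proof.
move=> eta0 e0; have [_ [eps1 /= eps10 <-] Weps1] := sup_adherent eta0 W_sup.
pose eps := Num.min eps1 e.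
have eps0 : 0 < eps by rewrite lt_min eps10.
have [_ [a [b [ab ->]]] qab] := inf_adherent eta0 (V_inf eps0).
exists eps, a, b; split => //.
- by rewrite eps0 ge_min lexx orbT.
- apply: le_trans (ltW qab) _; rewrite lerD2r.
  by apply: ub_le_sup; [exact: (proj2 W_sup)|exists eps].
- move=> eps' /andP[eps'0 ee]; apply: le_trans (ltW Weps1) _.
  apply: V_mono => //; apply: le_trans ee _.
  by rewrite ge_min lexx.
Qed.

(** A mere weak limit would not pass through the composition with [T], which does not preserve [p].
    Nearly minimal norm in nested convex sets yields a strong limit, here even an almost everywhere
    one, and that passes by nonsingularity. *)
Lemma exact_eigenfunction : exists a b : X -> R, [/\ bdm a, bdm b,
  {ae p, forall x, a (T x) = c * a x - s * b x},
  {ae p, forall x, b (T x) = s * a x + c * b x} &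
  delta <= \int[p]_x (w x * a x)].
Proof.
(* The parallelogram identity has total weight 8 on these errors, 4 from above and 4 from below, so
   [4^-n / 8] bounds the squared distance of consecutive terms by [4^-n]. *)
have /choice[f Hf] : forall n, exists f : R * (X -> R) * (X -> R),
  [/\ 0 < f.1.1 <= n.+1%:R^-1, almost c s f.1.1 f.1.2 f.2,
      q f.1.2 f.2 <= sup W + 4 ^- n / 8 &
      forall eps', 0 < eps' <= f.1.1 -> sup W - 4 ^- n / 8 <= inf (V eps')].
  move=> n; have e0 : 0 < 4 ^- n / 8 :> R by rewrite divr_gt0// invr_gt0 exprn_gt0.
  have n0 : 0 < n.+1%:R^-1 :> R by rewrite invr_gt0.
  by have [eps [a [b [? ? ? ?]]]] := near_minimizer e0 n0; exists (eps, a, b).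
pose a n := (f n).1.2; pose b n := (f n).2; pose eps n := (f n).1.1.
have ab n : almost c s (eps n) (a n) (b n) by have [] := Hf n.
have ba n : bdm (a n) by have [] := ab n.
have bb n : bdm (b n) by have [] := ab n.
have qD n : q (fun x => a n.+1 x - a n x) (fun x => b n.+1 x - b n x) <= 4 ^- n.
  have [/andP[en0 _] abn qn infn] := Hf n.
  have [/andP[em0 _] abm qm infm] := Hf n.+1.
  have e4 : 4 ^- n.+1 <= 4 ^- n :> R.
    by rewrite lef_pV2 ?posrE ?exprn_gt0// exprS ler_peMl ?exprn_ge0// ler1n.
  (* The midpoint inherits the larger error; the lower bound on the infimum is taken at the index
     where it is attained. *)
  pose e := Num.max (eps n) (eps n.+1).
  have mid : almost c s e (fun x => 2^-1 * (a n.+1 x + a n x))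
                          (fun x => 2^-1 * (b n.+1 x + b n x)).
    apply: almost_eigenfunction_mid; first apply: almost_eigenfunctionW (ab n.+1).
      by rewrite le_max lexx orbT.
    by apply: almost_eigenfunctionW (ab n); rewrite le_max lexx.
  have qmid : sup W - 4 ^- n / 8 <= q (fun x => 2^-1 * (a n.+1 x + a n x))
                          (fun x => 2^-1 * (b n.+1 x + b n x)).
    apply: (@le_trans _ _ (inf (V e))).
      rewrite /e; case: (leP (eps n) (eps n.+1)) => ee.
        by apply: le_trans (infm _ _); [lra|rewrite em0 lexx].
      by apply: infn; rewrite en0 lexx.
    apply: ge_inf; last by do 2 eexists; split; first exact: mid.
    by exists 0 => _ [? [? [_ ->]]]; exact: q0.
  have := qmid; have := qn; have := qm.
  rewrite -/(a n) -/(b n) -/(a n.+1) -/(b n.+1).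
  have -> : q (fun x => a n.+1 x - a n x) (fun x => b n.+1 x - b n x) =
      2 * q (a n.+1) (b n.+1) + 2 * q (a n) (b n) -
      4 * q (fun x => 2^-1 * (a n.+1 x + a n x)) (fun x => 2^-1 * (b n.+1 x + b n x)).
    have bcq r (g h : X -> R) : bdm g -> bdm h -> bdm (fun x => r * (g x ^+ 2 + h x ^+ 2)).
      by move=> bg bh; exact: bdmM (bdm_cst _) (bq bg bh).
    have bm (g h : X -> R) : bdm g -> bdm h -> bdm (fun x => 2^-1 * (g x + h x)).
      by move=> bg bh; exact: bdmM (bdm_cst _) (bdmD bg bh).
    have bma := bm _ _ (ba n.+1) (ba n); have bmb := bm _ _ (bb n.+1) (bb n).
    rewrite /q -!ExZl; [|exact: bq|exact: bq|exact: bq].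
    rewrite -ExD; [|exact: bcq|exact: bcq].
    rewrite -ExB; [|exact: bdmD (bcq _ _ _ _ _) (bcq _ _ _ _ _)|exact: bcq].
    by apply: eq_Rintegral => x _; field.
  by lra.
have Dcvg (g : nat -> X -> R) : (forall n, bdm (g n)) ->
    (forall n, \int[p]_x (g n.+1 x - g n x) ^+ 2 <= 4 ^- n) ->
    forall n, \int[p]_x `|g n.+1 x - g n x| <= 2 ^- n.
  move=> bg g4 n; have bD := bdmB (bg n.+1) (bg n).
  have t0 : 0 < 2 ^+ n :> R by rewrite exprn_gt0.
  (* AM-GM with weight [2^n], balanced so that both terms integrate to at most [2^-n]. *)
  apply: (@le_trans _ _ (\int[p]_x (2^-1 * (2 ^+ n * (g n.+1 x - g n x) ^+ 2 + 2 ^- n)))).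
    apply: le_Ex.
    - exact: bdm_norm.
    - exact: bdmM (bdm_cst _) (bdmD (bdmM (bdm_cst _) (bdmX 2 bD)) (bdm_cst _)).
    - move=> x; rewrite -[_ ^+ 2 in leRHS]real_normK ?num_real//.
      set t := 2 ^+ n in t0 *; set D := `|_|.
      rewrite -subr_ge0 (_ : _ - _ = 2^-1 * t^-1 * (t * D - 1) ^+ 2).
        by rewrite mulr_ge0 ?sqr_ge0// mulr_ge0// invr_ge0 ltW.
      by field; rewrite gt_eqF.
  rewrite ExZl; last exact: bdmD (bdmM (bdm_cst _) (bdmX 2 bD)) (bdm_cst _).
  rewrite ExD; [|exact: bdmM (bdm_cst _) (bdmX 2 bD)|exact: bdm_cst].
  rewrite ExZl; last exact: bdmX.
  rewrite Ex_cst; have := g4 n; rewrite -(ler_pM2l t0).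
  rewrite (_ : 2 ^+ n * 4 ^- n = 2 ^- n); first by lra.
  rewrite (_ : (4 : R) = 2 * 2); last by rewrite -natrM.
  by rewrite exprMn invfM mulrA divff ?mul1r// gt_eqF.
have [g bg ag] : exists2 g, bdm g & {ae p, forall x, a ^~ x @ \oo --> g x}.
  apply: fast_cauchy_cvg => //.
    by apply: ae_foralln => n; have [_ _ + _ _] := ab n; apply: filterS => x [].
  apply: Dcvg => // n; apply: le_trans (qD n); apply: le_Ex.
  - exact: bdmX (bdmB _ _).
  - exact: bq (bdmB _ _) (bdmB _ _).
  - by move=> x; rewrite lerDl sqr_ge0.
have [h bh bh_] : exists2 g, bdm g & {ae p, forall x, b ^~ x @ \oo --> g x}.
  apply: fast_cauchy_cvg => //.
    by apply: ae_foralln => n; have [_ _ + _ _] := ab n; apply: filterS => x [].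
  apply: Dcvg => // n; apply: le_trans (qD n); apply: le_Ex.
  - exact: bdmX (bdmB _ _).
  - exact: bq (bdmB _ _) (bdmB _ _).
  - by move=> x; rewrite lerDr sqr_ge0.
have epscvg : eps @ \oo --> (0 : R).
  apply: (@squeeze_cvgr _ _ _ _ (cst 0) (fun n => n.+1%:R^-1)).
  - by apply: nearW => n; have [/andP[/ltW -> ->]] := Hf n.
  - exact: cvg_cst.
  - exact: cvg_harmonic.
have abT : {ae p, forall x, forall n,
    `|a n (T x) - (c * a n x - s * b n x)| <= eps n /\
    `|b n (T x) - (s * a n x + c * b n x)| <= eps n}.
  by apply: ae_foralln => n; have [] := ab n.
have lim0 (u : nat -> R) l : u @ \oo --> l -> (forall n, `|u n| <= eps n) -> l = 0.
  move=> ul ue; have : u @ \oo --> (0 : R).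
    apply: (@squeeze_cvgr _ _ _ _ (fun n => - eps n) eps) => //.
      by apply: nearW => n; rewrite -ler_norml.
    by rewrite -oppr0; exact: cvgN.
  by move/(cvg_unique (@Rhausdorff R)) : ul => /[apply].
have agT := ae_nonsingular ag; have bhT := ae_nonsingular bh_.
exists g, h; split => //.
- apply: filterS3 abT (filterI ag agT) bh_ => x xT [xg xgT] xh.
  apply/eqP; rewrite -subr_eq0; apply/eqP.
  apply: (lim0 (fun n => a n (T x) - (c * a n x - s * b n x))); last first.
    by move=> n; have [] := xT n.
  by apply: cvgB => //; apply: cvgB; exact: cvgMr.
- apply: filterS3 abT (filterI bh_ bhT) ag => x xT [xh xhT] xg.
  apply/eqP; rewrite -subr_eq0; apply/eqP.
  apply: (lim0 (fun n => b n (T x) - (s * a n x + c * b n x))); last first.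
    by move=> n; have [] := xT n.
  by apply: cvgB => //; apply: cvgD; exact: cvgMr.
- have : \int[p]_x (w x * a n x) @[n --> \oo] --> \int[p]_x (w x * g x).
    apply: (@bounded_convergence _ _ _ _ (fun n x => w x * a n x) _ 1).
    + by move=> n; exact: bdmM.
    + exact: bdmM.
    + apply: ae_foralln => n; have [_ _ + _ _] := ab n; apply: filterS => x [a1 _].
      by rewrite normrM -[leRHS]mulr1 ler_pM.
    + by apply: filterS ag => x xg; exact: cvgMr.
  by move=> /cvgr_to_ge; apply; apply: nearW => n; have [] := ab n.
Qed.

End minimization.

Lemma LCEIC_no_almost_eigenfunction : LCEIC p T -> \int[p]_x w x = 0 -> 0 < delta ->
  ~ (forall eps, 0 < eps -> exists c s, c ^+ 2 + s ^+ 2 = 1 /\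
    exists a b, almost c s eps a b).
Proof.
move=> lceic w0 delta0 /cluster_eigenvalue[c [s [cs /exact_eigenfunction]]].
move=> [a [b [ba bb aT bT]]].
have [k [l kl]] := LCEIC_rotation lceic (proj1 ba) (proj1 bb) cs aT bT.
rewrite (ae_eq_Ex (bdmM bw ba) (bdmM bw (bdm_cst k))); last first.
  by apply: filterS kl => x [->].
by rewrite ExZr// w0 mul0r leNgt delta0.
Qed.

End exact_eigenfunctions.

(** * Invariant sets of the product *)

Section restricted_marginal.
Context {R : realType} {d d' : measure_display}
  {X : measurableType d} {Y : measurableType d'}.
Variables (p : probability X R) (m : probability Y R) (A : set (X * Y)).
Hypothesis mA : measurable A.

Definition restricted_marginal (D : set Y) : \bar R :=
  (p \x m)%E (A `&` snd @^-1` D).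

Let mpre D : measurable D -> measurable (A `&` snd @^-1` D).
Proof.
move=> mD; apply: measurableI => //.
by rewrite -[X in measurable X]setTI; exact: measurable_snd.
Qed.

Let marginal0 : restricted_marginal set0 = 0%E.
Proof. by rewrite /restricted_marginal preimage_set0 setI0 measure0. Qed.

Let marginal_ge0 D : (0 <= restricted_marginal D)%E.
Proof. exact: measure_ge0. Qed.

Let marginal_sigma_additive : semi_sigma_additive restricted_marginal.
Proof.
move=> F mF tF mUF; rewrite /restricted_marginal preimage_bigcup setI_bigcupr.
apply: measure_semi_sigma_additive.
- by move=> n; exact: mpre.
- apply/trivIsetP => /= i j _ _ ij; rewrite setIACA setIid -preimage_setI.
  by move/trivIsetP : tF => /(_ _ _ _ _ ij) ->//; rewrite preimage_set0 setI0.
- by rewrite -setI_bigcupr -preimage_bigcup; exact: mpre.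
Qed.

HB.instance Definition _ := isMeasure.Build _ _ _ restricted_marginal
  marginal0 marginal_ge0 marginal_sigma_additive.

Let marginal_fin : fin_num_fun restricted_marginal.
Proof.
move=> D mD; rewrite /restricted_marginal.
pose pm : probability (X * Y)%type R := (p \x m)%E.
exact: (fin_num_measure pm _ (mpre mD)).
Qed.

HB.instance Definition _ := Measure_isFinite.Build _ _ _ restricted_marginal
  marginal_fin.

(* The hypothesis says that the first coordinate restricted to [A] is
   independent of the second one. *)
Lemma product_of_independent :
  (forall B D, measurable B -> measurable D ->
    (p \x m)%E (A `&` (B `*` D)) = (p B * restricted_marginal D)%E) ->
  {ae p, forall x, {ae p, forall x',
    m (xsection A x' `\` xsection A x) = 0%E}}.
Proof.
move=> ind.
(* On rectangles this is the product of [p] with the marginal, hence everywhere. Vanishing off [A],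
   it forces almost every section of the complement to be null for the marginal. *)
pose P : {measure set (X * Y) -> \bar R} := mrestr (p \x m)%E mA.
have PE : forall C, measurable C -> (p \x restricted_marginal)%E C = P C.
  by apply: product_measure_unique => B D mB mD; rewrite -ind// /P /mrestr setIC.
have : (p \x restricted_marginal)%E (~` A) = 0%E.
  by rewrite PE; [rewrite /P /= /mrestr setICl measure0|exact: measurableC].
move/(product_null _ _ (measurableC mA)) => ae0.
apply: filterS ae0 => x; rewrite /restricted_marginal.
have mE : measurable (A `&` snd @^-1` xsection (~` A) x).
  by apply: mpre; apply: measurable_xsection; exact: measurableC.
move/(product_null _ _ mE); apply: filterS => x'; congr (m _ = _).
apply/seteqP; split => y; rewrite /xsection /= !inE /=.
  by move=> [? /set_mem ?].
by move=> [? ?]; split=> //; exact/mem_set.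
Qed.

End restricted_marginal.

Section LCEIC_weakly_mixing.
Context {R : realType} {d d' : measure_display}
  {X : measurableType d} {Y : measurableType d'}.
Variables (p : probability X R) (m : probability Y R).
Variables (T : X -> X) (S : Y -> Y).
Hypothesis lceic : LCEIC p T.
Hypothesis nsT : nonsingular p T.
Hypothesis mpS : measure_preserving m S.
Hypothesis ergS : ergodic m S.
Variable A : set (X * Y).
Hypothesis mA : measurable A.
Let F (z : X * Y) := (T z.1, S z.2).
Hypothesis FA : (p \x m)%E (F @^-1` A `+` A) = 0%E.

Let mT : measurable_fun setT T. Proof. by case: nsT. Qed.
Let mS : measurable_fun setT S. Proof. by case: mpS. Qed.

Let mF : measurable_fun setT F.
Proof.
by apply: measurable_fun_pair;
  [exact: measurableT_comp mT measurable_fst|exact: measurableT_comp mS measurable_snd].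
Qed.

Let f : X * Y -> R := \1_A.
Let bf : bdm f. Proof. exact: bdm_indic. Qed.

Let f1 z : `|f z| <= 1.
Proof. by rewrite /f indicE; case: (_ \in _); rewrite /= ?normr1 ?normr0. Qed.

Let FA_section : {ae p, forall x, {ae m, forall y, A (T x, S y) <-> A (x, y)}}.
Proof.
have mB : measurable (F @^-1` A `+` A).
  have mFA : measurable (F @^-1` A) by rewrite -[X in measurable X]setTI; exact: mF.
  by rewrite setY_def; apply: measurableU; exact: measurableD.
move/(product_null _ _ mB) : FA; apply: filterS => x x0.
exists (xsection (F @^-1` A `+` A) x); split => //; first exact: measurable_xsection.
move=> y /= nA; rewrite /xsection/= inE setY_def /=.
have [Axy|Axy] := pselect (A (x, y)).
  by right; split => // TA; apply: nA.
by left; split => //; apply: contrapT => TA; apply: nA.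
Qed.

Let fTS : {ae p, forall x, {ae m, forall y, f (T x, S y) = f (x, y)}}.
Proof.
apply: filterS FA_section => x; apply: filterS => y xy.
by rewrite /f !indicE; congr ((nat_of_bool _)%:R); apply/idP/idP; rewrite !inE => /xy.
Qed.

(** The centred indicator of [B] is a weight of mean zero: a correlation that is nonzero in [L^2(m)]
    would yield the almost eigenfunctions that LCEIC excludes. *)
Let section_independent (B : set X) : measurable B ->
  {ae m, forall y, \int[p]_x ((\1_B x - fine (p B)) * f (x, y)) = 0}.
Proof.
move=> mB; pose w x : R := \1_B x - fine (p B).
have bB := @bdm_indic R _ X B mB.
have bw : bdm w by exact: bdmB bB (bdm_cst _).
have pB01 : 0 <= fine (p B) <= 1.
  rewrite fine_ge0//= -[leRHS]/(fine 1%:E) fine_le ?probability_le1//.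
  exact: fin_num_measure.
have w1 x : `|w x| <= 1.
  case/andP: pB01 => ? ?; rewrite ler_norml /w indicE; apply/andP.
  by case: (_ \in _) => /=; split; lra.
have w0 : \int[p]_x w x = 0.
  by rewrite ExB//; [rewrite Ex_indic// Ex_cst subrr|exact: bdm_cst].
have bwf : bdm (fun z : X * Y => w z.1 * f z).
  by apply: bdmM => //; exact: bdm_comp measurable_fst bw.
have bh := bdm_Ex2 p m bwf.
pose eta : R := \int[m]_y (\int[p]_x (w x * f (x, y))) ^+ 2.
have eta0 : 0 <= eta by apply: Ex_ge0 => y; exact: sqr_ge0.
have [eta_gt0|eta_le0] := ltP 0 eta.
  have [delta delta0 H] := approximate_eigenfunction lceic mpS bf f1 fTS bw w1 eta_gt0.
  by case: (LCEIC_no_almost_eigenfunction nsT bw w1 lceic w0 delta0 H).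
have : {ae m, forall y, (\int[p]_x (w x * f (x, y))) ^+ 2 = 0}.
  apply: Ex_eq0; [exact: bdmX|by move=> y; exact: sqr_ge0|].
  by apply/eqP; rewrite eq_le eta0 eta_le0.
by apply: filterS => y /eqP; rewrite sqrf_eq0 => /eqP.
Qed.

Let fine_product (C : set (X * Y)) : measurable C ->
  fine ((p \x m)%E C) = \int[m]_y (\int[p]_x \1_C (x, y)).
Proof.
move=> mC; have bC := @bdm_indic R _ _ C mC.
rewrite -(Ex_fubini p m bC) /product_measure1 [in RHS]/Rintegral; congr fine.
apply: eq_integral => x _ /=.
rewrite [X in _ = (Rintegral _ _ X)%:E](_ : _ = \1_(xsection C x)); last first.
  apply/funext => y; rewrite !indicE; congr ((nat_of_bool _)%:R).
  by apply/idP/idP; rewrite /xsection !inE /=; rewrite ?inE.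
rewrite Ex_indic; last exact: measurable_xsection.
by rewrite fineK// fin_num_measure//; exact: measurable_xsection.
Qed.

(** [section_independent] integrated over [D]. *)
Let independent (B : set X) (D : set Y) : measurable B -> measurable D ->
  (p \x m)%E (A `&` (B `*` D)) = (p B * restricted_marginal p m A D)%E.
Proof.
move=> mB mD; have mBD : measurable (A `&` (B `*` D)).
  by apply: measurableI => //; exact: measurableX.
have mAD : measurable (A `&` snd @^-1` D).
  apply: measurableI => //.
  by rewrite -[X in measurable X]setTI; exact: measurable_snd.
have fB : p B \is a fin_num by exact: fin_num_measure.
have fAD : restricted_marginal p m A D \is a fin_num by exact: fin_num_measure.
pose pm : probability (X * Y)%type R := (p \x m)%E.
have fABD : (p \x m)%E (A `&` (B `*` D)) \is a fin_num.
  exact: (fin_num_measure pm _ mBD).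
rewrite -(fineK fABD) -(fineK fB) -(fineK fAD) -EFinM; congr EFin.
rewrite /restricted_marginal !fine_product//.
have bAD := @bdm_indic R _ _ _ mAD.
rewrite -ExZl; last exact: (bdm_Ex2 p m bAD).
apply: ae_eq_Ex.
- exact: (bdm_Ex2 p m (bdm_indic mBD)).
- exact: bdmM (bdm_cst _) (bdm_Ex2 p m bAD).
apply: filterS (section_independent mB) => y hy.
have bBi := @bdm_indic R _ X B mB.
have bfy := bdm_snd bf y.
rewrite (_ : \int[p]_x _ = \int[p]_x (\1_D y * (\1_B x * f (x, y)))); last first.
  apply: eq_Rintegral => x _; rewrite /f !indicE -!natrM; congr (_%:R).
  rewrite in_setI (_ : ((x, y) \in B `*` D) = (x \in B) && (y \in D)); last first.
    by apply/idP/andP; rewrite !inE.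
  by case: (_ \in A); case: (_ \in B); case: (_ \in D).
rewrite ExZl; last exact: bdmM.
rewrite (_ : \int[p]_x (\1_B x * f (x, y)) = fine (p B) * \int[p]_x f (x, y)); last first.
  apply/eqP; rewrite -subr_eq0 -ExZl// -ExB; [|exact: bdmM|exact: bdmM (bdm_cst _) _].
  by rewrite -[X in _ == X]hy; apply/eqP/eq_Rintegral => x _; ring.
rewrite mulrCA; congr (_ * _); rewrite -ExZl//; apply: eq_Rintegral => x _.
rewrite /f !indicE -natrM; congr (_%:R); rewrite in_setI mulnC.
rewrite (_ : ((x, y) \in snd @^-1` D) = (y \in D)); last by apply/idP/idP; rewrite !inE.
by case: (_ \in A); case: (_ \in D).
Qed.

Let ae_eq_prob (C D : set Y) : measurable C -> measurable D ->
  {ae m, forall y, C y <-> D y} -> m C = m D.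
Proof.
move=> mC mD CD.
rewrite -[LHS]fineK ?fin_num_measure// -[RHS]fineK ?fin_num_measure//.
rewrite -!Ex_indic//; congr EFin.
apply: ae_eq_Ex; [exact: bdm_indic|exact: bdm_indic|].
apply: filterS CD => y xy.
by rewrite !indicE; congr ((nat_of_bool _)%:R); apply/idP/idP; rewrite !inE => /xy.
Qed.

Lemma product_ergodic : (p \x m)%E A = 0%E \/ (p \x m)%E (~` A) = 0%E.
Proof.
pose u x : R := fine (m (xsection A x)).
have mAx x : measurable (xsection A x) by exact: measurable_xsection.
have mAxT x : measurable (S @^-1` xsection A x).
  by rewrite -[X in measurable X]setTI; exact: mS.
have AxE x y : xsection A x y <-> A (x, y) by rewrite /xsection /= inE.
have mu_ : measurable_fun setT u.
  by apply: measurableT_comp => //; exact: measurable_fun_xsection.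
have uT : {ae p, forall x, u (T x) = u x}.
  apply: filterS FA_section => x xA; rewrite /u; congr fine.
  have [_ mpS2] := mpS; rewrite -(mpS2 _ (mAx (T x))).
  apply: ae_eq_prob => //; apply: filterS xA => y xy.
  by rewrite /preimage /= !AxE.
(* Independence gives inclusions between almost all sections modulo null sets; having the same
   measure, these sections are equal modulo null sets. *)
have [k uk] := LCEIC_invariant lceic mu_ uT.
have [x0 [x0sub ux0]] := ae_exists (filterI (product_of_independent mA independent) uk).
pose D := xsection A x0.
have mD : measurable D by exact: mAx.
have AxD : {ae p, forall x, {ae m, forall y, A (x, y) <-> D y}}.
  apply: filterS2 x0sub uk => x x0x ux.
  have mxD : measurable (xsection A x `\` D) by exact: measurableD.
  have mDx : measurable (D `\` xsection A x) by exact: measurableD.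
  have Dx : m (D `\` xsection A x) = 0%E.
    have mE : m (xsection A x) = m D.
      rewrite -[LHS]fineK ?fin_num_measure// -[RHS]fineK ?fin_num_measure//.
      by congr EFin; rewrite [LHS]ux -ux0.
    have fDx : m (D `&` xsection A x) \is a fin_num.
      by apply: fin_num_measure; exact: measurableI.
    have e1 : m D = (m (D `\` xsection A x) + m (D `&` xsection A x))%E.
      exact: measureDI.
    have e2 : m (xsection A x) = (m (xsection A x `\` D) + m (xsection A x `&` D))%E.
      exact: measureDI.
    rewrite x0x add0e setIC mE e1 in e2.
    have fDm : m (D `\` xsection A x) \is a fin_num by exact: fin_num_measure.
    move: e2; rewrite -(fineK fDx) -(fineK fDm) -EFinD => -[] e2.
    by congr EFin; lra.
  have n1 : {ae m, forall y, ~ (xsection A x `\` D) y}.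
    exists (xsection A x `\` D); split => // y /= nn.
    by apply: contrapT => h; apply: nn.
  have n2 : {ae m, forall y, ~ (D `\` xsection A x) y}.
    exists (D `\` xsection A x); split => // y /= nn.
    by apply: contrapT => h; apply: nn.
  apply: filterS2 n1 n2 => y h1 h2; rewrite -AxE; split => h.
    by apply: contrapT => nD; apply: h1.
  by apply: contrapT => nD; apply: h2.
(* At such an [x] the sections at [x] and at [T x] are both [D], so invariance of [A] becomes
   invariance of [D] under [S]. *)
have [x [[xA xD] TxD]] :=
  ae_exists (filterI (filterI FA_section AxD) (ae_nonsingular nsT AxD)).
have SD : m (S @^-1` D `+` D) = 0%E.
  have mSD : measurable (S @^-1` D) by rewrite -[X in measurable X]setTI; exact: mS.
  have mSDD : measurable (S @^-1` D `+` D).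
    by rewrite setY_def; apply: measurableU; exact: measurableD.
  apply: measure_negligible => //.
  have ae : {ae m, forall y, D (S y) <-> D y}.
    apply: filterS3 xA xD (ae_measure_preserving mpS TxD) => y h1 h2 h3.
    by rewrite -h2 -h3.
  apply: negligibleS ae => y; rewrite setY_def /=.
  by move=> [[? ?]|[? ?]] h; tauto.
have mCA : measurable (~` A) by exact: measurableC.
have [D0|D0] := ergS mD SD; [left|right].
  apply/(product_null _ _ mA); apply: filterS AxD => x' x'D.
  by rewrite -D0; apply: ae_eq_prob => //; apply: filterS x'D => y; rewrite AxE.
apply/(product_null _ _ mCA); apply: filterS AxD => x' x'D.
rewrite -D0; apply: ae_eq_prob; [exact: measurable_xsection|exact: measurableC|].
apply: filterS x'D => y x'D; rewrite /xsection /= inE /=; tauto.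
Qed.

End LCEIC_weakly_mixing.

(** * Transfer to sigma-finite measures *)

Section LCEIC_implies_weakly_mixing.
Context {R : realType} {d : measure_display} {X : measurableType d}.

Lemma ae_equivalent (mu nu : {measure set X -> \bar R}) (P : X -> Prop) :
  (forall A, measurable A -> mu A = 0%E <-> nu A = 0%E) ->
  {ae mu, forall x, P x} <-> {ae nu, forall x, P x}.
Proof.
move=> munu; split=> -[N [mN N0 PN]]; exists N; split => //; exact/(munu _ mN).
Qed.

Lemma LCEIC_weakly_mixing (mu : {sigma_finite_measure set X -> \bar R})
    (T : X -> X) : nonsingular mu T -> LCEIC mu T -> weakly_mixing mu T.
Proof.
move=> nsT lceic d' Y m S _ mpS ergS A mA FA.
(* The zero measure has no equivalent probability, but then every subset of the product is null. *)
have [muT0|muT0] := pselect (mu setT = 0%E).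
  by left; apply/(product_null _ _ mA); exact: measure0_ae.
have [p pmu] := equivalent_probability muT0.
have prodE C : measurable C -> (mu \x m)%E C = 0%E <-> (p \x m)%E C = 0%E.
  by move=> mC; rewrite !product_null//; exact: ae_equivalent.
have [mT _] := nsT; have [mS _] := mpS.
have nsTp : nonsingular p T.
  split=> // B mB; rewrite -!pmu//; first exact: (proj2 nsT).
  by rewrite -[X in measurable X]setTI; exact: mT.
have lceicp : LCEIC p T.
  move=> Z S' phi lc bS iS bphi /(ae_equivalent _ pmu) phiT.
  have [c hc] := lceic Z S' phi lc bS iS bphi phiT.
  by exists c; apply/(ae_equivalent _ pmu).
rewrite (prodE _ mA) (prodE _ (measurableC mA)).
apply: (product_ergodic lceicp nsTp mpS ergS mA).
apply/prodE => //; rewrite setY_def.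
have mF : measurable_fun setT (fun z : X * Y => (T z.1, S z.2)).
  by apply: measurable_fun_pair; [exact: measurableT_comp mT measurable_fst|
     exact: measurableT_comp mS measurable_snd].
have mFA : measurable ((fun z : X * Y => (T z.1, S z.2)) @^-1` A).
  by rewrite -[X in measurable X]setTI; exact: mF.
by apply: measurableU; exact: measurableD.
Qed.

End LCEIC_implies_weakly_mixing.

(** * Weak mixing tested on two points *)

Section weakly_mixing_consequences.
Context {R : realType} {d : measure_display} {X : measurableType d}.
Variables (mu : {measure set X -> \bar R}) (T : X -> X).
Hypothesis mT : measurable_fun setT T.
Hypothesis wm : weakly_mixing mu T.

Let half01 : 0 <= (2^-1 : R) <= 1.
Proof. by apply/andP; split; lra. Qed.

Let coin : probability bool R := bernoulli_prob 2^-1.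

Let coinE (D : set bool) : coin D = (2^-1 * \1_D true + 2^-1 * \1_D false)%:E.
Proof.
rewrite [LHS](bernoulli_probE half01) /= /dirac -!EFinM -EFinD.
by rewrite (_ : unstable.onem 2^-1 = 2^-1)// /unstable.onem; lra.
Qed.

Let coin_eq0 (D : set bool) : coin D = 0%E <-> forall b, ~ D b.
Proof.
rewrite coinE; split => [[]|nD]; last first.
  by rewrite !indicE !memNset//= !mulr0 addr0.
rewrite !indicE => h [] Db; move: h; rewrite (mem_set Db) /=.
  by case: (_ \in _) => /=; lra.
by case: (_ \in _) => /=; lra.
Qed.

(* Weak mixing tested against the exchange of two points. *)
Lemma weakly_mixing_swap (B0 B1 : set X) : measurable B0 -> measurable B1 ->
  {ae mu, forall x, B0 (T x) <-> B1 x} -> {ae mu, forall x, B1 (T x) <-> B0 x} ->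
  {ae mu, forall x, ~ B0 x /\ ~ B1 x} \/ {ae mu, forall x, B0 x /\ B1 x}.
Proof.
move=> mB0 mB1 B01 B10.
(* The two hypotheses say together that [A] is invariant under [T x negb]; null and conull then mean
   neither and both. *)
pose A : set (X * bool) := [set z | if z.2 then B1 z.1 else B0 z.1].
have mA : measurable A.
  have -> : A = (B1 `*` [set true]) `|` (B0 `*` [set false]).
    apply/seteqP; split => [[x []] Ax|[x b]]; [by left|by right|].
    by rewrite /A; case => -[/= Bx ->].
  by apply: measurableU; exact: measurableX.
have mneg : measurable_fun setT negb by [].
have inv : invertible_mod0 coin negb.
  exists setT, negb; split => //.
  - by rewrite setCT measure0.
  - split => //; first by move=> [] [].
    by move=> b _; exists (~~ b) => //; rewrite negbK.
  - by move=> x _; rewrite negbK.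
have mp : measure_preserving coin negb.
  split => // D _.
  have E b : \1_(negb @^-1` D) b = \1_D (~~ b) :> R.
    by rewrite !indicE; congr ((nat_of_bool _)%:R); apply/idP/idP; rewrite !inE.
  by rewrite !coinE !E addrC.
have erg : ergodic coin negb.
  move=> D _ /coin_eq0; rewrite setY_def => nD; rewrite !coin_eq0.
  have DE : D true <-> D false.
    split=> Db; apply: contrapT => nDb; first by apply: (nD true); right.
    by apply: (nD false); right.
  by have [Dt|Dt] := pselect (D true); [right|left] => -[]; rewrite /setC /=; tauto.
have mF : measurable_fun setT (fun z : X * bool => (T z.1, ~~ z.2)).
  by apply: measurable_fun_pair; [exact: measurableT_comp mT measurable_fst|
     exact: measurableT_comp mneg measurable_snd].
have mFA : measurable ((fun z : X * bool => (T z.1, ~~ z.2)) @^-1` A).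
  by rewrite -[X in measurable X]setTI; exact: mF.
have mFAA : measurable ((fun z : X * bool => (T z.1, ~~ z.2)) @^-1` A `+` A).
  by rewrite setY_def; apply: measurableU; exact: measurableD.
have [|A0|A0] := wm inv mp erg mA.
- apply/(product_null _ _ mFAA); apply: filterS2 B01 B10 => x h0 h1.
  apply/coin_eq0 => b; rewrite /xsection /= inE setY_def /A.
  by case: b => /= -[[/= ? ?]|[/= ? ?]]; tauto.
- left; move/(product_null _ _ mA) : A0; apply: filterS => x /coin_eq0 xA.
  by have := xA true; have := xA false; rewrite /xsection /= !inE /A.
- right; move/(product_null _ _ (measurableC mA)) : A0.
  apply: filterS => x /coin_eq0 xA.
  have := xA true; have := xA false; rewrite /xsection /= !inE /A /=.
  by split; apply: contrapT.
Qed.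

Lemma weakly_mixing_ae_ergodic (B : set X) : measurable B ->
  {ae mu, forall x, B (T x) <-> B x} ->
  {ae mu, forall x, ~ B x} \/ {ae mu, forall x, B x}.
Proof.
move=> mB BT; have [h|h] := weakly_mixing_swap mB mB BT BT; [left|right].
  by apply: filterS h => x [].
by apply: filterS h => x [].
Qed.

End weakly_mixing_consequences.

(** * Orbit closures of isometries *)

Lemma open_mdist_lt (R : realType) (Y : metricType R) (y : Y) (e : R) :
  open [set z | mdist y z < e].
Proof.
rewrite openE => z /= yz; rewrite /interior nbhs_ballP.
exists (e - mdist y z); first by rewrite /= subr_gt0.
move=> u; rewrite ballEmdist /= => zu.
by apply: le_lt_trans (metric_triangle _ z _) _; rewrite -ltrBrDl.
Qed.

Section orbit_proximity.
Context {R : realType} {Y : metricType R}.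
Variable S : Y -> Y.
Hypothesis iS : Defs.isometry S.

Lemma isometry_iter n (y z : Y) : mdist (iter n S y) (iter n S z) = mdist y z.
Proof. by elim: n => //= n <-; exact: iS. Qed.

(* In terms of the two-sided orbits: some point of the orbit of [y] is at
   distance less than [e] from [z]. *)
Definition orbit_near (e : R) (y z : Y) :=
  exists j k, mdist (iter j S y) (iter k S z) < e.

Lemma orbit_near_refl e y : 0 < e -> orbit_near e y y.
Proof. by move=> e0; exists 0%N, 0%N; rewrite mdistxx. Qed.

(** Advancing two points by the same number of steps keeps their distance, so both comparisons can
    be made at the same iterate [j' + k] of [z]. *)
Lemma orbit_near_trans e e' y z u :
  orbit_near e y z -> orbit_near e' z u -> orbit_near (e + e') y u.
Proof.
move=> [j [k yz]] [j' [k' zu]]; exists (j' + j)%N, (k + k')%N.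
have h1 : mdist (iter (j' + j) S y) (iter (j' + k) S z) < e.
  by rewrite !iterD isometry_iter.
have h2 : mdist (iter (j' + k) S z) (iter (k + k') S u) < e'.
  by rewrite addnC !iterD isometry_iter.
exact: le_lt_trans (metric_triangle _ _ _) (ltrD h1 h2).
Qed.

Lemma orbit_near_sym e y z : orbit_near e y z -> orbit_near e z y.
Proof. by move=> [j [k yz]]; exists k, j; rewrite metric_sym. Qed.

Lemma orbit_nearW e e' y z : e <= e' -> orbit_near e y z -> orbit_near e' y z.
Proof. by move=> ee [j [k yz]]; exists j, k; exact: lt_le_trans yz ee. Qed.

Lemma orbit_nearS e y z : orbit_near e y (S z) <-> orbit_near e y z.
Proof.
split=> [[j [k yz]]|[j [k yz]]]; first by exists j, k.+1; rewrite iterSr.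
by exists j.+1, k; rewrite -iterSr /= iS.
Qed.

Lemma continuous_iter_isometry k : continuous (iter k S).
Proof.
move=> y; apply/metricType_numDomainType.cvgrPdist_lt => e e0.
apply/nbhs_ballP; exists e => //= z.
by rewrite ballEmdist /= isometry_iter.
Qed.

Lemma open_orbit_near e y : open [set z | orbit_near e y z].
Proof.
rewrite (_ : [set z | _] = \bigcup_j \bigcup_k
    (iter k S @^-1` [set z | mdist (iter j S y) z < e])).
  apply: bigcup_open => j _; apply: bigcup_open => k _.
  apply: open_comp; last exact: open_mdist_lt.
  by move=> z _; exact: continuous_iter_isometry.
apply/seteqP; split => [z [j [k yz]]|z [j _ [k _ yz]]]; last by exists j, k.
by exists j => //; exists k.
Qed.

End orbit_proximity.

Lemma separating_sequence (R : realType) (d : measure_display)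
    (X : measurableType d) : standard_borel R X ->
  exists G : nat -> nat -> set X,
    forall x x', (forall a k, G a k x <-> G a k x') -> x = x'.
Proof.
move=> [P [_ [D /countable_injP[g ginj] denseD] [f [bijf _]]]].
exists (fun a k => [set x | exists e, [/\ D e, g e = a & mdist e (f x) < k.+1%:R^-1]]).
move=> x x' xx'; apply: (bij_inj bijf); apply: contrapT => fxx'.
have r0 : 0 < mdist (f x) (f x') by rewrite mdist_gt0; exact/eqP.
set r := mdist _ _ in r0; pose k := Num.truncn (2 / r).
have kr : k.+1%:R^-1 < r / 2.
  rewrite invf_plt ?posrE ?ltr0n ?divr_gt0//.
  by rewrite invf_div truncnS_gt.
have k0 : 0 < k.+1%:R^-1 :> R by rewrite invr_gt0.
have [e [xe De]] : [set z | mdist (f x) z < k.+1%:R^-1] `&` D !=set0.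
  by apply: denseD; [exists (f x); rewrite /= mdistxx|exact: open_mdist_lt].
have [+ _] := xx' (g e) k; case.
  by exists e; split => //; rewrite metric_sym.
move=> e' [De' /ginj]; rewrite !inE => /(_ De' De) -> ex'.
have := metric_triangle (f x) e (f x'); rewrite -/r => rle.
have := lt_trans (le_lt_trans rle (ltrD xe ex')) (ltrD kr kr).
by rewrite -splitr ltxx.
Qed.

(** [l u] is the first admissible [t] in a well order of [T]; it will select a centre for each point
    of a cover. *)
Lemma well_ordered_choice (T : eqType) (U : Type) (Q : U -> T -> Prop) :
  (forall u, exists t, Q u t) ->
  exists (le : T -> T -> Prop) (l : U -> T),
    [/\ forall s t, le s t -> le t s -> s = t, forall s t, le s t \/ le t s &
        forall u, Q u (l u) /\ forall t, Q u t -> le (l u) t].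
Proof.
move=> exQ; have [le wo] := wochoice.well_ordering_principle T.
have least (P : T -> Prop) : (exists t, P t) -> exists t, P t /\ forall s, P s -> le t s.
  move=> [t Pt]; have [|m [[Pm mP] _]] := wo (fun t => `[< P t >]).
    by exists t; exact/asboolP.
  exists m; split; first exact/asboolP.
  by move=> s Ps; apply: mP; exact/asboolP.
have tot s t : le s t \/ le t s.
  have [|m [[<-|<-] mle]] := least (fun x => s = x \/ t = x).
  - by exists s; left.
  - by left; apply: mle; right.
  - by right; apply: mle; left.
have refl s : le s s by case: (tot s s).
(* Otherwise the pair would have two minima, while the well order makes the minimum unique. *)
have anti s t : le s t -> le t s -> s = t.
  move=> st ts; have [|m [_ uniq_m]] := wo (fun x => (x == s) || (x == t)).
    by exists s; rewrite unfold_in eqxx.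
  have min x : (x == s) || (x == t) ->
      wochoice.minimum_of le (fun x => (x == s) || (x == t)) x.
    move=> xst; split => // y; rewrite unfold_in.
    by move: xst => /orP[/eqP->|/eqP->] /orP[/eqP->|/eqP->]; rewrite ?refl ?st ?ts.
  have ms : m = s by apply/uniq_m/min; rewrite eqxx.
  by rewrite -ms; apply/uniq_m/min; rewrite eqxx orbT.
have /choice[l Hl] u := least _ (exQ u).
by exists (fun s t => le s t), l.
Qed.

(** * A single essential orbit without separability *)

Section essential_orbit.
Context {R : realType} {d : measure_display} {X : measurableType d}.
Variables (mu : {measure set X -> \bar R}) (T : X -> X).
Hypothesis muT0 : mu setT <> 0%E.
Hypothesis sbX : standard_borel R X.
Hypothesis erg : forall B, measurable B ->
  {ae mu, forall x, B (T x) <-> B x} ->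
  {ae mu, forall x, ~ B x} \/ {ae mu, forall x, B x}.
Context {Y : metricType R}.
Variables (S : Y -> Y) (phi : X -> Y).
Hypothesis iS : Defs.isometry S.
Hypothesis bphi : borel_map phi.
Hypothesis phiT : {ae mu, forall x, S (phi x) = phi (T x)}.

Lemma ae_exists_nonnull (P : X -> Prop) : {ae mu, forall x, P x} -> exists x, P x.
Proof.
move=> aeP; have pT : (0 < mu setT)%E by rewrite lt0e measure_ge0 andbT; exact/eqP.
have := ae_properfilter_algebraOfSetsType pT => PF.
by have [x Px] := @filter_ex _ _ PF _ aeP; exists x.
Qed.

Let open_invariant01 (U : set Y) : open U -> (forall z, U (S z) <-> U z) ->
  {ae mu, forall x, ~ U (phi x)} \/ {ae mu, forall x, U (phi x)}.
Proof.
move=> oU SU; apply: (erg (B := phi @^-1` U)).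
  by apply: bphi; exact: borel_open.
by apply: filterS phiT => x; rewrite /preimage /= => <-.
Qed.

(* A. H. Stone's sigma-discrete refinement of the cover by the sets of points
   near an orbit; [X] being countably separated, a zero-one measure cannot be
   spread over a discrete family. *)
Lemma essential_near (e : R) : 0 < e ->
  exists y, {ae mu, forall x, orbit_near S e y (phi x)}.
Proof.
move=> e0.
have [le [l [anti tot least]]] := @well_ordered_choice Y Y (fun u y => orbit_near S e y u)
  (fun u => ex_intro (orbit_near S e ^~ u) u (orbit_near_refl S u e0)).
pose del n : R := n.+1%:R^-1.
have del0 n : 0 < del n by rewrite invr_gt0.
(* Points close to some [u] whose first centre is [y], [u] lying in the set of points near [y] with
   margin [2 del n]. *)
pose V n y : set Y := [set z | exists u, [/\ l u = y, orbit_near S (del n) u z &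
  forall v, orbit_near S (2 * del n) u v -> orbit_near S e y v]].
have V_near n y z : V n y z -> orbit_near S e y z.
  move=> [u [_ uz uV]]; apply: uV; apply: orbit_nearW uz.
  by have := del0 n; lra.
(* A common point puts [u'] within the margin of [u], so [y] is admissible for [u'], and [y'], being
   first for [u'], precedes [y]. *)
have V_lt n y y' z : le y y' -> V n y z -> V n y' z -> y = y'.
  move=> yy' [u [lu uz uV]] [u' [lu' uz' uV']].
  apply: anti => //; rewrite -lu'; apply: (proj2 (least u')); apply: uV.
  rewrite mulr_natl mulr2n; apply: orbit_near_trans uz (orbit_near_sym uz') => //.
have V_inj n y y' z : V n y z -> V n y' z -> y = y'.
  move=> Vy Vy'; have [yy'|yy'] := tot y y'; first exact: V_lt Vy Vy'.
  by apply/esym; exact: V_lt Vy' Vy.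
(* Open and invariant for an arbitrary set [J] of centres, so the zero-one law holds for each such
   union. *)
pose U n (J : set Y) := \bigcup_(y in J) V n y.
have oU n J : open (U n J).
  apply: bigcup_open => y _.
  rewrite (_ : V n y = \bigcup_(u in [set u | l u = y /\
      forall v, orbit_near S (2 * del n) u v -> orbit_near S e y v])
      [set z | orbit_near S (del n) u z]).
    by apply: bigcup_open => u _; exact: open_orbit_near.
  apply/seteqP; split => [z [u [lu uz uV]]|z [u [lu uV] uz]]; last by exists u.
  by exists u.
have SU n J z : U n J (S z) <-> U n J z.
  split=> -[y Jy [u [lu uz uV]]]; exists y => //; exists u; split => //.
    by apply/(orbit_nearS iS).
  by apply/(orbit_nearS iS).
have U01 n J := open_invariant01 (oU n J) (@SU n J).
have cover z : exists n, U n setT z.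
  have [[j [k yz]] _] := least z.
  pose r := (e - mdist (iter j S (l z)) (iter k S z)) / 2.
  have r0 : 0 < r by rewrite divr_gt0// subr_gt0.
  have [n nr] : exists n, 2 * del n <= r.
    exists (Num.truncn (2 / r)); rewrite /del ler_pdivrMr ?ltr0n// mulrC.
    by rewrite -ler_pdivrMr// ltW// truncnS_gt.
  exists n, (l z) => //; exists z; split => //; first exact: orbit_near_refl.
  move=> v zv; have -> : e = (e - r) + r by rewrite subrK.
  apply: (orbit_near_trans iS (z := z)); last exact: orbit_nearW nr zv.
  by exists j, k; move: r0; rewrite /r; lra.
have [n Un] : exists n, {ae mu, forall x, U n setT (phi x)}.
  apply: contrapT => /forallNP nU.
  have aeN : {ae mu, forall x, forall n, ~ U n setT (phi x)}.
    by apply: ae_foralln => n; case: (U01 n setT) => // /nU.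
  by have [x xN] := ae_exists_nonnull aeN; have [n /xN] := cover (phi x).
have [G sepG] := separating_sequence sbX.
(* Labels each centre whose cell meets the image of [phi] by a point of [X] falling in that cell.
   Cells being disjoint, the label determines the centre, and labels live in a countably separated
   space. *)
have /choice[s Vs] : forall y, exists x,
    forall x', V n y (phi x') -> V n y (phi x).
  move=> y; have [[x yx]|nx] := pselect (exists x, V n y (phi x)); first by exists x.
  by exists point => x' yx'; case: nx; exists x'.
(* The zero-one law for these countably many sets of centres decides almost surely in which sets
   [G a k] the label lies, so it is almost surely constant. *)
pose J a k : set Y := [set y | G a k (s y)].
have /choice[b Hb] : forall ak : nat * nat, exists b : Prop,
    {ae mu, forall x, U n (J ak.1 ak.2) (phi x) <-> b}.
  move=> [a k]; have [h|h] := U01 n (J a k); [exists False|exists True].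
    by apply: filterS h => x; tauto.
  by apply: filterS h => x; tauto.
have {}Hb : {ae mu, forall x, forall a k, U n (J a k) (phi x) <-> b (a, k)}.
  by apply: ae_foralln => a; apply: ae_foralln => k; exact: (Hb (a, k)).
have [x0 [[y0 _ Vy0] bx0]] := ae_exists_nonnull (filterI Un Hb).
exists y0; apply: filterS2 Un Hb => x [y _ Vy] bx.
suff sy : s y = s y0.
  have := Vs _ _ Vy; rewrite sy => /V_inj/(_ (Vs _ _ Vy0)) <-.
  exact: V_near Vy.
have JU w z : V n w z -> forall a k, U n (J a k) z <-> G a k (s w).
  move=> Vw a k; split => [[w' Jw' /V_inj/(_ Vw) <-//]|Gw]; by exists w.
by apply: sepG => a k; rewrite -(JU _ _ Vy) -(JU _ _ Vy0) bx bx0.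
Qed.

Lemma essential_orbit : exists y0,
  {ae mu, forall x, forall e, 0 < e -> orbit_near S e y0 (phi x)}.
Proof.
have /choice[y Hy] : forall n, exists y, {ae mu, forall x, orbit_near S n.+1%:R^-1 y (phi x)}.
  by move=> n; apply: essential_near; rewrite invr_gt0.
have Hy' : {ae mu, forall x, forall n, orbit_near S n.+1%:R^-1 (y n) (phi x)}.
  exact: ae_foralln.
have [x0 Hx0] := ae_exists_nonnull Hy'.
(* The centre [y n] depends on the radius; passing through it, one generic point of the image serves
   for all radii. *)
exists (phi x0); apply: filterS Hy' => x Hx e e0.
pose n := Num.truncn (2 / e).
have ne : n.+1%:R^-1 < e / 2.
  by rewrite invf_plt ?posrE ?ltr0n ?divr_gt0// invf_div truncnS_gt.
apply: orbit_nearW (orbit_near_trans iS (orbit_near_sym (Hx0 n)) (Hx n)).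
by rewrite [leRHS](splitr e) lerD// ltW.
Qed.

End essential_orbit.

(** * Recurrence and compactness of orbit closures *)

Section forward_orbit.
Context {R : realType} {Y : metricType R}.
Variable S : Y -> Y.
Hypothesis iS : Defs.isometry S.
Variable y0 : Y.

Definition forward_closure : set Y :=
  [set z | forall e : R, 0 < e -> exists j, mdist (iter j S y0) z < e].

(** [n.+1] excludes the trivial return at time 0. *)
Definition recurrent := forall e : R, 0 < e -> exists n, mdist (iter n.+1 S y0) y0 < e.

Local Notation Z := forward_closure.

Lemma forward_closure_orbit n : Z (iter n S y0).
Proof. by move=> e e0; exists n; rewrite mdistxx. Qed.

Lemma forward_closureS z : Z z -> Z (S z).
Proof. by move=> Zz e /Zz[j jz]; exists j.+1; rewrite /= iS. Qed.

Lemma forward_closure_iter n z : Z z -> Z (iter n S z).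
Proof. by move=> Zz; elim: n => //= n; exact: forward_closureS. Qed.

Lemma closed_forward_closure : closed Z.
Proof.
move=> z clz e e0; have e2 : 0 < e / 2 by rewrite divr_gt0.
have [u [Zu zu]] := clz _ (nbhsx_ballx z _ e2).
have [j ju] := Zu _ e2; exists j.
apply: le_lt_trans (metric_triangle _ u _) _.
rewrite [ltRHS](splitr e) ltrD// metric_sym.
by rewrite ballEmdist in zu.
Qed.

Hypothesis rec : recurrent.

Lemma mdist_iter_mul n k (y : Y) :
  mdist (iter (n * k) S y) y <= k%:R * mdist (iter n S y) y.
Proof.
elim: k => [|k IHk]; first by rewrite muln0 mdistxx mul0r.
rewrite mulnS iterD; apply: le_trans (metric_triangle _ (iter n S y) _) _.
by rewrite isometry_iter// -addn1 natrD mulrDl mul1r lerD2r.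
Qed.

(** Repeating [N] times a return within [e / (N+1)] takes at least [N] steps and drifts by less than
    [e]. *)
Lemma recurrent_large (e : R) N : 0 < e ->
  exists2 n, (N <= n)%N & mdist (iter n S y0) y0 < e.
Proof.
move=> e0; have [n nN] := rec (divr_gt0 e0 (ltr0Sn R N)).
exists (n.+1 * N)%N; first by rewrite leq_pmull.
apply: le_lt_trans (mdist_iter_mul _ _ _) _.
apply: (@le_lt_trans _ _ (N%:R * (e / N.+1%:R))).
  by rewrite ler_wpM2l// ltW.
by rewrite mulrCA gtr_pMr// ltr_pdivrMr ?ltr0n// mul1r ltr_nat.
Qed.

(** A backward time is traded for a forward one: if [S^j y0] is close to [S^k z] and [S^n y0] to
    [y0] with [n >= k], then [S^(n-k+j) y0] is close to [z]. *)
Lemma orbit_near_forward_closure z :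
  (forall e, 0 < e -> orbit_near S e y0 z) -> Z z.
Proof.
move=> nz e e0; have e2 : 0 < e / 2 by rewrite divr_gt0.
have [j [k jk]] := nz _ e2; have [n kn nN] := recurrent_large k e2.
exists (n - k + j)%N.
rewrite -(isometry_iter iS k) -iterD addnA subnKC//.
apply: le_lt_trans (metric_triangle _ (iter j S y0) _) _.
by rewrite [ltRHS](splitr e) ltrD// addnC iterD isometry_iter.
Qed.

Lemma forward_closureSV z : Z (S z) -> Z z.
Proof.
move=> Zz; apply: orbit_near_forward_closure => e /Zz[j jz].
by exists j, 1%N.
Qed.

Lemma forward_closure_return z (e : R) : Z z -> 0 < e ->
  exists k, mdist (iter k.+1 S z) y0 < e.
Proof.
move=> Zz e0; have e2 : 0 < e / 2 by rewrite divr_gt0.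
have [j jz] := Zz _ e2; have [n jn nN] := recurrent_large j.+1 e2.
exists (n - j.+1)%N; rewrite -subSn// subSS.
apply: le_lt_trans (metric_triangle _ (iter n S y0) _) _.
rewrite [ltRHS](splitr e) ltrD// metric_sym.
by rewrite -[in iter n S y0](subnK (ltnW jn)) iterD isometry_iter.
Qed.

Hypothesis lcY : locally_compact [set: Y].

(** A compact neighbourhood [C] of [y0] in [Z] is revisited by each of its points, by compactness
    within a bounded time [K]. The orbit hence stays in the union of the [S^i C] with [i <= K],
    which is compact. *)
Lemma compact_forward_closure : compact Z.
Proof.
have [U] := @lcY y0 I; rewrite withinET => nU [cU clU].
have /nbhs_ballP[r /= r0 rU] := nU.
pose C := U `&` Z.
have cC : compact C by apply: compact_closedI => //; exact: closed_forward_closure.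
have CE z : Z z -> mdist z y0 < r -> C z.
  by move=> Zz zr; split => //; apply: rU; rewrite ballEmdist /= metric_sym.
have Cy0 : C y0 by apply: CE; [exact: (forward_closure_orbit 0)|rewrite mdistxx].
have [K HK] : exists K, forall z, C z -> exists2 k, (k < K)%N & mdist (iter k.+1 S z) y0 < r.
  have /compact_near_coveringP := cC.
  move=> /(_ nat \oo (fun K z => exists2 k, (k < K)%N & mdist (iter k.+1 S z) y0 < r)).
  case=> [|K _ HK]; last by exists K => z Cz; exact: (HK K (leqnn K)).
  move=> z [_ Zz]; have [k kz] := forward_closure_return Zz r0.
  exists ([set u | mdist (iter k.+1 S u) y0 < r], [set K | (k < K)%N]).
    split => /=; last by exists k.+1.
    apply: open_nbhs_nbhs; split => //.
    rewrite (_ : [set u | _] = iter k.+1 S @^-1` [set v | mdist y0 v < r]).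
      apply: open_comp; last exact: open_mdist_lt.
      by move=> u _; exact: continuous_iter_isometry.
    by apply/seteqP; split => u /=; rewrite metric_sym.
  by move=> [u i] /= [ur ki]; exists k.
have orbC n : exists i z, [/\ (i <= K)%N, C z & iter n S y0 = iter i S z].
  elim: n => [|n [i [z [iK Cz nz]]]]; first by exists 0%N, y0.
  move: iK; rewrite leq_eqVlt => /orP[/eqP iK|iK]; last first.
    by exists i.+1, z; rewrite /= nz.
  have [k kK kz] := HK z Cz.
  exists (i - k.+1).+1, (iter k.+1 S z); split.
  - by rewrite iK -subSn// subSS leq_subr.
  - by apply: CE => //; apply: forward_closure_iter; case: Cz.
  - by rewrite !iterS nz -(iterS k) -iterD subnK// iK.
pose W := \big[setU/set0]_(i < K.+1) (iter i S @` C).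
have cW : compact W.
  apply: bigsetU_compact => i _; apply: continuous_compact => //.
  by apply: continuous_subspaceT; exact: continuous_iter_isometry.
apply: (subclosed_compact closed_forward_closure cW) => z Zz.
have clW : closed W by apply: compact_closed => //; exact: (@metric_hausdorff R).
apply: clW => N /nbhs_ballP[e /= e0 eN].
have [n nz] := Zz e e0; exists (iter n S y0); split; last first.
  by apply: eN; rewrite ballEmdist /= metric_sym.
rewrite /W -(bigcup_mkord _ (fun i => iter i S @` C)); have [i [u [iK Cu ->]]] := orbC n.
by exists i => //; exists u.
Qed.

End forward_orbit.

(** Bundled so that the pointed, measurable and probability structures below can be attached to a
    type depending on one parameter. *)
Record orbit_system (R : realType) := OrbitSystem {
  os_space : metricType R;
  os_map : os_space -> os_space;
  os_inv : os_space -> os_space;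
  os_mapK : cancel os_map os_inv;
  os_invK : cancel os_inv os_map;
  os_point : os_space;
  os_isometry : Defs.isometry os_map;
  os_recurrent : recurrent os_map os_point;
  os_compact : compact (forward_closure os_map os_point) }.

(** * Ergodic measure of a compact orbit closure *)

Section mean.
Context {R : realType}.
Variable o : orbit_system R.
Local Notation Y := (os_space o).
Local Notation S := (@os_map R o).
Local Notation y0 := (os_point o).
Local Notation Z := (forward_closure S y0).
Implicit Types f g : Y -> R.

Let iS : Defs.isometry S. Proof. exact: os_isometry. Qed.

(** Composition with an isometry keeps both constants, so the averages of such a function are
    equi-Lipschitz and compactness makes their convergence uniform. *)
Definition bl f := (exists M : R, forall y, `|f y| <= M) /\
  exists2 L : R, 0 <= L & forall y z, `|f y - f z| <= L * mdist y z.

Lemma bl_cst (c : R) : bl (fun=> c).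
Proof.
split; first by exists `|c|.
by exists 0 => // y z; rewrite subrr normr0 mul0r.
Qed.

Lemma blD f g : bl f -> bl g -> bl (fun y => f y + g y).
Proof.
move=> [[M fM] [L L0 fL]] [[M' gM] [L' L'0 gL]]; split.
  by exists (M + M') => y; exact: le_trans (ler_normD _ _) (lerD (fM y) (gM y)).
exists (L + L'); first exact: addr_ge0.
move=> y z; rewrite (_ : _ - _ = (f y - f z) + (g y - g z)); last by ring.
by rewrite mulrDl; exact: le_trans (ler_normD _ _) (lerD (fL y z) (gL y z)).
Qed.

Lemma blM f g : bl f -> bl g -> bl (fun y => f y * g y).
Proof.
move=> [[M fM] [L L0 fL]] [[M' gM] [L' L'0 gL]]; split.
  by exists (M * M') => y; rewrite normrM ler_pM.
have M0 : 0 <= M by exact: le_trans (fM y0).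
have M'0 : 0 <= M' by exact: le_trans (gM y0).
exists (L * M' + M * L'); first by rewrite addr_ge0// mulr_ge0.
move=> y z; rewrite (_ : _ - _ = (f y - f z) * g y + f z * (g y - g z)); last by ring.
apply: le_trans (ler_normD _ _) _; rewrite !normrM mulrDl.
rewrite (_ : L * M' * mdist y z = L * mdist y z * M'); last by ring.
rewrite -(mulrA M); apply: lerD; apply: ler_pM => //.
Qed.

Lemma blZ (c : R) f : bl f -> bl (fun y => c * f y).
Proof. exact: blM (bl_cst c). Qed.

Lemma blN f : bl f -> bl (fun y => - f y).
Proof. by move=> /(blZ (-1)); under eq_fun do rewrite mulN1r. Qed.

Lemma blB f g : bl f -> bl g -> bl (fun y => f y - g y).
Proof. by move=> bf bg; exact: blD bf (blN bg). Qed.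

Lemma bl_iter n f : bl f -> bl (fun y => f (iter n S y)).
Proof.
move=> [[M fM] [L L0 fL]]; split; first by exists M => y.
by exists L => // y z; rewrite -(isometry_iter iS n y z).
Qed.

Lemma bl_sum N (F : nat -> Y -> R) : (forall n, bl (F n)) ->
  bl (fun y => \sum_(n < N) F n y).
Proof.
move=> bF; elim: N => [|N IHN].
  by under eq_fun do rewrite big_ord0; exact: bl_cst.
by under eq_fun do rewrite big_ord_recr /=; exact: blD.
Qed.

Lemma bl_maxr f (c : R) : bl f -> bl (fun y => Num.max c (f y)).
Proof.
move=> [[M fM] [L L0 fL]]; split.
  exists (`|c| + M) => y; rewrite /Num.max; case: ifP => _.
    by rewrite (le_trans (fM y))// lerDr.
  by rewrite lerDl (le_trans _ (fM y)).
exists L => // y z; apply: le_trans (fL y z).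
have := ler_norm (f y - f z); have := ler_norm (f z - f y); rewrite (distrC (f z)).
rewrite ler_norml; case: (leP c (f y)) => ?; case: (leP c (f z)) => ? ? ?.
- by apply/andP; split; lra.
- by apply/andP; split; lra.
- by apply/andP; split; lra.
- by have := normr_ge0 (f y - f z); move=> ?; apply/andP; split; lra.
Qed.

Lemma bl_minr f (c : R) : bl f -> bl (fun y => Num.min c (f y)).
Proof.
move=> bf; have := blN (bl_maxr (- c) (blN bf)); congr bl.
by apply/funext => y; rewrite oppr_max !opprK.
Qed.

Definition avg N f z : R := N%:R^-1 * \sum_(n < N) f (iter n S z).

Lemma bl_avg N f : bl f -> bl (avg N f).
Proof.
move=> bf; apply: blZ; apply: (bl_sum N (F := fun n y => f (iter n S y))) => n.
exact: bl_iter.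
Qed.

Lemma orbit_finite_net (e : R) : 0 < e ->
  exists K, forall z, Z z -> exists2 k, (k <= K)%N & mdist (iter k S y0) z < e.
Proof.
move=> e0; have /compact_near_coveringP := os_compact (o := o).
move=> /(_ nat \oo (fun K z => exists2 k, (k <= K)%N & mdist (iter k S y0) z < e)).
case=> [|K _ HK]; last by exists K => z Zz; exact: (HK K (leqnn K)).
move=> z Zz; have [k kz] := Zz e e0.
exists ([set u | mdist (iter k S y0) u < e], [set K | (k <= K)%N]).
  split => /=; last by exists k.
  by apply: open_nbhs_nbhs; split => //; exact: open_mdist_lt.
by move=> [u i] /= [ur ki]; exists k.
Qed.

(** Each step of the shift changes the sum by two end terms. *)
Lemma avg_shift N f M k z : (forall y, `|f y| <= M) ->
  `|avg N f (iter k S z) - avg N f z| <= N%:R^-1 * (2 * k%:R * M).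
Proof.
move=> fM; elim: k => [|k IHk]; first by rewrite subrr normr0 mulr0 mul0r mulr0.
apply: le_trans (ler_distD (avg N f (iter k S z)) _ _) _.
have -> : N%:R^-1 * (2 * k.+1%:R * M) = N%:R^-1 * (2 * M) + N%:R^-1 * (2 * k%:R * M).
  by rewrite -[k.+1]addn1 natrD; ring.
rewrite lerD//.
rewrite /avg -mulrBr normrM ger0_norm ?invr_ge0// ler_wpM2l ?invr_ge0//.
rewrite -sumrB.
under eq_bigr => n _ do rewrite -iterD addnS iterS -iterD.
set u := fun n => f (iter (n + k) S z).
rewrite (eq_bigr (fun n : 'I_N => u n.+1 - u n))//.
rewrite -(big_mkord xpredT (fun n => u n.+1 - u n)) telescope_sumr//.
apply: le_trans (ler_normB _ _) _.
have uN : `|u N| <= M := fM _; have u0 : `|u 0%N| <= M := fM _.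
by lra.
Qed.

Lemma ler_avg N f g z : Z z -> (forall y, Z y -> f y <= g y) ->
  avg N f z <= avg N g z.
Proof.
move=> Zz fg; rewrite /avg ler_wpM2l ?invr_ge0// ler_sum// => n _.
by apply: fg; exact: forward_closure_iter.
Qed.

Lemma avg_cst N (c : R) z : (0 < N)%N -> avg N (fun=> c) z = c.
Proof.
move=> N0; rewrite /avg sumr_const card_ord -[c *+ N]mulr_natr mulrC mulfK//.
by rewrite pnatr_eq0 -lt0n.
Qed.

Lemma avg_dist N f g z (e : R) : (0 < N)%N -> Z z ->
  (forall y, Z y -> `|f y - g y| <= e) -> `|avg N f z - avg N g z| <= e.
Proof.
move=> N0 Zz fg; rewrite /avg -mulrBr -sumrB normrM ger0_norm ?invr_ge0//.
rewrite -[leRHS](avg_cst e z N0) /avg ler_wpM2l ?invr_ge0//.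
apply: le_trans (ler_norm_sum _ _ _) _; apply: ler_sum => n _.
by apply: fg; exact: forward_closure_iter.
Qed.

Lemma avg_comm N M f z : avg N (avg M f) z = avg M (avg N f) z.
Proof.
rewrite /avg -!mulr_sumr !mulrA (mulrC M%:R^-1); congr (_ * _).
rewrite exchange_big; apply: eq_bigr => n _; apply: eq_bigr => k _.
by rewrite -!iterD addnC.
Qed.

(** Every [z] is close to some [S^k y0] with [k <= K] and remains so under all iterates, which costs
    [e / 2]; moving from [S^k y0] to [y0] costs at most [2 K M / N], again [e / 2] for large [N]. *)
Lemma avg_oscillation f (e : R) : bl f -> 0 < e -> exists2 N0, (0 < N0)%N &
  forall N z, (N0 <= N)%N -> Z z -> `|avg N f z - avg N f y0| <= e.
Proof.
move=> bf e0; have [[M fM] [L L0 fL]] := bf.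
have M0 : 0 <= M by exact: le_trans (fM y0).
have d0 : 0 < e / (2 * (L + 1)) by rewrite divr_gt0// mulr_gt0// ltr_wpDl.
have [K HK] := orbit_finite_net d0.
pose N0 := (Num.truncn (4 * K%:R * M / e)).+1.
exists N0 => // N z N0N Zz; have [k kK kz] := HK z Zz.
have N_gt0 : (0 < N)%N by exact: leq_trans N0N.
apply: le_trans (ler_distD (avg N f (iter k S y0)) _ _) _.
rewrite (splitr e) lerD//.
  rewrite /avg -mulrBr -sumrB normrM ger0_norm ?invr_ge0//.
  rewrite -[leRHS](avg_cst (e / 2) z N_gt0) /avg ler_wpM2l ?invr_ge0//.
  apply: le_trans (ler_norm_sum _ _ _) _; apply: ler_sum => n _.
  apply: le_trans (fL _ _) _; rewrite isometry_iter// metric_sym.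
  apply: (@le_trans _ _ (L * (e / (2 * (L + 1))))); first by rewrite ler_wpM2l// ltW.
  rewrite (_ : _ * _ = (e / 2) * (L / (L + 1))); last by field; lra.
  by rewrite ger_pMr ?divr_gt0// ler_pdivrMr; lra.
apply: le_trans (avg_shift N k y0 fM) _.
rewrite mulrC ler_pdivrMr ?ltr0n//.
apply: (@le_trans _ _ (2 * K%:R * M)).
  by rewrite ler_wpM2r// ler_wpM2l// ler_nat.
rewrite [leRHS]mulrC -ler_pdivrMr ?divr_gt0//.
have NN : N0%:R <= N%:R :> R by rewrite ler_nat.
apply: le_trans _ NN.
rewrite (_ : _ / _ = 4 * K%:R * M / e); last by field; lra.
by rewrite ltW// truncnS_gt.
Qed.

Definition mean f : R := limn (fun n => avg n f y0).

(** Averages commute. As [avg N f] and [avg M f] are almost constant on [Z], the double average is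
    close to both values at [y0], which gives a Cauchy sequence and shows that the [limn] in [mean]
    is a genuine limit. *)
Lemma mean_uniform f (e : R) : bl f -> 0 < e -> exists2 N0, (0 < N0)%N &
  forall N z, (N0 <= N)%N -> Z z -> `|avg N f z - mean f| <= e.
Proof.
move=> bf.
have Zy0 : Z y0 := @forward_closure_orbit R Y S y0 0.
have cau (e' : R) : 0 < e' -> exists2 N0, (0 < N0)%N & forall N M, (N0 <= N)%N -> (N0 <= M)%N ->
    `|avg N f y0 - avg M f y0| <= e'.
  move=> e'0; have e2 : 0 < e' / 2 by rewrite divr_gt0.
  have [N0 N0_gt0 HN0] := avg_oscillation bf e2; exists N0 => // N M NN MN.
  apply: le_trans (ler_distD (avg N (avg M f) y0) _ _) _; rewrite (splitr e') lerD//.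
    rewrite avg_comm distrC -[X in `|_ - X|](avg_cst (avg N f y0) y0 (leq_trans N0_gt0 MN)).
    by apply: avg_dist => //; [exact: leq_trans MN|move=> y Zy; exact: HN0].
  rewrite -[X in `|_ - X|](avg_cst (avg M f y0) y0 (leq_trans N0_gt0 NN)).
  by apply: avg_dist => //; [exact: leq_trans NN|move=> y Zy; exact: HN0].
have cv : cvgn (fun n => avg n f y0).
  apply: cauchy_cvg; apply/cauchyP => e' e'0.
  have e2 : 0 < e' / 2 by rewrite divr_gt0.
  have [N0 _ HN0] := cau _ e2; exists (avg N0 f y0), N0 => // n /= N0n.
  rewrite -ball_normE /=; apply: le_lt_trans (HN0 _ _ (leqnn _) N0n) _.
  by rewrite ltr_pdivrMr// ltr_pMr// ltr1n.
move=> e0; have e2 : 0 < e / 2 by rewrite divr_gt0.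
have [N1 N1_gt0 HN1] := avg_oscillation bf e2.
have [N2 _ HN2] := cau _ e2.
exists (maxn N1 N2); first by rewrite leq_max N1_gt0.
move=> N z; rewrite geq_max => /andP[N1N N2N] Zz.
apply: le_trans (ler_distD (avg N f y0) _ _) _; rewrite (splitr e) lerD//.
  exact: HN1.
have cN : (fun n => `|avg N f y0 - avg n f y0|) @ \oo --> `|avg N f y0 - mean f|.
  by apply: cvg_norm; apply: cvgB; [exact: cvg_cst|exact: cv].
by apply: (cvgr_to_le cN); exists N2 => // n /= N2n; exact: HN2.
Qed.

Lemma avg_cvg f z : bl f -> Z z -> avg n f z @[n --> \oo] --> mean f.
Proof.
move=> bf Zz; apply/cvgrPdist_le => e e0.
have [N0 _ HN0] := mean_uniform bf e0.
by exists N0 => // n /= N0n; rewrite distrC; exact: HN0.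
Qed.

Let Zy0 : Z y0. Proof. exact: (@forward_closure_orbit R Y S y0 0). Qed.

Let mean_eq f l : bl f -> avg n f y0 @[n --> \oo] --> l -> mean f = l.
Proof. by move=> _ /cvg_lim; apply. Qed.

Lemma meanD f g : bl f -> bl g -> mean (fun y => f y + g y) = mean f + mean g.
Proof.
move=> bf bg; apply: mean_eq; first exact: blD.
rewrite (_ : (fun n => _) = (fun n => avg n f y0 + avg n g y0)).
  by apply: cvgD; exact: avg_cvg.
by apply/funext => n; rewrite /avg big_split/= mulrDr.
Qed.

Lemma meanZ (c : R) f : bl f -> mean (fun y => c * f y) = c * mean f.
Proof.
move=> bf; apply: mean_eq; first exact: blZ.
rewrite (_ : (fun n => _) = (fun n => c * avg n f y0)).
  by apply: cvgMr; exact: avg_cvg.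
by apply/funext => n; rewrite /avg -mulr_sumr mulrCA.
Qed.

Lemma meanB f g : bl f -> bl g -> mean (fun y => f y - g y) = mean f - mean g.
Proof.
move=> bf bg; rewrite -[in RHS]mulN1r -meanZ// -meanD//; last exact: blZ.
by congr mean; apply/funext => y; rewrite mulN1r.
Qed.

Lemma mean_cst (c : R) : mean (fun=> c) = c.
Proof.
apply: mean_eq; first exact: bl_cst.
apply: cvg_near_cst.
by exists 1%N => // n /= n0; rewrite avg_cst.
Qed.

Lemma mean_sum N (F : nat -> Y -> R) : (forall n, bl (F n)) ->
  mean (fun y => \sum_(n < N) F n y) = \sum_(n < N) mean (F n).
Proof.
move=> bF; elim: N => [|N IHN].
  rewrite big_ord0 -[RHS](mean_cst 0).
  by congr mean; apply/funext => y; rewrite big_ord0.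
rewrite big_ord_recr /= -IHN -meanD//; last exact: (bl_sum N bF).
by congr mean; apply/funext => y; rewrite big_ord_recr.
Qed.

Lemma ler_mean f g : bl f -> bl g -> (forall y, Z y -> f y <= g y) ->
  mean f <= mean g.
Proof.
move=> bf bg fg; apply: ler_lim.
- by apply/cvg_ex; exists (mean f); exact: avg_cvg.
- by apply/cvg_ex; exists (mean g); exact: avg_cvg.
- by apply: nearW => n; exact: ler_avg.
Qed.

Lemma mean_shift f : bl f -> mean (fun y => f (S y)) = mean f.
Proof.
move=> bf; apply: mean_eq; first exact: (bl_iter 1 bf).
rewrite (_ : (fun n => _) = (fun n => avg n f (S y0))).
  by apply: avg_cvg => //; exact: forward_closureS.
by apply/funext => n; rewrite /avg; congr (_ * _); apply: eq_bigr => k _; rewrite -iterSr.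
Qed.

Lemma mean_iter n f : bl f -> mean (fun y => f (iter n S y)) = mean f.
Proof.
move=> bf; elim: n => // n <-; rewrite -(mean_shift (bl_iter n bf)).
by congr mean; apply/funext => y; rewrite iterSr.
Qed.

Lemma mean_avg N f : bl f -> (0 < N)%N -> mean (avg N f) = mean f.
Proof.
move=> bf N0; have bfn n : bl (fun y => f (iter n S y)) by exact: bl_iter.
rewrite /avg meanZ; last exact: (bl_sum N bfn).
rewrite (mean_sum N bfn).
under eq_bigr do rewrite mean_iter//.
exact: avg_cst (mean f) y0 N0.
Qed.

End mean.

(** * The outer measure defined by the means *)

Section orbit_outer_measure.
Context {R : realType}.
Variable o : orbit_system R.
Local Notation Y := (os_space o).
Local Notation S := (@os_map R o).
Local Notation S' := (@os_inv R o).
Local Notation y0 := (os_point o).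
Local Notation Z := (forward_closure S y0).
Implicit Types (A B : set Y) (g : nat -> Y -> R).

Let iS : Defs.isometry S. Proof. exact: os_isometry. Qed.

Let SV z : Z z -> Z (S' z).
Proof.
move=> Zz; apply: (forward_closureSV iS (@os_recurrent _ o)).
by rewrite (@os_invK _ o).
Qed.

(* [v] bounds the means of an increasing sequence of functions dominating the
   indicator of [A] on the orbit closure. *)
Definition orbit_cover A (v : R) := exists g, [/\ forall K, bl (g K),
  forall K y, 0 <= g K y <= g K.+1 y,
  forall y, A y -> Z y -> exists K, 1 <= g K y &
  forall K, mean (g K) <= v].

Definition orbit_content A : R := inf [set v | orbit_cover A v].

Let cover_mono g : (forall K y, 0 <= g K y <= g K.+1 y) ->
  forall K K' y, (K <= K')%N -> g K y <= g K' y.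
Proof.
move=> gg K K' y /subnKC <-; elim: (K' - K)%N => [|n IHn]; first by rewrite addn0.
by apply: le_trans IHn _; rewrite addnS; have /andP[] := gg (K + n)%N y.
Qed.

Let cover_ge0 A v : orbit_cover A v -> 0 <= v.
Proof.
move=> [g [bg gg _ /(_ 0%N)]]; apply: le_trans.
rewrite -(mean_cst o 0); apply: ler_mean => //; first exact: bl_cst.
by move=> y _; have /andP[] := gg 0%N y.
Qed.

Let cover1 A : orbit_cover A 1.
Proof.
exists (fun _ _ => 1); split => //.
- by move=> _; exact: bl_cst.
- by move=> *; rewrite ler01 lexx.
- by move=> *; exists 0%N.
- by move=> _; rewrite mean_cst.
Qed.

Let has_inf_cover A : has_inf [set v | orbit_cover A v].
Proof.
split; first by exists 1; exact: cover1.
by exists 0 => v; exact: cover_ge0.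
Qed.

Lemma orbit_content_le A v : orbit_cover A v -> orbit_content A <= v.
Proof. by move=> Av; apply: ge_inf => //; have [] := has_inf_cover A. Qed.

Lemma orbit_content_ge A v : (forall u, orbit_cover A u -> v <= u) ->
  v <= orbit_content A.
Proof. by move=> Av; apply: lb_le_inf => //; have [] := has_inf_cover A. Qed.

Lemma orbit_content_ge0 A : 0 <= orbit_content A.
Proof. by apply: orbit_content_ge => u; exact: cover_ge0. Qed.

Lemma orbit_content_le1 A : orbit_content A <= 1.
Proof. by apply: orbit_content_le; exact: cover1. Qed.

Lemma orbit_content_adherent A (e : R) : 0 < e ->
  exists2 v, orbit_cover A v & v < orbit_content A + e.
Proof. by move=> e0; have [v Av] := inf_adherent e0 (has_inf_cover A); exists v. Qed.

Lemma orbit_cover_sub A B v : A `<=` B -> orbit_cover B v -> orbit_cover A v.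
Proof.
by move=> AB [g [bg gg gB gv]]; exists g; split => // y /AB; exact: gB.
Qed.

Lemma le_orbit_content A B : A `<=` B -> orbit_content A <= orbit_content B.
Proof.
by move=> AB; apply: orbit_content_ge => u /(orbit_cover_sub AB); exact: orbit_content_le.
Qed.

Lemma orbit_content0 : orbit_content set0 = 0.
Proof.
apply/eqP; rewrite eq_le orbit_content_ge0 andbT; apply: orbit_content_le.
exists (fun _ _ => 0); split => //.
- by move=> _; exact: bl_cst.
- by move=> *; rewrite lexx.
- by move=> _; rewrite mean_cst.
Qed.

(** As in Dini's theorem: the increasing functions reach 1 at each point of the compact [Z], so one
    of them exceeds [1 - e] on all of [Z]. *)
Lemma orbit_contentT : orbit_content setT = 1.
Proof.
apply/eqP; rewrite eq_le orbit_content_le1; apply: orbit_content_ge => v.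
move=> [g [bg gg gT gv]]; apply/ler_addgt0Pr => e e0.
have [K HK] : exists K, forall z, Z z -> 1 - e <= g K z.
  have /compact_near_coveringP := os_compact (o := o).
  move=> /(_ nat \oo (fun K z => 1 - e <= g K z)).
  case=> [|K _ HK]; last by exists K => z Zz; exact: (HK K (leqnn K)).
  move=> z Zz; have [K gK] := gT z I Zz.
  have [_ [L L0 gL]] := bg K.
  exists ([set u | mdist z u < e / (L + 1)], [set n | (K <= n)%N]).
    split => /=; last by exists K.
    apply: open_nbhs_nbhs; split; first exact: open_mdist_lt.
    by rewrite /= mdistxx divr_gt0// ltr_wpDl.
  move=> [u n] /= [zu Kn]; apply: le_trans (cover_mono gg u Kn).
  have := le_trans (ler_norm _) (gL z u).
  have : L * mdist z u <= e.
    move: zu; rewrite ltr_pdivlMr ?ltr_wpDl// => zu.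
    apply: le_trans (ltW zu); rewrite mulrDr mulr1 mulrC lerDl.
    exact: mdist_ge0.
  by lra.
have : 1 - e <= mean (g K).
  by rewrite -(mean_cst o (1 - e)); apply: ler_mean => //; exact: bl_cst.
by have := gv K; lra.
Qed.

Lemma orbit_content_support A : Z `<=` A -> orbit_content A = 1.
Proof.
move=> ZA; apply/eqP; rewrite eq_le orbit_content_le1 -orbit_contentT.
apply: orbit_content_ge => v [g [bg gg gA gv]]; apply: orbit_content_le.
by exists g; split => // y _ Zy; apply: gA => //; exact: ZA.
Qed.

Definition orbit_outer (A : set Y) : \bar R := (orbit_content A)%:E.

Let outer0 : orbit_outer set0 = 0%E.
Proof. by rewrite /orbit_outer orbit_content0. Qed.

Let outer_ge0 A : (0 <= orbit_outer A)%E.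
Proof. by rewrite lee_fin orbit_content_ge0. Qed.

Let le_outer : {homo orbit_outer : A B / A `<=` B >-> (A <= B)%E}.
Proof. by move=> A B AB; rewrite lee_fin le_orbit_content. Qed.

Let outer_sigma_subadditive : sigma_subadditive orbit_outer.
Proof.
move=> F; set s := (X in (_ <= X)%E).
have s0 : (0 <= s)%E by apply: nneseries_ge0.
have sge K : (\sum_(0 <= n < K) orbit_outer (F n) <= s)%E.
  by apply: nneseries_lim_ge.
move: s s0 sge => [r| |//] _ sge; last by rewrite leey.
rewrite lee_fin; apply/ler_addgt0Pr => e e0.
have e2 n : 0 < e / (2 ^ n.+1)%:R by rewrite divr_gt0// ltr0n expn_gt0.
have /choice[v Hv] : forall n, exists v, orbit_cover (F n) v /\
    v < orbit_content (F n) + e / (2 ^ n.+1)%:R.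
  by move=> n; have [v Fv vF] := orbit_content_adherent (F n) (e2 n); exists v.
have /choice[g Hg] : forall n, exists g, [/\ forall K, bl (g K),
    forall K y, 0 <= g K y <= g K.+1 y,
    forall y, F n y -> Z y -> exists K, 1 <= g K y &
    forall K, mean (g K) <= v n].
  by move=> n; have [[g Fg] _] := Hv n; exists g.
have gbl n K : bl (g n K) by have [] := Hg n.
have gmon n K y : 0 <= g n K y <= g n K.+1 y by have [] := Hg n.
have g0 n K y : 0 <= g n K y by have /andP[] := gmon n K y.
(* Diagonal cover: stage [K] adds the first [K] covers, each at its own stage [K], and so remains a
   finite sum. *)
apply: orbit_content_le; exists (fun K y => \sum_(n < K) g n K y); split.
- by move=> K; apply: (bl_sum K (F := fun n y => g n K y)).
- move=> K y; rewrite sumr_ge0//= big_ord_recr /=.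
  apply: ler_wpDr => //; apply: ler_sum => n _.
  by have /andP[] := gmon n K y.
- move=> y [n _ Fny] Zy; have [_ _ /(_ y Fny Zy)[K gK] _] := Hg n.
  exists (maxn K n.+1); apply: le_trans gK _.
  apply: le_trans (cover_mono (gmon n) y (leq_maxl K n.+1)) _.
  have nK : (n < maxn K n.+1)%N by rewrite leq_max leqnn orbT.
  by rewrite (bigD1 (Ordinal nK))//= lerDl sumr_ge0.
- move=> K; rewrite (mean_sum K (F := fun n y => g n K y))//.
  apply: (@le_trans _ _ (\sum_(n < K) (orbit_content (F n) + e / (2 ^ n.+1)%:R))).
    apply: ler_sum => n _; have [_ vF] := Hv n; apply: le_trans (ltW vF).
    by have [_ _ _] := Hg n; exact.
  rewrite big_split /= lerD//.
    have := sge K; rewrite big_mkord /orbit_outer sumEFin lee_fin.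
    exact.
  rewrite -lee_fin; apply: le_trans (epsilon_trick0 xpredT (ltW e0)).
  have := @nneseries_lim_ge R (fun n => (e / (2 ^ n.+1)%:R)%:E) xpredT 0%N K.
  rewrite big_mkord sumEFin; apply => n _ _.
  by rewrite lee_fin ltW.
Qed.

HB.instance Definition _ := isOuterMeasure.Build R Y orbit_outer outer0
  outer_ge0 le_outer outer_sigma_subadditive.

(* Splitting by the cutoffs [min 1 (K h)], where [h] vanishes off the ball. *)
Lemma orbit_content_split A (p : Y) (r : R) :
  orbit_content (A `&` [set z | mdist p z < r]) +
  orbit_content (A `&` ~` [set z | mdist p z < r]) <= orbit_content A.
Proof.
apply: orbit_content_ge => v [g [bg gg gA gv]].
have g0 K y : 0 <= g K y by have /andP[] := gg K y.
pose h y := Num.max 0 (r - mdist p y).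
have h0 y : 0 <= h y by rewrite le_max lexx.
have dL y z : `|mdist p y - mdist p z| <= mdist y z.
  have := metric_triangle p y z; have := metric_triangle p z y.
  by rewrite (metric_sym z) ler_norml => ? ?; apply/andP; split; lra.
have bh : bl h.
  split.
    exists `|r| => y; rewrite ger0_norm// /h ge_max normr_ge0/=.
    by apply: le_trans (ler_norm r); rewrite gerBl mdist_ge0.
  exists 1 => // y z; rewrite mul1r; apply: le_trans (dL y z).
  rewrite /h; move: (dL y z); set a := mdist p y; set b := mdist p z => _.
  have := ler_norm (a - b); have := ler_norm (b - a); rewrite (distrC b).
  rewrite ler_norml; case: (leP 0 (r - a)) => ?; case: (leP 0 (r - b)) => ? ? ?;
    by apply/andP; split; have := normr_ge0 (a - b); lra.
pose c K y := Num.min 1 (K%:R * h y).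
have bc K : bl (c K) by apply: bl_minr; exact: blZ.
have c01 K y : 0 <= c K y <= 1.
  by rewrite /c le_min ler01 mulr_ge0//= ge_min lexx.
have cmon K y : c K y <= c K.+1 y.
  rewrite /c le_min ge_min lexx /= ge_min; apply/orP; right.
  by rewrite ler_wpM2r// ler_nat.
have gcmon K y : 0 <= g K y * c K y <= g K.+1 y * c K.+1 y.
  have /andP[? ?] := c01 K y; have /andP[? ?] := gg K y.
  by rewrite mulr_ge0//= ler_pM.
have bgc K n : bl (fun y => g n y * c K y) by exact: blM.
(* [sup W] bounds the part inside the ball; a [K] almost attaining it fixes the cutoff used for the
   part outside. *)
pose W := [set mean (fun y => g K y * c K y) | K in [set: nat]].
have Wv : ubound W v.
  move=> _ [K _ <-]; apply: le_trans (gv K); apply: ler_mean => // y _.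
  by have /andP[? ?] := c01 K y; rewrite ler_piMr.
have W_sup : has_sup W by split; [eexists; exists 0%N|exists v].
have in_ball : orbit_content (A `&` [set z | mdist p z < r]) <= sup W.
  apply: orbit_content_le; exists (fun K y => g K y * c K y); split => //.
    move=> y [Ay ry] Zy; have [K gK] := gA y Ay Zy.
    have hy : 0 < h y by rewrite lt_max subr_gt0 ry orbT.
    pose N := maxn K (Num.truncn (h y)^-1).+1.
    exists N; have gN : 1 <= g N y by apply: le_trans gK (cover_mono gg y (leq_maxl _ _)).
    rewrite (_ : c N y = 1) ?mulr1//; apply/min_l.
    rewrite -ler_pdivrMr// div1r; apply: le_trans (ltW (truncnS_gt _)) _.
    by rewrite ler_nat leq_maxr.
  by move=> K; apply: ub_le_sup; [exists v|exists K].
apply/ler_addgt0Pr => e e0.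
have [_ [K _ <-] We] := sup_adherent e0 W_sup.
suff : orbit_content (A `&` ~` [set z | mdist p z < r]) <=
    v - mean (fun y => g K y * c K y) by lra.
apply: orbit_content_le; exists (fun n y => g n y * (1 - c K y)).
have b1c : bl (fun y => 1 - c K y) by apply: blB => //; exact: bl_cst.
have gKmon n y : 0 <= g n y * (1 - c K y) <= g n.+1 y * (1 - c K y).
  have /andP[? ?] := c01 K y; have /andP[? ?] := gg n y.
  by rewrite mulr_ge0 ?subr_ge0//= ler_wpM2r// subr_ge0.
(* For these [n], [g n * c K] dominates [g K * c K]; earlier stages are bounded by later ones. *)
have late n : (K <= n)%N ->
    mean (fun y => g n y * (1 - c K y)) <= v - mean (fun y => g K y * c K y).
  move=> Kn; rewrite (_ : (fun y => _) = (fun y => g n y - g n y * c K y)); last first.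
    by apply/funext => y; rewrite mulrBr mulr1.
  rewrite meanB//; apply: lerB => //; apply: ler_mean => // y _.
  by have /andP[? ?] := c01 K y; rewrite ler_wpM2r// cover_mono.
split => //.
- by move=> n; exact: blM.
- move=> y [Ay /negP]; rewrite -leNgt => ry Zy; have [n gn] := gA y Ay Zy.
  exists n; rewrite (_ : c K y = 0) ?subr0 ?mulr1//.
  rewrite /c (_ : h y = 0) ?mulr0; first by rewrite min_r.
  by apply/max_l; rewrite subr_le0.
- move=> n; apply: le_trans (late (maxn K n) (leq_maxl _ _)).
  apply: ler_mean; [exact: blM|exact: blM|].
  move=> y _; have /andP[? ?] := c01 K y.
  by rewrite ler_wpM2r ?subr_ge0// cover_mono// leq_maxr.
Qed.

(** Covers are transported by [S] and by its inverse; for the inverse, recurrence is what keeps [Z]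
    stable. *)
Lemma orbit_content_preimage A : orbit_content (S @^-1` A) = orbit_content A.
Proof.
apply/eqP; rewrite eq_le; apply/andP; split.
  apply: orbit_content_ge => v [g [bg gg gA gv]]; apply: orbit_content_le.
  exists (fun K y => g K (S y)); split => //.
  - by move=> K; exact: (bl_iter 1 (bg K)).
  - by move=> y Ay Zy; apply: gA => //; exact: forward_closureS.
  - by move=> K; rewrite mean_shift.
apply: orbit_content_ge => v [g [bg gg gA gv]]; apply: orbit_content_le.
have bg' K : bl (fun y => g K (S' y)).
  have [[M gM] [L L0 gL]] := bg K; split; first by exists M => y.
  exists L => // y z; apply: le_trans (gL _ _) _.
  by rewrite -iS !(@os_invK _ o).
exists (fun K y => g K (S' y)); split => //.
- by move=> y Ay Zy; apply: gA => //; [rewrite /preimage /= (@os_invK _ o)|exact: SV].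
- move=> K; rewrite -mean_shift//; apply: le_trans (gv K).
  rewrite (_ : (fun y => _) = g K)//.
  by apply/funext => y; rewrite (@os_mapK _ o).
Qed.

End orbit_outer_measure.

Definition orbit_type (R : realType) (o : orbit_system R) : Type := os_space o.

HB.instance Definition _ (R : realType) (o : orbit_system R) :=
  Choice.on (orbit_type o).
HB.instance Definition _ (R : realType) (o : orbit_system R) :=
  isPointed.Build (orbit_type o) (os_point o).

Section orbit_measure.
Context {R : realType}.
Variable o : orbit_system R.
Local Notation Y := (orbit_type o).

(** The closure of a recurrent orbit is a compact monothetic group in which [S] is a translation;
    the measure below corresponds to its Haar measure. *)
Definition haar_outer : {outer_measure set Y -> \bar R} := @orbit_outer R o.

Definition haar_type := caratheodory_type haar_outer.

HB.instance Definition _ := Measurable.on haar_type.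

Definition haar : set haar_type -> \bar R := haar_outer.

HB.instance Definition _ := Measure.on haar.

Lemma haarE A : haar A = (orbit_content A)%:E. Proof. by []. Qed.

Let haar1 : haar setT = 1%E.
Proof. by rewrite haarE orbit_contentT. Qed.

HB.instance Definition _ := Measure_isProbability.Build _ _ _ haar haar1.

End orbit_measure.

(** * Invariance, ergodicity and full support *)

Section haar_dynamics.
Context {R : realType}.
Variable o : orbit_system R.
Local Notation Y := (haar_type o).
Local Notation S := (@os_map R o : Y -> Y).
Local Notation S' := (@os_inv R o : Y -> Y).
Local Notation y0 := (os_point o).
Local Notation Z := (forward_closure (@os_map R o) y0).
Implicit Types A B : set Y.

Let m : probability Y R := @haar R o.

Let iS : Defs.isometry (@os_map R o). Proof. exact: os_isometry. Qed.

Lemma measurable_haar_ball (p : os_space o) (r : R) :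
  measurable ([set z | mdist p z < r] : set Y).
Proof.
apply: (@le_caratheodory_measurable _ _ (haar_outer o)) => A.
by rewrite -EFinD lee_fin; exact: orbit_content_split.
Qed.

Lemma haar_outer_preimage A : haar_outer o (S @^-1` A) = haar_outer o A.
Proof. by congr EFin; exact: orbit_content_preimage. Qed.

Lemma haar_outer_preimageV A : haar_outer o (S' @^-1` A) = haar_outer o A.
Proof.
rewrite -haar_outer_preimage; congr (haar_outer o _).
by apply/funext => y; rewrite /preimage /= (@os_mapK _ o).
Qed.

(** Measurability is the Caratheodory criterion, which invariance of the outer measure under [S] and
    its inverse carries from [A] to its preimage. *)
Lemma measurable_haar_map : measurable_fun setT S.
Proof.
move=> _ A mA; rewrite setTI.
suff cSA : (haar_outer o).-caratheodory (S @^-1` A) by exact: cSA.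
move=> B; rewrite -haar_outer_preimageV ((mA : (haar_outer o).-caratheodory A) (S' @^-1` B)).
rewrite -haar_outer_preimage.
rewrite -[X in (_ + X)%E]haar_outer_preimage.
congr (haar_outer o _ + haar_outer o _)%E;
  by apply/funext => y; rewrite /preimage /setI /setC /= (@os_mapK _ o).
Qed.

Lemma measurable_haar_inv : measurable_fun setT S'.
Proof.
move=> _ A mA; rewrite setTI.
suff cSA : (haar_outer o).-caratheodory (S' @^-1` A) by exact: cSA.
move=> B; rewrite -haar_outer_preimage ((mA : (haar_outer o).-caratheodory A) (S @^-1` B)).
rewrite -haar_outer_preimageV.
rewrite -[X in (_ + X)%E]haar_outer_preimageV.
congr (haar_outer o _ + haar_outer o _)%E;
  by apply/funext => y; rewrite /preimage /setI /setC /= (@os_invK _ o).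
Qed.

Lemma haar_invertible : invertible_mod0 m S.
Proof.
exists setT, S'; split => //.
- by rewrite setCT measure0.
- split => //; first by move=> y z _ _ /(can_inj (@os_mapK _ o)).
  by move=> y _; exists (S' y) => //; exact: (@os_invK _ o).
- exact: measurable_haar_inv.
- by move=> y _; exact: (@os_mapK _ o).
Qed.

Lemma haar_preserving : measure_preserving m S.
Proof. by split; [exact: measurable_haar_map|move=> A _; exact: haar_outer_preimage]. Qed.

(* A cover of [A] by [g] of mean less than [1] splits as [g K] plus a tail of
   small mean; averaging [g K] along orbits makes it almost constant, so the
   averaged tail alone covers the points whose forward orbit stays in [A]. *)
Lemma orbit_content_zero_one A : orbit_content A < 1 ->
  orbit_content [set y : os_space o | forall n, A (iter n S y)] = 0.
Proof.
set A' := [set y | _] => A1.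
apply/eqP; rewrite eq_le orbit_content_ge0 andbT; apply/ler_addgt0Pr => eta eta0.
rewrite add0r; set a := orbit_content A in A1.
(* Where the orbit stays in [A], late averages are at least 1 and those of [g K] at most
   [a + 2 e <= a + k]; the tail is thus at least [1 - a - k = k]. Dividing by [k] gives a cover of
   mean at most [e / k <= eta]. *)
pose k := (1 - a) / 2; have k0 : 0 < k by rewrite divr_gt0// subr_gt0.
pose e := Num.min (k / 2) (eta * k).
have e0 : 0 < e by rewrite lt_min divr_gt0//= mulr_gt0.
have ek : e <= k / 2 by rewrite ge_min lexx.
have eetak : e <= eta * k by rewrite ge_min lexx orbT.
have [v [g [bg gg gA gv]] va] := orbit_content_adherent A e0.
have g0 K y : 0 <= g K y by have /andP[] := gg K y.
have gmono K K' y : (K <= K')%N -> g K y <= g K' y.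
  move=> /subnKC <-; elim: (K' - K)%N => [|n IHn]; first by rewrite addn0.
  by apply: le_trans IHn _; rewrite addnS; have /andP[] := gg (K + n)%N y.
pose W := [set mean (g K) | K in [set: nat]].
have W_sup : has_sup W.
  split; first by eexists; exists 0%N.
  by exists v => _ [K _ <-].
have [_ [K _ <-] WK] := sup_adherent e0 W_sup.
have tail n : mean (g n) - mean (g K) <= e.
  have : mean (g n) <= sup W by apply: ub_le_sup; [case: W_sup|exists n].
  by lra.
have [N N0 HN] := mean_uniform (bg K) e0.
have bt n : bl (fun y => g (K + n)%N y - g K y) by exact: blB.
pose t n := avg N (fun y => g (K + n)%N y - g K y).
have t0 n y : 0 <= t n y.
  rewrite /t /avg mulr_ge0 ?invr_ge0// sumr_ge0// => i _.
  by rewrite subr_ge0 gmono// leq_addr.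
apply: orbit_content_le; exists (fun n y => k^-1 * t n y); split.
- by move=> n; apply/blZ/bl_avg.
- move=> n y; rewrite mulr_ge0 ?invr_ge0 ?(ltW k0)//= ler_wpM2l ?invr_ge0 ?(ltW k0)//.
  rewrite /t /avg ler_wpM2l ?invr_ge0// ler_sum// => i _.
  by rewrite lerD2r gmono// leq_add2l.
- move=> y A'y Zy.
  (* Only [N] iterates are averaged, so a common stage of the cover serves them all. *)
  have [n Hn] : exists n, forall i, (i < N)%N -> 1 <= g (K + n)%N (iter i S y).
    elim: N {HN t t0 N0} => [|i [n Hn]]; first by exists 0%N.
    have [n' gn'] := gA _ (A'y i) (forward_closure_iter iS i Zy).
    exists (maxn n n') => j; rewrite ltnS leq_eqVlt => /orP[/eqP ->|ji].
      apply: le_trans gn' _; apply: gmono.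
      by apply: leq_trans (leq_addl _ _); exact: leq_maxr.
    apply: le_trans (Hn _ ji) _; apply: gmono.
    by rewrite leq_add2l leq_maxl.
  exists n; rewrite mulrC ler_pdivlMr// mul1r.
  have avg1 : 1 <= avg N (g (K + n)%N) y.
    rewrite -(avg_cst 1 y N0) /avg ler_wpM2l ?invr_ge0// ler_sum// => i _.
    exact: Hn.
  have tE : t n y = avg N (g (K + n)%N) y - avg N (g K) y.
    by rewrite /t /avg -mulrBr -sumrB.
  have := HN N y (leqnn N) Zy; rewrite ler_norml => /andP[_].
  have := gv K; rewrite tE; move: ek avg1 va; rewrite /k; lra.
- move=> n; rewrite meanZ; last exact: bl_avg.
  rewrite mean_avg// meanB// mulrC ler_pdivrMr//.
  exact: le_trans (tail _) eetak.
Qed.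

(** Off the null set of points whose orbit meets the symmetric difference of [A] and its preimage, a
    point of [A] stays in [A] forever, and [orbit_content_zero_one] applies. Content 1 makes the
    complement null by additivity. *)
Lemma haar_ergodic : ergodic m S.
Proof.
move=> A mA SA.
have mSA : measurable (S @^-1` A).
  by rewrite -[X in measurable X]setTI; exact: measurable_haar_map.
have mD : measurable (S @^-1` A `+` A).
  by rewrite setY_def; apply: measurableU; exact: measurableD.
have [A1|A1] := ltP (orbit_content A) 1; last first.
  right; have mCA : measurable (~` A) by exact: measurableC.
  have := probability_setC m mA => ->.
  have -> : m A = 1%E.
    by congr EFin; apply/eqP; rewrite eq_le A1 orbit_content_le1.
  by rewrite subee.
left; have A'0 := orbit_content_zero_one A1.
pose D n := iter n S @^-1` (S @^-1` A `+` A).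
have D0 n : m.-negligible (D n).
  elim: n => [|n [N [mN N0 DN]]]; first by exists (S @^-1` A `+` A); split.
  exists (S @^-1` N); split.
  - by rewrite -[X in measurable X]setTI; exact: measurable_haar_map.
  - by have [_ ->] := haar_preserving.
  - by move=> y; rewrite /D /preimage /= -iterS iterSr => /DN.
have mSn n : measurable_fun setT (iter n S).
  elim: n => [|n IHn]; first exact: measurable_id.
  exact: measurableT_comp measurable_haar_map IHn.
pose A' : set Y := \bigcap_n (iter n S @^-1` A).
have A'N : m.-negligible A'.
  apply/negligibleP.
    apply: bigcapT_measurable => n.
    by rewrite -[X in measurable X]setTI; exact: mSn.
  congr EFin; rewrite -A'0; congr orbit_content.
  by apply/seteqP; split => [y A'y n|y A'y n _]; [exact: A'y|exact: A'y].
apply: measure_negligible => //.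
apply: (negligibleS _ (negligibleU A'N (negligible_bigcup D0))) => y Ay.
have [A'y|nA'y] := pselect (A' y); [by left|right].
apply: contrapT => nD; apply: nA'y => n _; elim: n => // n IHn.
apply: contrapT => nAn; apply: nD; exists n => //.
have : (S @^-1` A `+` A) (iter n S y) by rewrite setY_def; right.
by [].
Qed.

(** By recurrence every point of [Z] enters the ball at some time; were the ball null, [Z] would lie
    in a countable union of null preimages, against its full content. *)
Lemma haar_ball_gt0 k (r : R) : 0 < r ->
  m ([set z | mdist (iter k (@os_map R o) y0) z < r] : set Y) <> 0%E.
Proof.
move=> r0 B0; set B := [set z | _] in B0.
have mB : measurable (B : set Y) by exact: measurable_haar_ball.
have Bn0 n : m.-negligible (iter n S @^-1` B).
  elim: n => [|n [N [mN N0 DN]]]; first by exists B; split.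
  exists (S @^-1` N); split.
  - by rewrite -[X in measurable X]setTI; exact: measurable_haar_map.
  - by have [_ ->] := haar_preserving.
  - by move=> y; rewrite /preimage /= -iterS iterSr => /DN.
have [N [mN N0 BN]] := negligible_bigcup Bn0.
have ZN : Z `<=` N.
  move=> z Zz; apply: BN.
  have [n nz] := forward_closure_return iS (@os_recurrent _ o) Zz r0.
  exists (k + n.+1)%N => //.
  rewrite /B /preimage /= metric_sym.
  by rewrite [iter (k + n.+1) _ _](iterD k n.+1) (isometry_iter iS).
have := orbit_content_support ZN.
have N0' : (orbit_content N)%:E = 0%E := N0.
by case: N0' => -> /eqP; rewrite eq_sym oner_eq0.
Qed.

End haar_dynamics.

(** * Weak mixing and isometric factors *)

Section recurrence.
Context {R : realType} {d : measure_display} {X : measurableType d}.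
Variables (mu : {measure set X -> \bar R}) (T : X -> X).
Hypothesis mT : measurable_fun setT T.
Hypothesis wm : weakly_mixing mu T.
Hypothesis muT0 : mu setT <> 0%E.
Context {Y : metricType R}.
Variables (S : Y -> Y) (phi : X -> Y) (y0 : Y).
Hypothesis iS : Defs.isometry S.
Hypothesis bphi : borel_map phi.
Hypothesis phiT : {ae mu, forall x, S (phi x) = phi (T x)}.
Hypothesis near0 :
  {ae mu, forall x, forall e, 0 < e -> orbit_near S e y0 (phi x)}.

(** The parity of [j + k] is that of the position [j - k] of [z] along the two-sided orbit of
    [y0]. *)
Let near_parity (b : bool) (e : R) (z : Y) := exists j k,
  odd (j + k) = b /\ mdist (iter j S y0) (iter k S z) < e.

Let open_near_parity b e : open [set z | near_parity b e z].
Proof.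
rewrite (_ : [set z | _] = \bigcup_j \bigcup_(k in [set k | odd (j + k) = b])
    (iter k S @^-1` [set z | mdist (iter j S y0) z < e])).
  apply: bigcup_open => j _; apply: bigcup_open => k _.
  apply: open_comp; last exact: open_mdist_lt.
  by move=> z _; exact: continuous_iter_isometry.
apply/seteqP; split => [z [j [k [jk yz]]]|z [j _ [k jk yz]]]; last by exists j, k.
by exists j => //; exists k.
Qed.

Let near_parityS b e z : near_parity b e (S z) <-> near_parity (~~ b) e z.
Proof.
split=> -[j [k [jk yz]]].
  by exists j, k.+1; split; [rewrite addnS /= jk|rewrite iterSr].
exists j.+1, k; rewrite addSn /= jk negbK; split => //.
by rewrite -iterSr /= iS.
Qed.

(* Otherwise the orbit of [y0] is discrete and infinite, and the parity along it
   is a factor exchanging two points. *)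
Lemma weakly_mixing_recurrent : recurrent S y0.
Proof.
apply: contrapT => /existsNP[e /not_implyP[e0 /forallNP nrec]].
have far n : e <= mdist (iter n.+1 S y0) y0 by rewrite leNgt; exact/negP/nrec.
have e2 : 0 < e / 2 by rewrite divr_gt0.
pose B b : set X := phi @^-1` [set z | near_parity b (e / 2) z].
have mB b : measurable (B b) by apply: bphi; exact: borel_open (@open_near_parity b _).
have BT b : {ae mu, forall x, B b (T x) <-> B (~~ b) x}.
  by apply: filterS phiT => x xT; rewrite /B /preimage /= -xT; exact: near_parityS.
(* No parity contradicts the nearness to the orbit. Both parities bring two distinct iterates of
   [y0] within [e] of each other, hence a return excluded by [far]. *)
have [h|h] := weakly_mixing_swap mT wm (mB false) (mB true) (BT false) (BT true).
  have [x [xnear [nF nT]]] := ae_exists_nonnull muT0 (filterI near0 h).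
  have [j [k jk]] := xnear _ e2.
  case: (boolP (odd (j + k))) => o; first by apply: nT; exists j, k.
  by apply: nF; exists j, k; split => //; exact/negbTE.
have [x [[j [k [jk yz]]] [j' [k' [jk' yz']]]]] := ae_exists_nonnull muT0 h.
have h1 : mdist (iter (k' + j) S y0) (iter (k' + k) S (phi x)) < e / 2.
  by rewrite !iterD isometry_iter.
have h2 : mdist (iter (k' + k) S (phi x)) (iter (k + j') S y0) < e / 2.
  by rewrite metric_sym [(k' + k)%N]addnC !iterD isometry_iter.
have := le_lt_trans (metric_triangle _ _ _) (ltrD h1 h2); rewrite -splitr.
have neq : (k' + j)%N <> (k + j')%N.
  move=> /(congr1 odd); rewrite !oddD; move: jk jk'; rewrite !oddD.
  by case: (odd j); case: (odd k); case: (odd j'); case: (odd k').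
have key a b : (a < b)%N -> e <= mdist (iter a S y0) (iter b S y0).
  move=> ab; rewrite metric_sym -(subnKC (ltnW ab)) iterD isometry_iter//.
  by have := far (b - a).-1; rewrite prednK// subn_gt0.
move=> lt; have [ab|ab|//] := ltngtP (k' + j) (k + j').
  by have := key _ _ ab; rewrite leNgt lt.
by have := key _ _ ab; rewrite metric_sym leNgt lt.
Qed.

End recurrence.

Section compact_orbit_closure.
Context {R : realType} {d : measure_display} {X : measurableType d}.
Variables (mu : {measure set X -> \bar R}) (T : X -> X).
Hypothesis mT : measurable_fun setT T.
Hypothesis wm : weakly_mixing mu T.
Hypothesis muT0 : mu setT <> 0%E.
Variable o : orbit_system R.
Local Notation Y := (os_space o).
Local Notation S := (@os_map R o).
Local Notation y0 := (os_point o).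
Local Notation Z := (forward_closure S y0).
Local Notation H := (haar_type o).
Variable phi : X -> Y.
Hypothesis bphi : borel_map phi.
Hypothesis phiT : {ae mu, forall x, S (phi x) = phi (T x)}.
Hypothesis phiZ : {ae mu, forall x, Z (phi x)}.

Let iS : Defs.isometry S. Proof. exact: os_isometry. Qed.
Let m : probability H R := @haar R o.

(** A measurable form of [d(phi x, z) < e]: the distance is split at a point of the orbit of [y0]
    and a rational, which gives countably many rectangles. The iterate [k] makes the union
    invariant. *)
Let E (e : R) : set (X * H) := \bigcup_j \bigcup_k \bigcup_q
  ([set x | mdist (iter j S y0) (iter k S (phi x)) < ratr q] `*`
   [set z : H | mdist (iter j S y0) (iter k S z) < e - ratr q]).

Let mE e : measurable (E e).
Proof.
apply: bigcupT_measurable => j; apply: bigcupT_measurable => k.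
apply: countable_bigcupT_measurable => // q; apply: measurableX.
  apply: (bphi (B := iter k S @^-1` [set z | mdist (iter j S y0) z < ratr q])).
  apply: borel_open; apply: open_comp; last exact: open_mdist_lt.
  by move=> z _; exact: continuous_iter_isometry.
have mSk : measurable_fun setT (iter k S : H -> H).
  elim: k => [|k IHk]; first exact: measurable_id.
  exact: measurableT_comp (@measurable_haar_map _ o) IHk.
have := mSk measurableT _ (@measurable_haar_ball _ o (iter j S y0) (e - ratr q)).
by rewrite setTI.
Qed.

Let E_dist e x z : E e (x, z) -> mdist (phi x) z < e.
Proof.
move=> [j _ [k _ [q _ [/= xq zq]]]]; rewrite -(isometry_iter iS k).
apply: le_lt_trans (metric_triangle _ (iter j S y0) _) _.
by rewrite metric_sym -[e](subrKC (ratr q)) ltrD.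
Qed.

Let E_invariant e x z : S (phi x) = phi (T x) -> E e (T x, S z) <-> E e (x, z).
Proof.
move=> xT; split=> -[j _ [k _ [q _ [/= xq zq]]]].
  exists j => //; exists k.+1 => //; exists q => //.
  by split; rewrite /= -iterS iterSr ?xT.
exists j.+1 => //; exists k => //; exists q => //.
by split; rewrite /= -?xT -iterSr /= iS.
Qed.

(** The section contains a ball around an iterate of [y0] close to [phi x]. *)
Let E_nonnull e x : 0 < e -> Z (phi x) -> m (xsection (E e) x) <> 0%E.
Proof.
move=> e0 Zx; have e2 : 0 < e / 2 by rewrite divr_gt0.
have [j jx] := Zx _ e2; have [q] := rat_in_itvoo jx.
rewrite in_itv /= => /andP[xq qe] E0.
apply: (@haar_ball_gt0 _ o j (e - ratr q)); first by lra.
apply: measure_negligible; first exact: measurable_haar_ball.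
exists (xsection (E e) x); split => //; first exact: measurable_xsection.
move=> z zj; rewrite /xsection /= inE.
by exists j => //; exists 0%N => //; exists q.
Qed.

Let E_conull e : 0 < e -> {ae mu, forall x, m (xsection (~` E e) x) = 0%E}.
Proof.
move=> e0.
have mF : measurable_fun setT (fun p : X * H => (T p.1, (S : H -> H) p.2)).
  by apply: measurable_fun_pair; [exact: measurableT_comp mT measurable_fst|
     exact: measurableT_comp (@measurable_haar_map _ o) measurable_snd].
have mFE : measurable ((fun p : X * H => (T p.1, (S : H -> H) p.2)) @^-1` E e).
  by rewrite -[X in measurable X]setTI; exact: mF.
have mFEE : measurable ((fun p : X * H => (T p.1, (S : H -> H) p.2)) @^-1` E e `+` E e).
  by rewrite setY_def; apply: measurableU; exact: measurableD.
have [|E0|E0] := wm (@haar_invertible _ o) (@haar_preserving _ o) (@haar_ergodic _ o) (mE e).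
- apply/(product_null _ m mFEE); apply: filterS phiT => x xT.
  rewrite (_ : xsection _ x = set0) ?measure0//.
  apply/seteqP; split => // z; rewrite /xsection /= inE setY_def.
  have := @E_invariant e x z xT.
  by move=> Exz [[/= h1 h2]|[/= h1 h2]]; apply: h2; apply/Exz.
- move/(product_null _ m (mE e)) : E0 => E0.
  by have [x [xE xZ]] := ae_exists_nonnull muT0 (filterI E0 phiZ); case: (E_nonnull e0 xZ).
- exact/(product_null _ m (measurableC (mE e))).
Qed.

Lemma weakly_mixing_compact_constant : exists c, {ae mu, forall x, phi x = c}.
Proof.
have H0 : {ae mu, forall x, forall n, m (xsection (~` E n.+1%:R^-1) x) = 0%E}.
  by apply: ae_foralln => n; apply: E_conull; rewrite invr_gt0.
have [x0 Hx0] := ae_exists_nonnull muT0 H0.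
exists (phi x0); apply: filterS H0 => x Hx.
apply: mdist_positivity; apply/eqP; rewrite eq_le mdist_ge0 andbT.
apply/ler_addgt0Pr => e e0; rewrite add0r.
pose n := Num.truncn (2 / e).
have ne : n.+1%:R^-1 < e / 2.
  by rewrite invf_plt ?posrE ?ltr0n ?divr_gt0// invf_div truncnS_gt.
pose C z := xsection (~` E n.+1%:R^-1) z.
have mC z : measurable (C z) by apply: measurable_xsection; exact: measurableC.
(* Two null sets do not cover a probability space, so some [z] is close to both [phi x] and
   [phi x0]. *)
have [z [Cx Cx0]] : exists z, ~ C x z /\ ~ C x0 z.
  apply: contrapT => /forallNP nz.
  have CU : C x `|` C x0 = setT.
    apply/seteqP; split => // z _; apply: contrapT => nC; apply: (nz z).
  by split => h; apply: nC; [left|right].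
  have : m (C x `|` C x0) = 0%E.
    apply: measure_negligible; first exact: measurableU.
    apply: negligibleU; first by apply/negligibleP; [exact: mC|exact: Hx].
    by apply/negligibleP; [exact: mC|exact: Hx0].
  by rewrite CU probability_setT => /eqP; rewrite onee_eq0.
have CE w : ~ C w z -> mdist (phi w) z < n.+1%:R^-1.
  by move=> nC; apply: E_dist; apply: contrapT => nE; apply: nC; rewrite /C /xsection /= inE.
apply: le_trans (metric_triangle _ z _) _; rewrite (splitr e) lerD//.
  exact: ltW (lt_trans (CE _ Cx) ne).
by rewrite metric_sym; exact: ltW (lt_trans (CE _ Cx0) ne).
Qed.

End compact_orbit_closure.

Lemma weakly_mixing_LCEIC (R : realType) (d : measure_display)
    (X : measurableType d) (mu : {measure set X -> \bar R}) (T : X -> X) :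
  standard_borel R X -> measurable_fun setT T -> weakly_mixing mu T -> LCEIC mu T.
Proof.
move=> sbX mT wm Y S phi lcY [S' SK S'K] iS bphi phiT.
(* For the zero measure any value of [phi] will do; [point] supplies one. *)
have [muT0|muT0] := pselect (mu setT = 0%E).
  by exists (phi point); exact: measure0_ae.
have erg := weakly_mixing_ae_ergodic mT wm.
have [y0 near0] := essential_orbit muT0 sbX erg iS bphi phiT.
have rec := weakly_mixing_recurrent mT wm muT0 iS bphi phiT near0.
pose o := OrbitSystem SK S'K iS rec (compact_forward_closure iS rec lcY).
apply: (@weakly_mixing_compact_constant _ _ _ _ _ mT wm muT0 o) => //.
by apply: filterS near0 => x; exact: orbit_near_forward_closure.
Qed.

Theorem proposition5p2 (R : realType) (d : measure_display)
    (X : measurableType d) (mu : {sigma_finite_measure set X -> \bar R})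
    (T : X -> X)
    (hX : standard_borel R X) (hmu : nonatomic mu)
    (hinv : invertible_mod0 mu T) (hns : nonsingular mu T) :
  LCEIC mu T <-> weakly_mixing mu T.
Proof.
split; first exact: LCEIC_weakly_mixing.
by apply: weakly_mixing_LCEIC => //; case: hns.
Qed.
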